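(* Let $\{(X,Y),(X_i,Y_i):i\in\mathbb{N}\}$ be real-valued i.i.d. random vectors following a common bivariate Farlie-Gumbel-Morgenstern (FGM) distribution with parameter $r\in[-1,1]$, where $F$ is the marginal distribution of the $X_i$ and $G$ is the marginal distribution of the $Y_i$. Let $\{(R_i,\widetilde R_i):i\in\mathbb{N}\}$ be positive random vectors such that $\{(X,Y),(X_i,Y_i):i\in\mathbb{N}\}$ and $\{(R_i,\widetilde R_i):i\in\mathbb{N}\}$ are mutually independent. Fix $n\in\mathbb{N}$ and suppose there are constants $0<a_1\le b_1<\infty$, $0<a_2\le b_2<\infty$ with $\mathbb{P}\left(\prod_{k=1}^iR_k\in[a_1,b_1],\ \prod_{k=1}^j\widetilde R_k\in[a_2,b_2]\right)=1$ for all $1\le i,j\le n$. Let $$D_1(n)=\sum_{i=1}^nX_i\prod_{k=1}^iR_k,\qquad D_2(n)=\sum_{i=1}^nY_i\prod_{k=1}^i\widetilde R_k,\qquad D_{\text{sum}}(x,y;n)=\mathbb{P}\left(D_1(n)+D_2(n)>x+y\right).$$ If $F,G\in\widetilde{\mathscr S}_2$ and $F(x,x+1]\asymp G(x,x+1]$ as $x\to\infty$, then, with $z=x+y$, as $(x,y)\to(\infty,\infty)$, \begin{align*} D_{\text{sum}}(x,y;n) &=\sum_{i=1}^n\mathbb{P}\left(X_i\prod_{k=1}^iR_k>z\right)+\mu_F\sum_{1\le i\ne l\le n}\mathbb{E}\left[\prod_{k=1}^iR_k\,\mathbf{1}_{\left\{X_l\prod_{k=1}^lR_k\in(z,z+1]\right\}}\right]\\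 &\quad+\sum_{j=1}^n\mathbb{P}\left(Y_j\prod_{k=1}^j\widetilde R_k>z\right)+\mu_G\sum_{1\le j\ne l\le n}\mathbb{E}\left[\prod_{k=1}^j\widetilde R_k\,\mathbf{1}_{\left\{Y_l\prod_{k=1}^l\widetilde R_k\in(z,z+1]\right\}}\right]\\ &\quad+\sum_{i=1}^n\sum_{j=1}^n\left(\mathbb{E}\left[X_i\prod_{k=1}^iR_k\,\mathbf{1}_{\left\{Y_j\prod_{k=1}^j\widetilde R_k\in(z,z+1]\right\}}\right]+\mathbb{E}\left[Y_j\prod_{k=1}^j\widetilde R_k\,\mathbf{1}_{\left\{X_i\prod_{k=1}^iR_k\in(z,z+1]\right\}}\right]\right)\\ &\quad+o\left(\sum_{i=1}^n\mathbb{P}\left(X_i\prod_{k=1}^iR_k\in(z,z+1]\right)+\sum_{j=1}^n\mathbb{P}\left(Y_j\prod_{k=1}^j\widetilde R_k\in(z,z+1]\right)\right). \end{align*}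
   Context: Notation: for a distribution function $F$, $\overline F=1-F$ (assumed $>0$ on $(0,\infty)$), $F(x,x+t]=F(x+t)-F(x)$, and $\mu_F$ is the mean of $F$. Sums over $1\le i\ne l\le n$ run over ordered pairs $(i,l)$ of distinct indices; empty sums are $0$. $f\sim g$ means $f/g\to1$; $f\asymp g$ means $f=O(g)$ and $g=O(f)$. No dependence restriction is imposed among the $R_i,\widetilde R_i$. FGM distribution: the bivariate FGM distribution with marginals $F,G$ and parameter $r\in[-1,1]$ has joint distribution function $\Pi(x,y)=F(x)G(y)\left(1+r\overline F(x)\overline G(y)\right)$. Class $\mathscr L_\Delta$: a distribution $F$ belongs to $\mathscr L_\Delta$ if for every $t>0$, $F(x+y,x+y+t]\sim F(x,x+t]$ as $x\to\infty$ uniformly in $y\in[0,1]$. Class $\mathscr S_2$: a distribution $F$ on $[0,\infty)$ with finite mean $\mu_F$ belongs to $\mathscr S_2$ if $F\in\mathscr L_\Delta$ and $\overline{F^{2*}}(x)-2\overline F(x)\sim 2\mu_F F(x,x+1]$ as $x\to\infty$, where $F^{2*}$ is the convolution of $F$ with itself. Class $\widetilde{\mathscr S}_2$: a distribution $F$ on $(-\infty,\infty)$ with finite mean belongs to $\widetilde{\mathscr S}_2$ if $F^+\in\mathscr S_2$, where $F^+(x)=F(x)\mathbf{1}_{\{x\ge0\}}$, and $x\mapsto F(x,x+1]$ is almost decreasing, i.e. ultimately positive with $\sup_{y\ge x}F(y,y+1]\asymp F(x,x+1]$ as $x\to\infty$. *)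

(* Defs.v *)
From HB Require Import structures.
From mathcomp Require Import all_boot all_order all_algebra.
From mathcomp Require Import all_classical all_reals all_analysis.
From mathcomp Require Import measurable_realfun.

Set Implicit Arguments.
Unset Strict Implicit.
Unset Printing Implicit Defensive.

Import Order.TTheory GRing.Theory Num.Theory.
Import numFieldNormedType.Exports.

Local Open Scope classical_set_scope.
Local Open Scope ring_scope.

(* A distribution on the line is a probability measure F on R, and [dfun F] is
   its distribution function; the law of a random variable X is
   [distribution P X]. *)

Section distributions.
Context {R : realType}.
Implicit Types F G : probability R R.

Definition dfun F (x : R) : R := fine (F `]-oo, x]%classic).

Definition dtail F (x : R) : R := 1 - dfun F x.

(* F(x, x + t] = F(x + t) - F(x) *)
Definition dincr F (x t : R) : R := dfun F (x + t) - dfun F x.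

Definition has_finite_mean F : Prop :=
  F.-integrable [set: R] (fun x => x%:E).

(* Junk value if F has no finite mean. *)
Definition mean F : R := fine (\int[F]_x x%:E)%E.

(* The limit forces g(x) != 0 for large x, since division by 0 yields 0; the
   same applies to the ratio in [class_LDelta] (take y = 0). *)
Definition asymp_equiv (f g : R -> R) : Prop :=
  f x / g x @[x --> +oo] --> (1 : R).

(* Landau comparisons along a filter, spelled out as in the landau library. *)
Definition big_O {S : Type} (H : set_system S) (f g : S -> R) : Prop :=
  exists2 C : R, 0 < C & \forall s \near H, `|f s| <= C * `|g s|.

Definition little_o {S : Type} (H : set_system S) (f g : S -> R) : Prop :=
  forall e : R, 0 < e -> \forall s \near H, `|f s| <= e * `|g s|.

Definition same_order (f g : R -> R) : Prop :=
  big_O (pinfty_nbhs R) f g /\ big_O (pinfty_nbhs R) g f.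

(* Joint distribution function of the bivariate FGM law. *)
Definition FGM (r : R) F G (x y : R) : R :=
  dfun F x * dfun G y * (1 + r * (dtail F x * dtail G y)).

Definition addR2 (p : R * R) :
  R := p.1 + p.2.

Lemma measurable_addR2 : measurable_fun [set: _] addR2.
Proof. by apply: measurable_funD. Qed.

HB.instance Definition _ :=
  isMeasurableFun.Build _ _ _ _ addR2 measurable_addR2.

(* F * G: law of the sum of independent variables with laws F and G. *)
Definition convolution F G := distribution (F \x G)%E addR2.

Definition posR (x : R) : R := Num.max x 0.

Lemma measurable_posR : measurable_fun [set: _] posR.
Proof. by apply: measurable_maxr. Qed.

HB.instance Definition _ :=
  isMeasurableFun.Build _ _ _ _ posR measurable_posR.

(* F^+, the image of F under x |-> max(x, 0); [dfun_pos_part] below shows that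
   its distribution function is F(x) 1_{x >= 0}. *)
Definition pos_part F := distribution F posR.

Lemma dfun_pos_part F (x : R) :
  dfun (pos_part F) x = dfun F x * \1_(`[0, +oo[%classic : set R) x.
Proof.
rewrite /dfun /pos_part /distribution /pushforward /= indicE.
have [x0|x0] := leP 0 x.
  rewrite mem_set/= ?in_itv/= ?andbT// mulr1; congr fine; congr (Probability.sort F _).
  by apply/seteqP; split=> y /=; rewrite !in_itv/= /posR ge_max x0 andbT.
rewrite memNset/= ?in_itv/= ?andbT ?leNgt ?x0// mulr0.
rewrite -[RHS]/(fine 0%E) -(measure0 F); congr fine.
congr (Probability.sort F _); apply/seteqP; split=> y //=.
by rewrite in_itv/= /posR ge_max => /andP[_]; rewrite leNgt x0.
Qed.

Definition class_LDelta F : Prop :=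
  forall t : R, 0 < t -> forall e : R, 0 < e ->
    \forall x \near +oo, forall y : R, 0 <= y <= 1 ->
      `|dincr F (x + y) t / dincr F x t - 1| < e.

Definition class_S2 F : Prop :=
  [/\ F `]-oo, 0[%classic = 0%E, has_finite_mean F, class_LDelta F &
      asymp_equiv (fun x => dtail (convolution F F) x - 2 * dtail F x)
                  (fun x => 2 * mean F * dincr F x 1)].

Definition almost_decreasing (f : R -> R) : Prop :=
  (\forall x \near +oo, 0 < f x) /\
  same_order (fun x => sup [set f y | y in `[x, +oo[]) f.

Definition class_S2tilde F : Prop :=
  [/\ has_finite_mean F, class_S2 (pos_part F) &
      almost_decreasing (fun x => dincr F x 1)].

End distributions.

Section independence.
Context {d : measure_display} {T : measurableType d} {R : realType}.
Variable P : probability T R.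

(* Mutual independence of the family of all Z i: product rule over every
   finite subfamily. *)
Definition mutually_independent d' (T' : measurableType d') (I : choiceType)
    (Z : I -> T -> T') : Prop :=
  forall (s : seq I) (B : I -> set T'), uniq s ->
    (forall i, measurable (B i)) ->
    P (\big[setI/setT]_(i <- s) (Z i @^-1` B i)) =
    (\prod_(i <- s) P (Z i @^-1` B i))%E.

(* The sigma-algebra generated by the Z i with i in D. *)
Definition family_sigma d' (T' : measurableType d') (I : Type) (D : set I)
    (Z : I -> T -> T') : set (set T) :=
  <<s [set A | exists i B, [/\ D i, measurable B & A = Z i @^-1` B]] >>.

Definition independent_families d1 (T1 : measurableType d1)
    d2 (T2 : measurableType d2) (I J : Type) (D : set I) (E : set J)
    (Z : I -> T -> T1) (W : J -> T -> T2) : Prop :=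
  forall A B, family_sigma D Z A -> family_sigma E W B ->
    P (A `&` B) = (P A * P B)%E.

(* Real-valued probability, and E[U 1_A]. *)
Definition prob (A : set T) : R := fine (P A).

Definition expect_on (U : T -> R) (A : set T) : R :=
  fine ('E_P[fun w => (U w * \1_A w)%R])%E.

End independence.

Section discounted_sums.
Context {T : Type} {R : realType}.

(* Indices start from 1, so the entries Q 0 and X 0 do not occur. *)
Definition discount (Q : nat -> T -> R) (i : nat) (w : T) : R :=
  \prod_(1 <= k < i.+1) Q k w.

(* X_i * prod_(k <= i) Q_k *)
Definition discounted (X Q : nat -> T -> R) (i : nat) (w : T) : R :=
  X i w * discount Q i w.

Definition discounted_sum (X Q : nat -> T -> R) (n : nat) (w : T) : R :=
  \sum_(1 <= i < n.+1) discounted X Q i w.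

(* The event {V in (z, z + 1]} *)
Definition in_window (V : T -> R) (z : R) : set T := [set w | z < V w <= z + 1].

End discounted_sums.

(* Main.v *)
(** Work relative to the law Phi of F^+ and the scale D(z) = Phi(z, z + 1].
A family of tails T is regular, with window h = O(D), if
T(z - x) = T(z) + x h(z) + o(D(z)) locally uniformly in x and uniformly over the
family.  The class S_2 forces the event that two independent copies of Phi are
both far from 0 and from z while their sum exceeds z to have probability o(D(z)).
That event only sees increments of the tails, so the same bound holds for any
independent A and B with regular tails and uniformly integrable laws, whence
P(A + B > z) = P(A > z) + P(B > z) + E[A] h_B(z) + E[B] h_A(z) + o(D(z)).
The FGM law is a convex combination of four products of laws of minima and maxima
of two independent copies, whose tails are again regular; this yields the
expansion for one pair (c X_i, e Y_i), and adding the independent pairs one at a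
time yields it for weighted sums.  Everything is uniform over weights in a box:
dividing by the largest weight brings the weights into [a, 1], where the almost
decreasing scale controls the dilations, and the term carrying the largest weight
keeps the error scale at least of order D.  Integrating the uniform estimate over
the law of the independent random weights concludes. *)
Require Import Defs.
From HB Require Import structures.
From mathcomp Require Import all_boot all_order all_algebra.
From mathcomp Require Import all_classical all_reals all_analysis.
From mathcomp Require Import measurable_realfun ring lra.

Set Implicit Arguments.
Unset Strict Implicit.
Unset Printing Implicit Defensive.

Import Order.TTheory GRing.Theory Num.Theory.
Import numFieldNormedType.Exports.

Local Open Scope classical_set_scope.
Local Open Scope ring_scope.

(** * Asymptotics relative to a scale *)

(** Regularity is the notion that survives all later operations. The window of a regular family
    changes by o(D) under bounded shifts, so a product of a mean and a window adds nothing to the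
    increments of a tail: windows simply add up under convolution, and an expansion of a sum is
    itself a proof that the sum can be used in the next step. A window is only determined up to
    o(D), so it may be taken as s (T(z) - T(z + 1/s)) for any s in a compact part of (0, oo); with s
    the largest weight, undoing the normalisation turns it into the probability of an interval (z, z
    + 1]. The weights may depend on one another in any way, so they can only be frozen and restored
    at the end; this is why every estimate is about a family indexed by p. In the FGM law r F (1 -
    F) G (1 - G) is a signed perturbation; minima and maxima turn it into genuine probability laws,
    with weights that are nonnegative exactly for |r| <= 1. Within one pair the coordinates stay
    dependent, and the cross expectations with equal indices never factor. *)

Section window_calculus.
Context {R : realType}.
Variable D : R -> R.

(** The factor 2 is just a fixed constant that lets an error of order [D (z - x)] count as one of
    order [D z]. The third clause serves arguments z / c with c <= 1 and increments over long
    intervals. *)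
Record scale_function : Prop := ScaleFunction {
  scale_gt0 : \forall z \near +oo, 0 < D z;
  scale_shift : forall M, \forall z \near +oo,
    forall x, `|x| <= M -> D (z - x) <= 2 * D z;
  scale_almost_decreasing : exists2 C, 0 < C &
    \forall z \near +oo, forall y, z <= y -> D y <= C * D z }.

Definition negl (I : Type) (f : I -> R -> R) : Prop :=
  forall e, 0 < e -> \forall z \near +oo, forall p, `|f p z| <= e * D z.

Definition dominated (I : Type) (f : I -> R -> R) : Prop :=
  exists2 C, 0 < C & \forall z \near +oo, forall p, `|f p z| <= C * D z.

(** [h] acts as the derivative of -[T] seen at bounded distances. Its bound by [D] is used when a
    mean is replaced by a truncated mean and when increments of [T] are compared with those of the
    reference tail. *)
Definition regular (I : Type) (T h : I -> R -> R) : Prop :=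
  dominated h /\
  forall M e, 0 < e -> \forall z \near +oo, forall p x, `|x| <= M ->
    `|T p (z - x) - T p z - x * h p z| <= e * D z.

Definition bounded (I : Type) (m : I -> R) : Prop :=
  exists2 B, 0 < B & forall p, `|m p| <= B.

Lemma near_window (Q : R -> Prop) (M : R) : (\forall z \near +oo, Q z) ->
  \forall z \near +oo, forall x, `|x| <= M -> Q (z - x).
Proof.
move=> [a [_ aQ]]; exists (a + M); split; first by rewrite num_real.
by move=> z /= az x; rewrite ler_norml => /andP[? ?]; apply: aQ; lra.
Qed.

Lemma eq_negl (I : Type) (f g : I -> R -> R) :
  (\forall z \near +oo, forall p, f p z = g p z) -> negl f -> negl g.
Proof.
move=> fg nf e e0; near=> z => p.
rewrite -(near fg z) //; move: p; near: z; exact: nf.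
Unshelve. all: by end_near. Qed.

Lemma neglD (I : Type) (f g : I -> R -> R) :
  negl f -> negl g -> negl (fun p z => f p z + g p z).
Proof.
move=> nf ng e e0; have e20 : 0 < e / 2 by lra.
near=> z => p; rewrite (le_trans (ler_normD _ _))//.
have : `|f p z| <= e / 2 * D z by move: p; near: z; exact: nf.
have : `|g p z| <= e / 2 * D z by move: p; near: z; exact: ng.
lra.
Unshelve. all: by end_near. Qed.

Lemma neglM (I : Type) (m : I -> R) (f : I -> R -> R) :
  bounded m -> negl f -> negl (fun p z => m p * f p z).
Proof.
move=> [B B0 mB] nf e e0; have eB0 : 0 < e / B by rewrite divr_gt0.
near=> z => p; rewrite normrM.
have fz : `|f p z| <= e / B * D z by move: p; near: z; exact: nf.
rewrite (le_trans (ler_pM _ _ (mB p) fz))//.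
by rewrite mulrA [B * _]mulrC divfK ?gt_eqF.
Unshelve. all: by end_near. Qed.

Lemma neglN (I : Type) (f : I -> R -> R) :
  negl f -> negl (fun p z => - f p z).
Proof.
by move=> nf e e0; near=> z => p; rewrite normrN; move: p; near: z; exact: nf.
Unshelve. all: by end_near. Qed.

Lemma negl_sum (I : Type) (J : eqType) (s : seq J) (Q : pred J)
    (f : J -> I -> R -> R) : scale_function ->
  (forall j, j \in s -> negl (f j)) ->
  negl (fun p z => \sum_(j <- s | Q j) f j p z).
Proof.
move=> Dp; elim: s => [|j s IH] nf.
  move=> e e0; near=> z => p; rewrite big_nil normr0 mulr_ge0 ?ltW//.
  by near: z; exact: scale_gt0.
have ns : negl (fun p z => \sum_(j <- s | Q j) f j p z).
  by apply: IH => k ks; apply: nf; rewrite inE ks orbT.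
have := nf j (mem_head _ _).
case: (boolP (Q j)) => Qj nj; last first.
  by apply: eq_negl ns; apply: nearW => z p; rewrite big_cons (negbTE Qj).
by apply: eq_negl (neglD nj ns); apply: nearW => z p; rewrite big_cons Qj.
Unshelve. all: by end_near. Qed.

Lemma eq_dominated (I : Type) (f g : I -> R -> R) :
  (\forall z \near +oo, forall p, f p z = g p z) -> dominated f -> dominated g.
Proof.
move=> fg [C C0 df]; exists C => //; near=> z => p.
rewrite -(near fg z) //; move: p; near: z; exact: df.
Unshelve. all: by end_near. Qed.

Lemma dominatedD (I : Type) (f g : I -> R -> R) :
  dominated f -> dominated g -> dominated (fun p z => f p z + g p z).
Proof.
move=> [A A0 df] [B B0 dg]; exists (A + B); first by lra.
near=> z => p; rewrite (le_trans (ler_normD _ _))// mulrDl.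
by rewrite lerD//; move: p; near: z.
Unshelve. all: by end_near. Qed.

Lemma dominatedM (I : Type) (m : I -> R) (f : I -> R -> R) :
  bounded m -> dominated f -> dominated (fun p z => m p * f p z).
Proof.
move=> [B B0 mB] [A A0 df]; exists (B * A); first by rewrite mulr_gt0.
near=> z => p; rewrite normrM -mulrA ler_pM//; move: p; near: z; exact: df.
Unshelve. all: by end_near. Qed.

Lemma negl_dominated (I : Type) (f : I -> R -> R) : negl f -> dominated f.
Proof. by move=> nf; exists 1 => //; exact: nf. Qed.

Lemma eq_regular (I : Type) (T T' h h' : I -> R -> R) :
  (\forall z \near +oo, forall p, T p z = T' p z) ->
  (\forall z \near +oo, forall p, h p z = h' p z) ->
  regular T h -> regular T' h'.
Proof.
move=> TT' hh' [dh rT]; split; first exact: eq_dominated dh.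
move=> M e e0; near=> z => p x xM.
have <- : T p (z - x) = T' p (z - x).
  by move: x xM p; near: z; apply: (near_window M TT').
rewrite -(near TT' z)// -(near hh' z)//.
by move: p x xM; near: z; exact: rT.
Unshelve. all: by end_near. Qed.

Lemma regularD (I : Type) (T1 T2 h1 h2 : I -> R -> R) :
  regular T1 h1 -> regular T2 h2 ->
  regular (fun p z => T1 p z + T2 p z) (fun p z => h1 p z + h2 p z).
Proof.
move=> [d1 r1] [d2 r2]; split; first exact: dominatedD.
move=> M e e0; have e20 : 0 < e / 2 by lra.
near=> z => p x xM.
have : `|T1 p (z - x) - T1 p z - x * h1 p z| <= e / 2 * D z.
  by move: p x xM; near: z; exact: r1.
have : `|T2 p (z - x) - T2 p z - x * h2 p z| <= e / 2 * D z.
  by move: p x xM; near: z; exact: r2.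
rewrite !ler_norml => /andP[? ?] /andP[? ?]; apply/andP; split; lra.
Unshelve. all: by end_near. Qed.

Lemma regularM (I : Type) (m : I -> R) (T h : I -> R -> R) :
  bounded m -> regular T h ->
  regular (fun p z => m p * T p z) (fun p z => m p * h p z).
Proof.
move=> bm [dh r]; split; first exact: dominatedM.
move: bm => [B B0 mB] M e e0; have eB0 : 0 < e / B by rewrite divr_gt0.
near=> z => p x xM.
have -> : m p * T p (z - x) - m p * T p z - x * (m p * h p z) =
  m p * (T p (z - x) - T p z - x * h p z) by ring.
have fz : `|T p (z - x) - T p z - x * h p z| <= e / B * D z.
  by move: p x xM; near: z; exact: r.
rewrite normrM (le_trans (ler_pM _ _ (mB p) fz))//.
by rewrite mulrA [B * _]mulrC divfK ?gt_eqF.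
Unshelve. all: by end_near. Qed.

Lemma regular_negl_window (I : Type) (T h h' : I -> R -> R) :
  regular T h -> negl (fun p z => h' p z - h p z) -> regular T h'.
Proof.
move=> [dh r] nh; split.
  apply: eq_dominated (dominatedD dh (negl_dominated nh)).
  by apply: nearW => z p; ring.
(* [M] may be zero or negative, and [N] serves as a divisor. *)
move=> M e e0; pose N := `|M| + 1; have N0 : 0 < N.
  by rewrite /N; have := normr_ge0 M; lra.
have e20 : 0 < e / 2 by lra. have eN : 0 < e / 2 / N by rewrite divr_gt0.
near=> z.
have A p x : `|x| <= M -> `|T p (z - x) - T p z - x * h p z| <= e / 2 * D z.
  by move: p x; near: z; exact: r.
have B p : `|h' p z - h p z| <= e / 2 / N * D z by move: p; near: z; exact: nh.
move=> p x xM; have {}A := A p x xM; have {}B := B p.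
have xN : `|x| <= N by rewrite /N (le_trans xM)// (le_trans (ler_norm M))//; lra.
have C : `|x * (h' p z - h p z)| <= e / 2 * D z.
  rewrite normrM (le_trans (ler_pM _ _ xN B))//.
  by rewrite mulrA [N * _]mulrC divfK ?gt_eqF.
move: A C; rewrite !ler_norml => /andP[? ?] /andP[? ?]; apply/andP; split; lra.
Unshelve. all: by end_near. Qed.

Lemma negl_regular (I : Type) (f : I -> R -> R) : scale_function ->
  negl f -> regular f (fun _ _ => 0).
Proof.
move=> Dp nf; split.
  exists 1 => //; near=> z => p; rewrite normr0 mul1r ltW//.
  by near: z; exact: scale_gt0.
move=> M e e0; have e30 : 0 < e / 3 by lra.
near=> z.
have A p : `|f p z| <= e / 3 * D z by move: p; near: z; exact: nf.
have B x : `|x| <= M -> forall p, `|f p (z - x)| <= e / 3 * D (z - x).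
  move: x; near: z.
  apply: (@near_window (fun z => forall p, `|f p z| <= e / 3 * D z)).
  exact: nf.
have E x : `|x| <= M -> D (z - x) <= 2 * D z.
  by move: x; near: z; exact: scale_shift.
move=> p x xM.
have C : e / 3 * D (z - x) <= e / 3 * (2 * D z) by rewrite ler_pM2l// E.
move: {A B} (A p) (B x xM p).
rewrite !ler_norml => /andP[? ?] /andP[? ?]; apply/andP; split; lra.
Unshelve. all: by end_near. Qed.

(* The increments of h are differences of increments of T. *)
Lemma regular_window (I : Type) (T h : I -> R -> R) : scale_function ->
  regular T h -> regular h (fun _ _ => 0).
Proof.
move=> Dp [dh r]; split.
  exists 1 => //; near=> z => p; rewrite normr0 mul1r ltW//.
  by near: z; exact: scale_gt0.
move=> M e e0; have e40 : 0 < e / 4 by lra.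
near=> z.
have A p x : `|x| <= M -> `|T p (z - x) - T p z - x * h p z| <= e / 4 * D z.
  by move: p x; near: z; exact: r.
have B p x : `|x| <= M + 1 -> `|T p (z - x) - T p z - x * h p z| <= e / 4 * D z.
  by move: p x; near: z; exact: r.
(* A unit step from the moved base point z - x produces [h (z - x)]; the steps x and x + 1 from z
   produce [h z]. *)
have C x : `|x| <= M -> forall p,
    `|T p (z - x - 1) - T p (z - x) - 1 * h p (z - x)| <= e / 4 * D (z - x).
  move: x; near: z.
  apply: (@near_window (fun z => forall p, `|T p (z - 1) - T p z - 1 * h p z| <= e / 4 * D z)).
  by have := r 1 _ e40; apply: filterS => z rz p; apply: rz; rewrite normr1.
have E x : `|x| <= M -> D (z - x) <= 2 * D z.
  by move: x; near: z; exact: scale_shift.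
move=> p x xM; rewrite mulr0 subr0.
have xM1 : `|x + 1| <= M + 1 by rewrite (le_trans (ler_normD _ _))// normr1 lerD2r.
have {}E : e / 4 * D (z - x) <= e / 4 * (2 * D z) by rewrite ler_pM2l// E.
move: {A B C} (A p x xM) (B p _ xM1) (C x xM p).
have -> : z - x - 1 = z - (x + 1) by ring.
rewrite !ler_norml => /andP[? ?] /andP[? ?] /andP[? ?].
apply/andP; split; lra.
Unshelve. all: by end_near. Qed.

Lemma regular_sum (I : Type) (J : eqType) (s : seq J) (T h : J -> I -> R -> R) :
  scale_function -> (forall j, j \in s -> regular (T j) (h j)) ->
  regular (fun p z => \sum_(j <- s) T j p z) (fun p z => \sum_(j <- s) h j p z).
Proof.
move=> Dp; elim: s => [|j s IH] rT.
  have n0 : negl (fun (_ : I) (_ : R) => 0).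
    move=> e e0; near=> z => _; rewrite normr0 mulr_ge0 ?ltW//.
    by near: z; exact: scale_gt0.
  by apply: eq_regular (negl_regular Dp n0); apply: nearW => z p; rewrite big_nil.
have rs := IH (fun k ks => rT k (mem_behead (s := j :: s) ks)).
apply: eq_regular (regularD (rT j (mem_head _ _)) rs);
  by apply: nearW => z p; rewrite big_cons.
Unshelve. all: by end_near. Qed.

(** This is regularity at x = -1 / s, divided by the length of the step. It is needed because (z, z
    + 1] becomes an interval of length 1 / s once all weights are divided by the largest one, s. *)
Lemma negl_rescaled_window (I : Type) (s : I -> R) (T h : I -> R -> R) :
  (forall p, 0 < s p) -> bounded s -> bounded (fun p => (s p)^-1) ->
  regular T h ->
  negl (fun p z => s p * (T p z - T p (z + (s p)^-1)) - h p z).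
Proof.
move=> s0 bs [B B0 sB] [_ r].
have n1 : negl (fun p z => T p (z + (s p)^-1) - T p z + (s p)^-1 * h p z).
  move=> e e0; have := r B e e0; apply: filterS => z rz p.
  by have := rz p (- (s p)^-1); rewrite normrN => /(_ (sB p)); rewrite opprK mulNr opprK.
apply: eq_negl (neglN (neglM bs n1)); apply: nearW => z p.
by field; rewrite gt_eqF.
Qed.

(* Law of c X for c <= 1: the almost decreasing scale absorbs z / c >= z. *)
Lemma regular_dilation (I : Type) (a : R) (c : I -> R) (T h : R -> R) :
  scale_function -> 0 < a -> (forall p, a <= c p <= 1) ->
  regular (fun _ : unit => T) (fun _ => h) ->
  regular (fun p z => T (z / c p)) (fun p z => h (z / c p) / c p).
Proof.
move=> Dp a0 ca [[C C0 dh] r].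
have [K K0 DK] := scale_almost_decreasing Dp.
have c0 p : 0 < c p by have /andP[/(lt_le_trans a0)] := ca p.
have ci p : (c p)^-1 <= a^-1 by rewrite lef_pV2 ?posrE//; have /andP[] := ca p.
have ci0 p : 0 <= (c p)^-1 by rewrite invr_ge0 ltW.
have ai : 0 < a^-1 by rewrite invr_gt0.
have zc z p : 0 <= z -> z <= z / c p.
  by move=> z0; rewrite ler_peMr// invf_ge1//; have /andP[] := ca p.
have nearc (Q : R -> Prop) : (\forall z \near +oo, Q z) ->
    \forall z \near +oo, forall p, Q (z / c p).
  move=> [b [_ bQ]]; near=> z => p; apply: bQ.
  have z0 : 0 <= z by near: z; apply: nbhs_pinfty_ge; exact: num_real.
  apply: lt_le_trans (zc z p z0); near: z; apply: nbhs_pinfty_gt; exact: num_real.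
split.
  exists (C * K * a^-1); first by rewrite !mulr_gt0.
  near=> z.
  have z0 : 0 <= z by near: z; apply: nbhs_pinfty_ge; exact: num_real.
  have A p : `|h (z / c p)| <= C * D (z / c p).
    move: p; near: z; apply: (nearc (fun z => `|h z| <= C * D z)).
    by apply: filterS dh => z; apply; exact: tt.
  have B y : z <= y -> D y <= K * D z by move: y; near: z.
  move=> p; have {}B := B _ (zc _ p z0); have {}A := A p.
  have -> : C * K * a^-1 * D z = C * (K * D z) * a^-1 by ring.
  rewrite normrM [`|_^-1|]ger0_norm// ler_pM// (le_trans A)//.
  by rewrite ler_pM2l.
move=> M e e0; have eK : 0 < e / K by rewrite divr_gt0.
near=> z.
have z0 : 0 <= z by near: z; apply: nbhs_pinfty_ge; exact: num_real.
have B y : z <= y -> D y <= K * D z by move: y; near: z.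
have A p y : `|y| <= M / a ->
    `|T (z / c p - y) - T (z / c p) - y * h (z / c p)| <= e / K * D (z / c p).
  move: p y; near: z.
  apply: (nearc (fun z => forall y, `|y| <= M / a ->
    `|T (z - y) - T z - y * h z| <= e / K * D z)).
  by have := r (M / a) _ eK; apply: filterS => z /(_ tt).
move=> p x xM; have {}B := B _ (zc _ p z0).
have xc : `|x / c p| <= M / a.
  by rewrite normrM [`|_^-1|]ger0_norm// ler_pM.
have {}A := A p _ xc.
rewrite mulrBl; have -> : x * (h (z / c p) / c p) = x / c p * h (z / c p) by ring.
rewrite (le_trans A)//.
have -> : e * D z = e / K * (K * D z) by field; rewrite gt_eqF.
by rewrite ler_pM2l.
Unshelve. all: by end_near. Qed.

End window_calculus.

(** * Expectations of real-valued functions *)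

Section expectation.
Context d (T : measurableType d) (R : realType).

Definition mfun_of d' (U : measurableType d') (f : T -> U)
  (mf : measurable_fun setT f) : {mfun T >-> U} :=
  HB.pack f (isMeasurableFun.Build _ _ _ _ f mf).

Variable P : probability T R.
Implicit Types f g : T -> R.

Definition intg (f : T -> R) : Prop := P.-integrable setT (EFin \o f).

Definition Ex (f : T -> R) : R := \int[P]_x f x.

Lemma intg_measurable f : intg f -> measurable_fun setT f.
Proof. by move=> /integrableP[/measurable_EFinP]. Qed.

Lemma intg_le f g : measurable_fun setT f -> (forall x, `|f x| <= g x) ->
  intg g -> intg f.
Proof.
move=> mf fg; apply: le_integrable => //; first exact/measurable_EFinP.
by move=> x _ /=; rewrite !lee_fin (le_trans (fg x))// ler_norm.
Qed.

Lemma intg_cst k : intg (fun=> k).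
Proof. exact: finite_measure_integrable_cst. Qed.

Lemma intg_bounded f k : measurable_fun setT f -> (forall x, `|f x| <= k) ->
  intg f.
Proof. by move=> mf fk; apply: intg_le mf fk _; exact: intg_cst. Qed.

Lemma intgD f g : intg f -> intg g -> intg (fun x => f x + g x).
Proof. by move=> intf intg'; exact: (integrableD measurableT intf intg'). Qed.

Lemma intgB f g : intg f -> intg g -> intg (fun x => f x - g x).
Proof. by move=> intf intg'; exact: (integrableB measurableT intf intg'). Qed.

Lemma intgZ k f : intg f -> intg (fun x => k * f x).
Proof. by move=> intf; exact: (integrableZl measurableT k intf). Qed.

Lemma intg_norm f : intg f -> intg (fun x => `|f x|).
Proof. by move=> intf; apply: integrable_norm. Qed.

Lemma intg_sum (J : Type) (s : seq J) (Q : pred J) (f : J -> T -> R) :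
  (forall j, Q j -> intg (f j)) -> intg (fun x => \sum_(j <- s | Q j) f j x).
Proof.
move=> intf; elim: s => [|j s IH].
  have := intg_cst 0; rewrite /intg.
  by congr integrable; apply/funext => x /=; rewrite big_nil.
case: (boolP (Q j)) => Qj; last first.
  by move: IH; rewrite /intg; congr integrable; apply/funext => x /=;
    rewrite big_cons (negbTE Qj).
have := intgD (intf j Qj) IH; rewrite /intg; congr integrable.
by apply/funext => x /=; rewrite big_cons Qj.
Qed.

Lemma Ex_cst k : Ex (fun=> k) = k.
Proof.
rewrite /Ex Rintegral_cst//; rewrite [X in fine X]probability_setT.
by rewrite mulr1.
Qed.

Lemma eq_Ex f g : (forall x, f x = g x) -> Ex f = Ex g.
Proof. by move=> fg; congr Ex; apply/funext. Qed.

Lemma ExD f g : intg f -> intg g -> Ex (fun x => f x + g x) = Ex f + Ex g.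
Proof. by move=> intf intg'; rewrite /Ex RintegralD. Qed.

Lemma ExB f g : intg f -> intg g -> Ex (fun x => f x - g x) = Ex f - Ex g.
Proof. by move=> intf intg'; rewrite /Ex RintegralB. Qed.

Lemma ExZ k f : intg f -> Ex (fun x => k * f x) = k * Ex f.
Proof. by move=> intf; rewrite /Ex RintegralZl. Qed.

Lemma Ex_sum (J : Type) (s : seq J) (Q : pred J) (f : J -> T -> R) :
  (forall j, Q j -> intg (f j)) ->
  Ex (fun x => \sum_(j <- s | Q j) f j x) = \sum_(j <- s | Q j) Ex (f j).
Proof.
move=> intf; elim: s => [|j s IH].
  by rewrite big_nil -[RHS](Ex_cst 0); apply: eq_Ex => x; rewrite big_nil.
rewrite big_cons -IH; case: (boolP (Q j)) => Qj.
  rewrite -ExD; [|exact: intf|exact: intg_sum].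
  by apply: eq_Ex => x; rewrite big_cons Qj.
by apply: eq_Ex => x; rewrite big_cons (negbTE Qj).
Qed.

Lemma Ex_le f g : intg f -> intg g -> (forall x, f x <= g x) -> Ex f <= Ex g.
Proof. by move=> intf intg' fg; apply: le_Rintegral => // x _. Qed.

Lemma Ex_ge0 f : (forall x, 0 <= f x) -> 0 <= Ex f.
Proof. by move=> f0; apply: Rintegral_ge0 => x _. Qed.

Lemma Ex_norm_le f g : measurable_fun setT f -> intg g ->
  (forall x, `|f x| <= g x) -> `|Ex f| <= Ex g.
Proof.
move=> mf intgg fg; have intf := intg_le mf fg intgg.
apply: le_trans (le_normr_Rintegral measurableT intf) _.
by apply: (Ex_le (intg_norm intf)).
Qed.

Lemma measurable_natb (b : T -> bool) : measurable_fun setT b ->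
  measurable_fun setT (fun x => (b x)%:R : R).
Proof.
by move=> mb; apply: (measurableT_comp (f := fun c : bool => c%:R : R)) mb.
Qed.

Lemma intg_natb (b : T -> bool) : measurable_fun setT b ->
  intg (fun x => (b x)%:R).
Proof.
move=> mb; apply: (@intg_bounded _ 1); first exact: measurable_natb.
by move=> x; case: (b x); rewrite ?normr0 ?normr1.
Qed.

Lemma intgMb (b : T -> bool) f : measurable_fun setT b -> intg f ->
  intg (fun x => f x * (b x)%:R).
Proof.
move=> mb intf; apply: intg_le (intg_norm intf).
  by apply: measurable_funM; [exact: intg_measurable|exact: measurable_natb].
by move=> x; rewrite normrM; case: (b x); rewrite ?normr0 ?normr1 ?mulr0 ?mulr1.
Qed.

Lemma measurable_bool_set (b : T -> bool) : measurable_fun setT b ->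
  measurable [set x | b x].
Proof.
move=> mb; rewrite -[X in measurable X]setTI; exact: (mb measurableT [set true]).
Qed.

Lemma Ex_natb (b : T -> bool) : measurable_fun setT b ->
  Ex (fun x => (b x)%:R) = fine (P [set x | b x]).
Proof.
move=> mb; rewrite /Ex /Rintegral.
under eq_integral => x _.
  rewrite (_ : (b x)%:R = \1_([set x | b x]) x :> R); last first.
    by rewrite indicE; congr (_%:R); apply/esym; congr nat_of_bool; exact: asboolb.
  over.
by rewrite integral_indic ?setIT//; exact: measurable_bool_set.
Qed.

End expectation.

Section change_of_variable.
Context d (T : measurableType d) d' (U : measurableType d') (R : realType).
Variables (P : probability T R) (X : {mfun T >-> U}).

Lemma intg_distribution (f : U -> R) : measurable_fun setT f ->
  intg P (f \o X) -> intg (distribution P X) f.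
Proof.
move=> mf ifX; apply: integrable_pushforward => //.
exact/measurable_EFinP.
Qed.

Lemma intg_distributionP (f : U -> R) : 
  intg (distribution P X) f -> intg P (f \o X).
Proof.
move=> /integrableP[mf fi]; apply/integrableP; split.
  exact: (measurableT_comp mf).
move: fi; rewrite ge0_integral_pushforward//.
exact: measurableT_comp.
Qed.

Lemma Ex_distribution (f : U -> R) : measurable_fun setT f ->
  intg P (f \o X) -> Ex (distribution P X) f = Ex P (f \o X).
Proof.
move=> mf ifX; rewrite /Ex /Rintegral integral_distribution//.
exact/measurable_EFinP.
Qed.

End change_of_variable.

Section fubini.
Context d1 (T1 : measurableType d1) d2 (T2 : measurableType d2) (R : realType).
Variables (P1 : probability T1 R) (P2 : probability T2 R).

(** Integrability of every section makes the inner integral finite everywhere, so that it coincides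
    as a function with its extended-real version [fubini_G]. *)
Lemma intg_fubini (f : T1 * T2 -> R) : intg (P1 \x P2)%E f ->
  (forall y, intg P1 (fun x => f (x, y))) ->
  intg P2 (fun y => Ex P1 (fun x => f (x, y))).
Proof.
move=> intf int1; have /integrableP[mf _] := intf.
rewrite /intg (_ : _ \o _ = fubini_G P1 (EFin \o f)); last first.
  apply/funext => y /=; rewrite /fubini_G /Ex /Rintegral fineK//.
  exact: (integrable_fin_num measurableT (int1 y)).
apply/integrableP; split; first exact: (measurable_fubini_G intf).
apply: le_lt_trans ((integrable21ltyP P1 P2 mf).1 intf).
apply: ge0_le_integral => //.
- by apply: measurableT_comp => //; exact: (measurable_fubini_G intf).
- apply: (measurable_fun_fubini_tonelli_G (abse \o (EFin \o f))) => *;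
    first [exact: abse_ge0|exact: measurableT_comp].
- move=> y _; apply: le_abse_integral => //.
  exact: measurable_int (int1 y).
Qed.

Lemma Ex_fubini (f : T1 * T2 -> R) : intg (P1 \x P2)%E f ->
  (forall y, intg P1 (fun x => f (x, y))) ->
  Ex (P1 \x P2)%E f = Ex P2 (fun y => Ex P1 (fun x => f (x, y))).
Proof.
move=> intf int1; rewrite /Ex /Rintegral -integral21_prod_meas1//.
congr fine; apply: eq_integral => y _.
rewrite /fubini_G fineK//; exact: (integrable_fin_num measurableT (int1 y)).
Qed.

Lemma Ex_fubini_swap (f : T1 * T2 -> R) : intg (P1 \x P2)%E f ->
  (forall x, intg P2 (fun y => f (x, y))) ->
  Ex (P1 \x P2)%E f = Ex P1 (fun x => Ex P2 (fun y => f (x, y))).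
Proof.
move=> intf int2; rewrite /Ex /Rintegral -integral12_prod_meas1//.
congr fine; apply: eq_integral => x _.
rewrite /fubini_F fineK//; exact: (integrable_fin_num measurableT (int2 x)).
Qed.

Lemma intg_fst (f : T1 -> R) : intg P1 f -> intg (P1 \x P2)%E (f \o fst).
Proof.
move=> intf; have mf := intg_measurable intf.
have mff : measurable_fun setT (EFin \o (f \o (@fst T1 T2))).
  by apply/measurable_EFinP; exact: measurableT_comp.
apply/(integrable12ltyP P1 P2 mff).
under eq_integral do rewrite /= integral_cst// [X in (_ * X)%E]probability_setT mule1.
by have /integrableP[] := intf.
Qed.

Lemma intg_snd (f : T2 -> R) : intg P2 f -> intg (P1 \x P2)%E (f \o snd).
Proof.
move=> intf; have mf := intg_measurable intf.
have mff : measurable_fun setT (EFin \o (f \o (@snd T1 T2))).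
  by apply/measurable_EFinP; exact: measurableT_comp.
apply/(integrable21ltyP P1 P2 mff).
under eq_integral do rewrite /= integral_cst// [X in (_ * X)%E]probability_setT mule1.
by have /integrableP[] := intf.
Qed.

End fubini.

Notation "\I[ b ]" := ((nat_of_bool b%R)%:R)
  (at level 0, b at level 99, format "\I[ b ]") : ring_scope.

Section measurability.
Context d (T : measurableType d) (R : realType).
Implicit Types f g : T -> R.

Lemma measurable_normf f : measurable_fun setT f ->
  measurable_fun setT (fun x => `|f x|).
Proof. by move=> mf; apply: (measurableT_comp (@normr_measurable R setT) mf). Qed.

Lemma measurable_addf f g : measurable_fun setT f -> measurable_fun setT g ->
  measurable_fun setT (fun x => f x + g x).
Proof. exact: measurable_funD. Qed.

Lemma measurable_subf f g : measurable_fun setT f -> measurable_fun setT g ->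
  measurable_fun setT (fun x => f x - g x).
Proof. exact: measurable_funB. Qed.

Lemma measurable_mulf f g : measurable_fun setT f -> measurable_fun setT g ->
  measurable_fun setT (fun x => f x * g x).
Proof. exact: measurable_funM. Qed.

Lemma measurable_oppf f : measurable_fun setT f ->
  measurable_fun setT (fun x => - f x).
Proof. by move=> mf; apply: (measurableT_comp (@oppr_measurable R setT) mf). Qed.

Lemma measurable_ltf f g : measurable_fun setT f -> measurable_fun setT g ->
  measurable_fun setT (fun x => f x < g x).
Proof. exact: measurable_fun_ltr. Qed.

Lemma measurable_lef f g : measurable_fun setT f -> measurable_fun setT g ->
  measurable_fun setT (fun x => f x <= g x).
Proof. exact: measurable_fun_ler. Qed.

Lemma measurable_andf (f g : T -> bool) :
  measurable_fun setT f -> measurable_fun setT g ->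
  measurable_fun setT (fun x => f x && g x).
Proof. exact: measurable_and. Qed.

End measurability.

(** The branches for [Order.lt _], [GRing.add _] and the like catch functions such as fun t => x <
    t, which occur eta-reduced. *)
Ltac meas :=
  solve [repeat first
    [ assumption
    | exact: measurable_id
    | exact: measurable_cst
    | exact: measurable_fst
    | exact: measurable_snd
    | exact: normr_measurable
    | exact: oppr_measurable
    | match goal with
      | |- measurable_fun _ (fun x => (nat_of_bool (@?f x))%:R) =>
          apply: measurable_natb
      | |- measurable_fun _ (fun x => (@?f x) && (@?g x)) =>
          apply: measurable_andf
      | |- measurable_fun _ (fun x => (@?f x) < (@?g x)) =>
          apply: measurable_ltf
      | |- measurable_fun _ (fun x => (@?f x) <= (@?g x)) =>
          apply: measurable_lef
      | |- measurable_fun _ (Order.lt _) => apply: measurable_ltf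
      | |- measurable_fun _ (Order.le _) => apply: measurable_lef
      | |- measurable_fun _ (GRing.add _) => apply: measurable_addf
      | |- measurable_fun _ (GRing.mul _) => apply: measurable_mulf
      | |- measurable_fun _ (fun x => `| @?f x |) => apply: measurable_normf
      | |- measurable_fun _ (fun x => - (@?f x)) => apply: measurable_oppf
      | |- measurable_fun _ (fun x => (@?f x) + (@?g x)) =>
          apply: measurable_addf
      | |- measurable_fun _ (fun x => (@?f x) * (@?g x)) =>
          apply: measurable_mulf
      end ]].

(** * Tails of a law as expectations of indicators *)

Section tails.
Context {R : realType}.
Implicit Type H : probability R R.

Lemma dtailE H x : dtail H x = Ex H (fun t => \I[x < t]).
Proof.
rewrite Ex_natb; last by meas.
have -> : [set t | x < t] = ~` [set` `]-oo, x]].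
  by apply/seteqP; split => t /=; rewrite in_itv/= ?ltNge => /negP.
rewrite probability_setC// /dtail /dfun.
by rewrite fineB// fin_num_measure.
Qed.

Lemma Ex_itv H u v : u <= v ->
  Ex H (fun t => \I[u < t <= v]) = dtail H u - dtail H v.
Proof.
move=> uv; rewrite !dtailE -ExB; [|apply: intg_natb; meas..].
apply: eq_Ex => t; case: (ltP u t) => ut; case: (leP t v) => tv //=; lra.
Qed.

Lemma dtail_nonincreasing H u v : u <= v -> dtail H v <= dtail H u.
Proof.
by move=> uv; rewrite -subr_ge0 -Ex_itv//; apply: Ex_ge0 => x; exact: ler0n.
Qed.

Lemma dtail_ge0 H x : 0 <= dtail H x.
Proof. by rewrite dtailE; apply: Ex_ge0 => t; exact: ler0n. Qed.

Lemma dtail_le1 H x : dtail H x <= 1.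
Proof.
rewrite dtailE -[leRHS](Ex_cst H 1); apply: Ex_le.
- by apply: intg_natb; meas.
- exact: intg_cst.
- by move=> t; rewrite lern1 leq_b1.
Qed.

Lemma measurable_dtail H : measurable_fun setT (dtail H).
Proof.
by apply: nonincreasing_measurable => // u v /dtail_nonincreasing; apply.
Qed.

Lemma dincrE H x t : dincr H x t = dtail H x - dtail H (x + t).
Proof. by rewrite /dincr /dtail; lra. Qed.

End tails.

(** * Uniform integrability *)

Section uniform_integrability.
Context {R : realType}.

Definition excess (H : probability R R) (A : R) : R :=
  Ex H (fun x => `|x| * \I[A < `|x|]).

Definition unif_int (I : Type) (H : I -> probability R R) : Prop :=
  (forall p, intg (H p) id) /\
  forall e, 0 < e -> exists A, forall p, excess (H p) A <= e.

Lemma intg_excess (H : probability R R) A : intg H id ->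
  intg H (fun x => `|x| * \I[A < `|x|]).
Proof.
move=> iH; apply: (@intgMb _ _ _ H (fun x => A < `|x|) (fun x => `|x|)).
  by meas.
exact: intg_norm.
Qed.

Lemma excess_nonincreasing (H : probability R R) A B : intg H id -> A <= B ->
  excess H B <= excess H A.
Proof.
move=> iH AB; apply: Ex_le; try exact: intg_excess.
move=> x; apply: ler_wpM2l => //; rewrite ler_nat.
by case: (ltP B) => // Bx; rewrite (le_lt_trans AB Bx).
Qed.

(** Dominated convergence along integer thresholds: at each point the truncated function vanishes
    once the threshold has passed [Z w]. *)
Lemma integrable_tail_small d (T : measurableType d) (P : probability T R)
    (Z : T -> R) e : intg P Z -> (forall w, 0 <= Z w) -> 0 < e ->
  exists A, Ex P (fun w => Z w * \I[A < Z w]) <= e.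
Proof.
move=> iZ Z0 e0; have mZ := intg_measurable iZ.
pose f_ n w := (Z w * \I[n%:R < Z w])%:E.
have [] := @dominated_convergence _ _ _ P setT measurableT f_ (cst 0%E) (EFin \o Z).
- move=> n; apply/measurable_EFinP; meas.
- exact: measurable_cst.
- apply: aeW => w _; apply: cvg_near_cst.
  near=> n; rewrite /f_ /=; case: ltP => //=; last by rewrite mulr0.
  move=> nZ; exfalso; move: nZ; apply/negP; rewrite -leNgt.
  near: n; exact: nbhs_infty_ger.
- exact: iZ.
- apply: aeW => w n _; rewrite /f_ /= lee_fin normrM (ger0_norm (Z0 w)).
  by rewrite normr_nat ler_piMr// lern1 leq_b1.
move=> _ _; rewrite integral0 => /fine_cvgP[_].
move=> /cvgrPdist_le/(_ e e0)[n _ /(_ n (leqnn n))] /=.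
rewrite sub0r normrN => fn; exists n%:R.
by apply: le_trans fn; exact: ler_norm.
Unshelve. all: by end_near. Qed.

(** A common integrable envelope gives one threshold for the whole family, because |X| > A forces Z
    > A. *)
Lemma unif_int_distribution (I : Type) d (T : measurableType d)
    (P : probability T R) (X : I -> {mfun T >-> R}) (Z : T -> R) :
  intg P Z -> (forall w, 0 <= Z w) -> (forall p w, `|X p w| <= Z w) ->
  unif_int (fun p => distribution P (X p)).
Proof.
move=> iZ Z0 XZ; have mZ := intg_measurable iZ.
have iX p : intg P (X p) by apply: intg_le iZ => //; exact: XZ.
split=> [p|e e0]; first by apply: intg_distribution => //; exact: iX.
have [A ZA] := integrable_tail_small iZ Z0 e0; exists A => p.
have mX : measurable_fun setT (X p) by [].
have iXA : intg P (fun w => `|X p w| * \I[A < `|X p w|]).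
  by apply: intgMb _ (intg_norm (iX p)); meas.
rewrite /excess Ex_distribution//; last by meas.
apply: le_trans ZA; apply: Ex_le => //; first by apply: intgMb _ iZ; meas.
move=> w /=; apply: ler_pM => //; rewrite ler_nat.
by case: (ltP A (`|X p w|)) => // AX; rewrite (lt_le_trans AX).
Qed.

End uniform_integrability.

(** * Two independent summands *)

Section two_jumps.
Context {R : realType}.

(** Integrated against the law of (A, B), this is P(A + B > z) - P(A > z) - P(B > z), the defect of
    additivity of the tails. *)
Definition jump (z : R) (u : R * R) : R :=
  \I[z < u.1 + u.2] - \I[z < u.1] - \I[z < u.2].

Definition both_large (A z : R) (u : R * R) : bool :=
  [&& z < u.1 + u.2, A < u.1, u.1 <= z, A < u.2 & u.2 <= z].

(* Unless one coordinate stays in [-A, A] or both lie in ]A, z], the defect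
   jump z u can only come from a coordinate close to z. *)
Lemma jump_split (A z : R) (u : R * R) : 0 < A -> 2 * A < z ->
  `|jump z u - \I[`|u.2| <= A] * (\I[z - u.2 < u.1] - \I[z < u.1])
            - \I[`|u.1| <= A] * (\I[z - u.1 < u.2] - \I[z < u.2])
            - \I[both_large A z u]| <=
  \I[A < `|u.2|] * \I[z < u.1 <= z + `|u.2|]
  + \I[A < `|u.1|] * \I[z < u.2 <= z + `|u.1|].
Proof.
case: u => t x A0 Az; rewrite /jump /both_large/=.
rewrite [z - x < t]ltrBlDr [z - t < x]ltrBlDr [x + t]addrC.
have rhs0 : 0 <= \I[A < `|x|] * \I[z < t <= z + `|x|]
    + \I[A < `|t|] * \I[z < x <= z + `|t|] :> R.
  by rewrite addr_ge0// mulr_ge0.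
have small y : `|y| <= A -> (A < y) = false /\ (z < y) = false.
  rewrite ler_norml => /andP[? ?].
  by split; apply/negbTE; rewrite -leNgt; lra.
case: (lerP `|x| A) => xA.
  have [-> ->] := small x xA.
  case: (lerP `|t| A) => tA.
    have [-> ->] := small t tA.
    have -> : (z < t + x) = false.
      apply/negbTE; rewrite -leNgt; move: xA tA; rewrite !ler_norml.
      by move=> /andP[? ?] /andP[? ?]; lra.
    by rewrite /= !(subr0, mulr0) normr0; case: (ltP A `|x|); case: (ltP A `|t|).
  rewrite !andbF /= mul1r mul0r !subr0 subrr normr0.
  by rewrite mul0r mulr0 addr0.
case: (lerP `|t| A) => tA.
  have [-> ->] := small t tA.
  rewrite !andbF /= mul1r !mul0r mulr0 !subr0 subrr normr0.
  by rewrite addr0.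
rewrite !mul0r !subr0 !mul1r.
have opp y : A < `|y| -> 0 <= y \/ y < - A.
  move=> Ay; case: (lerP 0 y) => y0; first by left.
  by right; move: Ay; rewrite ltr0_norm//; lra.
have or1 (b c : bool) : b || c -> 1 <= \I[b] + \I[c] :> R.
  by case: b => /=; case: c => //= _; rewrite ?addr0 ?add0r// lerDl.
have nx := ler_norm x; have nt := ler_norm t.
case: (ltrP z t) => zt; case: (ltrP z x) => zx /=.
(* Both coordinates exceed z and the jump is -1; the smaller one lies below z plus the larger one,
   so one of the two windows is hit. *)
- have -> : z < t + x by lra.
  rewrite !andbF/= subrr sub0r subr0 normrN1 or1//.
  by case: (leP t x) => tx; apply/orP; [left|right]; lra.
(* Only t exceeds z: the jump is nonzero only if x pulls the sum back to z or below, and then t <= z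
   + |x|. *)
- rewrite !andbF/= !subr0; case: (ltrP z (t + x)) => ztx; first by rewrite subrr normr0 addr0.
  have -> : t <= z + `|x| by have := ler_norm (- x); rewrite normrN; lra.
  by rewrite sub0r normrN1 addr0.
- rewrite !andbF/= !subr0; case: (ltrP z (t + x)) => ztx; first by rewrite subrr normr0 add0r.
  have -> : x <= z + `|t| by have := ler_norm (- t); rewrite normrN; lra.
  by rewrite sub0r normrN1 add0r.
(* Neither exceeds z: if the sum does, a coordinate below -A would force the other above z, so both
   lie in ]A, z] and [both_large] accounts for the jump. *)
- rewrite !subr0; case: (ltrP z (t + x)) => ztx; last first.
    by rewrite /= subrr normr0 addr0.
  have t0 : 0 <= t by case: (opp t tA) => //; lra.
  have x0 : 0 <= x by case: (opp x xA) => //; lra.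
  move: tA xA; rewrite (ger0_norm t0) (ger0_norm x0) => -> ->.
  by rewrite /= subrr normr0 addr0.
Qed.

End two_jumps.

(** * Increments dominated by those of the reference law *)

Section domination.
Context {R : realType} (Phi : probability R R).

Definition scale (z : R) : R := dtail Phi z - dtail Phi (z + 1).

Hypothesis scaleP : scale_function scale.

(** Unit increments are bounded by unit increments of [Phi], and unit steps cover ]u, v]. The last
    step overshoots [v] by at most 1, whence [v + 1] on the right. *)
Lemma regular_itv_le (I : Type) (H : I -> probability R R) h :
  regular scale (fun p => dtail (H p)) h ->
  exists2 C, 0 < C & exists v0, forall p u v, v0 <= u -> u <= v ->
    dtail (H p) u - dtail (H p) v <= C * (dtail Phi u - dtail Phi (v + 1)).
Proof.
(* [C] bounds the window, and 1 is the error allowed in the expansion at x = -1. *)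
move=> [[C C0 dh] r]; exists (C + 1); first by lra.
have [v0 [_ Hv0]] : \forall z \near +oo, forall p,
    dtail (H p) z - dtail (H p) (z + 1) <= (C + 1) * scale z.
  near=> z.
  have A p x : `|x| <= 1 ->
      `|dtail (H p) (z - x) - dtail (H p) z - x * h p z| <= 1 * scale z.
    by move: p x; near: z; exact: r.
  have B p : `|h p z| <= C * scale z by move: p; near: z; exact: dh.
  move=> p; move: (B p); have := A p (-1); rewrite normrN1 opprK => /(_ (lexx _)).
  by rewrite !ler_norml => /andP[? ?] /andP[? ?]; lra.
(* The unit bound holds strictly beyond [v0], whereas [u] may equal the threshold. *)
exists (v0 + 1) => p u v v0u uv.
have steps k : dtail (H p) u - dtail (H p) (u + k%:R) <=
    (C + 1) * (dtail Phi u - dtail Phi (u + k%:R)).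
  elim: k => [|k IH]; first by rewrite addr0 !subrr mulr0.
  have : v0 < u + k%:R by have := ler0n R k; lra.
  have e1 : u + k%:R + 1 = u + k.+1%:R by rewrite -natr1 addrA.
  move=> /Hv0/(_ p); rewrite /scale e1; lra.
have vu0 : 0 <= v - u by lra.
have /andP[k1 k2] := Num.Theory.truncn_itv vu0.
set k := Num.truncn _ in k1 k2.
have := steps k.+1.
have : dtail (H p) (u + k.+1%:R) <= dtail (H p) v.
  by apply: dtail_nonincreasing; lra.
have : dtail Phi (v + 1) <= dtail Phi (u + k.+1%:R).
  by apply: dtail_nonincreasing; rewrite -natr1; lra.
move=> X Y Z; have C1 : 0 <= C + 1 by lra.
have := ler_wpM2l C1 X; lra.
Unshelve. all: by end_near. Qed.

(** Every unit step beyond z costs at most [C * scale z], and y + 1 bounds the number of steps.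
    Linear growth in y is what turns distant shifts into first moments. *)
Lemma scale_itv_le : exists2 C, 0 < C & \forall z \near +oo, forall y, 0 <= y ->
  dtail Phi z - dtail Phi (z + y) <= C * (y + 1) * scale z.
Proof.
have [C C0 DC] := scale_almost_decreasing scaleP.
exists C => //; near=> z.
have Dz y : z <= y -> scale y <= C * scale z by move: y; near: z.
have sz : 0 < scale z by near: z; exact: scale_gt0.
move=> y y0.
have steps k : dtail Phi z - dtail Phi (z + k%:R) <= k%:R * (C * scale z).
  elim: k => [|k IH]; first by rewrite addr0 subrr mul0r.
  have : scale (z + k%:R) <= C * scale z by apply: Dz; have := ler0n R k; lra.
  have e1 : z + k%:R + 1 = z + k.+1%:R by rewrite -natr1 addrA.
  rewrite {1}/scale e1 -natr1; lra.
have /andP[k1 k2] := Num.Theory.truncn_itv y0.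
set k := Num.truncn _ in k1 k2.
have := steps k.+1.
have : dtail Phi (z + k.+1%:R) <= dtail Phi (z + y).
  by apply: dtail_nonincreasing; lra.
have : k.+1%:R * (C * scale z) <= (y + 1) * (C * scale z).
  apply: ler_wpM2r; first by rewrite mulr_ge0 ?ltW.
  by rewrite -natr1; lra.
lra.
Unshelve. all: by end_near. Qed.

Lemma regular_itv_le_scale (I : Type) (H : I -> probability R R) h :
  regular scale (fun p => dtail (H p)) h ->
  exists2 C, 0 < C & \forall z \near +oo, forall p y, 0 <= y ->
    dtail (H p) z - dtail (H p) (z + y) <= C * (y + 1) * scale z.
Proof.
move=> /regular_itv_le[C C0 [v0 HC]]; have [B B0 HB] := scale_itv_le.
exists (C * (2 * B)); first by rewrite !mulr_gt0.
near=> z.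
have zv : v0 <= z by near: z; apply: nbhs_pinfty_ge; exact: num_real.
have sz : 0 < scale z by near: z; exact: scale_gt0.
have Bz y : 0 <= y -> dtail Phi z - dtail Phi (z + y) <= B * (y + 1) * scale z.
  by move: y; near: z.
move=> p y y0; have zy : z <= z + y by lra.
apply: le_trans (HC p z (z + y) zv zy) _.
have y1 : 0 <= y + 1 by lra.
have -> : C * (2 * B) * (y + 1) * scale z = C * (B * (2 * (y + 1)) * scale z).
  by ring.
rewrite ler_pM2l// -[z + y + 1]addrA (le_trans (Bz _ y1))// ler_pM2r// ler_pM2l//.
by lra.
Unshelve. all: by end_near. Qed.

End domination.

Section truncated_expectations.
Context {R : realType}.
Implicit Type H : probability R R.

Lemma meanE H : mean H = Ex H id. Proof. by []. Qed.

Lemma intg_trunc H A : intg H (fun x => \I[`|x| <= A] * x).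
Proof.
apply: (@intg_bounded _ _ _ _ _ `|A|); first by meas.
move=> x; rewrite normrM; case: (lerP `|x| A) => xA.
  by rewrite normr1 mul1r (le_trans xA)// ler_norm.
by rewrite normr0 mul0r.
Qed.

Lemma mean_trunc H A : intg H id ->
  `|mean H - Ex H (fun x => \I[`|x| <= A] * x)| <= excess H A.
Proof.
move=> iH; rewrite meanE -ExB//; last exact: intg_trunc.
apply: Ex_norm_le; [by meas|exact: intg_excess|move=> x /=].
case: (lerP `|x| A) => xA; first by rewrite mul1r subrr normr0 mulr_ge0.
by rewrite mul0r subr0 mulr1.
Qed.

Lemma unif_int_mean (I : Type) (H : I -> probability R R) :
  unif_int H -> bounded (fun p => mean (H p)).
Proof.
move=> [iH uH]; have [A HA] := uH 1 ltr01.
exists (`|A| + 1); first by have := normr_ge0 A; lra.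
move=> p; apply: le_trans (_ : `|Ex (H p) (fun x => \I[`|x| <= A] * x)|
    + excess (H p) A <= _).
  have := mean_trunc A (iH p).
  by move=> /(le_trans (lerB_dist _ _)); lra.
apply: lerD => //; rewrite -[leRHS](Ex_cst (H p)).
apply: Ex_norm_le; [by meas|exact: intg_cst|move=> x].
rewrite normrM; case: (lerP `|x| A) => xA.
  by rewrite normr1 mul1r (le_trans xA)// ler_norm.
by rewrite normr0 mul0r.
Qed.

(** Every threshold beyond [A0] works, so that several requirements can be met by one A; [1 <= A0]
    gives |x| + 1 <= 2 |x| beyond it. *)
Lemma unif_int_excess (I : Type) (H : I -> probability R R) e :
  unif_int H -> 0 < e ->
  exists2 A0, 1 <= A0 & forall A, A0 <= A -> forall p, excess (H p) A <= e.
Proof.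
move=> [iH uH] e0; have [A HA] := uH e e0.
exists (Num.max 1 A); first by rewrite le_max lexx.
move=> B; rewrite ge_max => /andP[_ AB] p.
by apply: le_trans (HA p); exact: excess_nonincreasing.
Qed.

End truncated_expectations.

(** * The jump of two independent laws, up to the event that both are large *)

Section two_independent_jumps.
Context {R : realType} (Phi : probability R R).
Local Notation D := (scale Phi).
Hypothesis scaleP : scale_function D.
Variable I : Type.
Implicit Types H K : I -> probability R R.

Lemma intg_shift (H : probability R R) (K : probability R R) A z :
  intg H (fun x => \I[`|x| <= A] * (dtail K (z - x) - dtail K z)).
Proof.
have mT := measurable_dtail K.
apply: (@intg_bounded _ _ _ _ _ 1).
  apply: measurable_mulf; first by meas.
  apply: measurable_subf; last by meas.
  by apply: (measurableT_comp mT); meas.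
move=> x; rewrite normrM -[leRHS]mulr1 ler_pM//.
  by case: (_ <= A); rewrite ?normr1 ?normr0.
have := dtail_ge0 K (z - x); have := dtail_le1 K (z - x).
have := dtail_ge0 K z; have := dtail_le1 K z.
by rewrite ler_norml => ? ? ? ?; apply/andP; split; lra.
Qed.

(** On |x| <= A the shift is expanded by regularity. The truncated mean that appears is off by at
    most [excess], and this error is multiplied by [k], which is O(D). *)
Lemma small_shift H K k e : unif_int H ->
  regular D (fun p => dtail (K p)) k -> 0 < e ->
  exists2 A0, 1 <= A0 & forall A, A0 <= A -> \forall z \near +oo, forall p,
    `|Ex (H p) (fun x => \I[`|x| <= A] * (dtail (K p) (z - x) - dtail (K p) z))
      - mean (H p) * k p z| <= e * D z.
Proof.
move=> uH [[C C0 dk] r] e0; have e20 : 0 < e / 2 by lra.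
have eC : 0 < e / 2 / C by rewrite divr_gt0.
have [A0 A01 HA] := unif_int_excess uH eC.
exists A0 => // A AA; near=> z.
have Dz : 0 < D z by near: z; exact: scale_gt0.
have rz p x : `|x| <= A ->
    `|dtail (K p) (z - x) - dtail (K p) z - x * k p z| <= e / 2 * D z.
  by move: p x; near: z; exact: r.
have kz p : `|k p z| <= C * D z by move: p; near: z; exact: dk.
move=> p.
have iT := intg_trunc (H p) A.
have ->: Ex (H p) (fun x => \I[`|x| <= A] * (dtail (K p) (z - x) - dtail (K p) z))
    - mean (H p) * k p z =
  Ex (H p) (fun x => \I[`|x| <= A] * (dtail (K p) (z - x) - dtail (K p) z)
    - k p z * (\I[`|x| <= A] * x))
  - (mean (H p) - Ex (H p) (fun x => \I[`|x| <= A] * x)) * k p z.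
  rewrite ExB; [|exact: intg_shift|exact: intgZ].
  by rewrite ExZ//; ring.
rewrite (le_trans (ler_normB _ _))//.
have -> : e * D z = e / 2 * D z + e / 2 / C * (C * D z) by field; rewrite gt_eqF.
apply: lerD; last first.
  rewrite normrM ler_pM// (le_trans (mean_trunc A (uH.1 p)))//.
  exact: HA.
rewrite -[leRHS](Ex_cst (H p)); apply: Ex_norm_le; last first.
- move=> x; rewrite mulrCA -mulrBr [k p z * x]mulrC normrM.
  case: (lerP `|x| A) => xA; last by rewrite normr0 mul0r mulr_ge0 ?ltW.
  by rewrite normr1 mul1r rz.
- exact: intg_cst.
- apply: measurable_subf; first exact: intg_measurable (intg_shift _ _ _ _).
  by meas.
Unshelve. all: by end_near. Qed.

Lemma intg_far (H : probability R R) (K : probability R R) A z :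
  intg H (fun x => \I[A < `|x|] * (dtail K z - dtail K (z + `|x|))).
Proof.
have mT := measurable_dtail K.
apply: (@intg_bounded _ _ _ _ _ 1).
  apply: measurable_mulf; first by meas.
  apply: measurable_subf; first by meas.
  by apply: (measurableT_comp mT); meas.
move=> x; rewrite normrM -[leRHS]mulr1 ler_pM//.
  by case: (A < _); rewrite ?normr1 ?normr0.
have := dtail_ge0 K (z + `|x|); have := dtail_le1 K (z + `|x|).
have := dtail_ge0 K z; have := dtail_le1 K z.
by rewrite ler_norml => ? ? ? ?; apply/andP; split; lra.
Qed.

(** A shift by |x| costs O((|x| + 1) D z), so the expectation over |x| > A is bounded by a tail of
    the first moment, small uniformly in p. *)
Lemma small_far H K k e : unif_int H ->
  regular D (fun p => dtail (K p)) k -> 0 < e ->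
  exists2 A0, 1 <= A0 & forall A, A0 <= A -> \forall z \near +oo, forall p,
    Ex (H p) (fun x => \I[A < `|x|] * (dtail (K p) z - dtail (K p) (z + `|x|)))
    <= e * D z.
Proof.
move=> uH rK e0; have [C C0 HC] := regular_itv_le_scale scaleP rK.
have eC : 0 < e / (2 * C) by rewrite divr_gt0// mulr_gt0.
have [A0 A01 HA] := unif_int_excess uH eC.
exists A0 => // A AA; near=> z.
have Dz : 0 < D z by near: z; exact: scale_gt0.
have Kz p y : 0 <= y ->
    dtail (K p) z - dtail (K p) (z + y) <= C * (y + 1) * D z.
  by move: p y; near: z.
move=> p; have iE := intg_excess A (uH.1 p).
apply: le_trans (_ : 2 * C * D z * excess (H p) A <= _).
  rewrite /excess -ExZ//; apply: Ex_le; [exact: intg_far|exact: intgZ|move=> x].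
  case: (ltP A `|x|) => xA; last by rewrite mul0r !mulr0.
  rewrite mul1r mulr1 (le_trans (Kz _ _ (normr_ge0 x)))//.
  have -> : 2 * C * D z * `|x| = C * (2 * `|x|) * D z by ring.
  by rewrite ler_pM2r// ler_pM2l//; lra.
have -> : e * D z = 2 * C * D z * (e / (2 * C)) by field; rewrite gt_eqF.
by rewrite ler_pM2l ?HA// !mulr_gt0.
Unshelve. all: by end_near. Qed.

Lemma Ex_far (H K : probability R R) A z :
  Ex (K \x H)%E (fun u => \I[A < `|u.2|] * \I[z < u.1 <= z + `|u.2|]) =
  Ex H (fun x => \I[A < `|x|] * (dtail K z - dtail K (z + `|x|))).
Proof.
have zx x : z <= z + `|x| :> R by have := normr_ge0 x; lra.
rewrite Ex_fubini.
- apply: eq_Ex => x /=; rewrite ExZ; last by apply: intg_natb; meas.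
  by rewrite Ex_itv.
- apply: (@intg_bounded _ _ _ _ _ 1) => [|u]; first by meas.
  by rewrite -natrM mulnb normr_nat lern1 leq_b1.
- by move=> x /=; apply: intgZ; apply: intg_natb; meas.
Qed.

Lemma Ex_far_swap (H K : probability R R) A z :
  Ex (H \x K)%E (fun u => \I[A < `|u.1|] * \I[z < u.2 <= z + `|u.1|]) =
  Ex H (fun x => \I[A < `|x|] * (dtail K z - dtail K (z + `|x|))).
Proof.
have zx x : z <= z + `|x| :> R by have := normr_ge0 x; lra.
rewrite Ex_fubini_swap.
- apply: eq_Ex => x /=; rewrite ExZ; last by apply: intg_natb; meas.
  by rewrite Ex_itv.
- apply: (@intg_bounded _ _ _ _ _ 1) => [|u]; first by meas.
  by rewrite -natrM mulnb normr_nat lern1 leq_b1.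
- by move=> x /=; apply: intgZ; apply: intg_natb; meas.
Qed.

Lemma measurable_jump z : measurable_fun setT (@jump R z).
Proof. by rewrite /jump; meas. Qed.

Lemma measurable_both_large A z : measurable_fun setT (@both_large R A z).
Proof. by rewrite /both_large; meas. Qed.

Lemma intg_jump d (T : measurableType d) (P : probability T R) z (X : T -> R * R) :
  measurable_fun setT X -> intg P (jump z \o X).
Proof.
move=> mX; apply: (@intg_bounded _ _ _ _ _ 3).
  by apply: measurableT_comp mX; exact: measurable_jump.
move=> w; rewrite /jump/=; case: (_ < _); case: (_ < _); case: (_ < _);
  rewrite ler_norml /=; apply/andP; split; lra.
Qed.

Lemma Ex_jump (H1 H2 : probability R R) z :
  Ex (H1 \x H2)%E (jump z) =
  Ex (H1 \x H2)%E (fun u => \I[z < u.1 + u.2]) - dtail H1 z - dtail H2 z.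
Proof.
rewrite /jump ExB; [|apply: intgB; apply: intg_natb; meas|apply: intg_natb; meas].
rewrite ExB; [|apply: intg_natb; meas..].
congr (_ - _ - _); rewrite dtailE.
  rewrite Ex_fubini_swap; [|by apply: intg_natb; meas|].
    by apply: eq_Ex => x /=; rewrite Ex_cst.
  by move=> x /=; exact: intg_cst.
rewrite Ex_fubini; [|by apply: intg_natb; meas|].
  by apply: eq_Ex => x /=; rewrite Ex_cst.
by move=> x /=; exact: intg_cst.
Qed.

(** The terms of [jump_split] other than [both_large] receive e / 4 each: two come from a coordinate
    in [-A, A], two from a coordinate of modulus beyond A. Regularity and uniform integrability
    suffice up to this point. *)
Lemma jump_expansion_upto H1 H2 h1 h2 e :
  unif_int H1 -> unif_int H2 ->
  regular D (fun p => dtail (H1 p)) h1 -> regular D (fun p => dtail (H2 p)) h2 ->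
  0 < e ->
  exists2 A0, 1 <= A0 & forall A, A0 <= A -> \forall z \near +oo, forall p,
    `|Ex (H1 p \x H2 p)%E (jump z) - mean (H2 p) * h1 p z - mean (H1 p) * h2 p z
      - Ex (H1 p \x H2 p)%E (fun u => \I[both_large A z u])| <= e * D z.
Proof.
move=> u1 u2 r1 r2 e0; have e40 : 0 < e / 4 by lra.
have [A1 A11 HA1] := small_shift u2 r1 e40.
have [A2 A21 HA2] := small_shift u1 r2 e40.
have [A3 A31 HA3] := small_far u2 r1 e40.
have [A4 A41 HA4] := small_far u1 r2 e40.
exists (A1 + A2 + A3 + A4); first by lra.
move=> A AA; near=> z.
have z2A : 2 * A < z by near: z; apply: nbhs_pinfty_gt; exact: num_real.
have B1 p : `|Ex (H2 p) (fun x => \I[`|x| <= A] *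
    (dtail (H1 p) (z - x) - dtail (H1 p) z)) - mean (H2 p) * h1 p z| <= e / 4 * D z.
  by move: p; near: z; apply: HA1; lra.
have B2 p : `|Ex (H1 p) (fun x => \I[`|x| <= A] *
    (dtail (H2 p) (z - x) - dtail (H2 p) z)) - mean (H1 p) * h2 p z| <= e / 4 * D z.
  by move: p; near: z; apply: HA2; lra.
have B3 p : Ex (H2 p) (fun x => \I[A < `|x|] *
    (dtail (H1 p) z - dtail (H1 p) (z + `|x|))) <= e / 4 * D z.
  by move: p; near: z; apply: HA3; lra.
have B4 p : Ex (H1 p) (fun x => \I[A < `|x|] *
    (dtail (H2 p) z - dtail (H2 p) (z + `|x|))) <= e / 4 * D z.
  by move: p; near: z; apply: HA4; lra.
have A0 : 0 < A by lra.
move=> p.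
pose a (u : R * R) := \I[`|u.2| <= A] * (\I[z - u.2 < u.1] - \I[z < u.1]) : R.
pose b (u : R * R) := \I[`|u.1| <= A] * (\I[z - u.1 < u.2] - \I[z < u.2]) : R.
pose k (u : R * R) := \I[both_large A z u] : R.
pose r (u : R * R) := \I[A < `|u.2|] * \I[z < u.1 <= z + `|u.2|] : R.
pose r' (u : R * R) := \I[A < `|u.1|] * \I[z < u.2 <= z + `|u.1|] : R.
have mb (c1 c2 c3 : bool) : `|\I[c1] * (\I[c2] - \I[c3])| <= 1 :> R.
  by case: c1; case: c2; case: c3; rewrite /= ?mul1r ?mul0r ?subrr ?subr0 ?sub0r
    ?normrN1 ?normr1 ?normr0.
have mb2 (c1 c2 : bool) : `|\I[c1] * \I[c2]| <= 1 :> R.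
  by case: c1; case: c2; rewrite /= ?mul1r ?mul0r ?normr1 ?normr0.
have mk := measurable_both_large A z.
have ia : intg (H1 p \x H2 p)%E a.
  by apply: (@intg_bounded _ _ _ _ _ 1) => [|u]; [rewrite /a; meas|exact: mb].
have ib : intg (H1 p \x H2 p)%E b.
  by apply: (@intg_bounded _ _ _ _ _ 1) => [|u]; [rewrite /b; meas|exact: mb].
have ik : intg (H1 p \x H2 p)%E k by apply: intg_natb.
have ir : intg (H1 p \x H2 p)%E r.
  by apply: (@intg_bounded _ _ _ _ _ 1) => [|u]; [rewrite /r; meas|exact: mb2].
have ir' : intg (H1 p \x H2 p)%E r'.
  by apply: (@intg_bounded _ _ _ _ _ 1) => [|u]; [rewrite /r'; meas|exact: mb2].
have ij : intg (H1 p \x H2 p)%E (jump z).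
  exact: (@intg_jump _ _ _ z id).
have Ea : Ex (H1 p \x H2 p)%E a = Ex (H2 p) (fun x => \I[`|x| <= A] *
    (dtail (H1 p) (z - x) - dtail (H1 p) z)).
  rewrite Ex_fubini//.
    apply: eq_Ex => x; rewrite /a /= ExZ; last by apply: intgB; apply: intg_natb; meas.
    by rewrite ExB ?dtailE//; apply: intg_natb; meas.
  by move=> x; rewrite /a/=; apply: intgZ; apply: intgB; apply: intg_natb; meas.
have Eb : Ex (H1 p \x H2 p)%E b = Ex (H1 p) (fun x => \I[`|x| <= A] *
    (dtail (H2 p) (z - x) - dtail (H2 p) z)).
  rewrite Ex_fubini_swap//.
    apply: eq_Ex => x; rewrite /b /= ExZ; last by apply: intgB; apply: intg_natb; meas.
    by rewrite ExB ?dtailE//; apply: intg_natb; meas.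
  by move=> x; rewrite /b/=; apply: intgZ; apply: intgB; apply: intg_natb; meas.
have split : `|Ex (H1 p \x H2 p)%E (jump z) - Ex (H1 p \x H2 p)%E a
   - Ex (H1 p \x H2 p)%E b - Ex (H1 p \x H2 p)%E k| <=
   Ex (H1 p \x H2 p)%E r + Ex (H1 p \x H2 p)%E r'.
  rewrite -ExB// -ExB//; last exact: intgB.
  rewrite -ExB//; last by apply: intgB => //; exact: intgB.
  rewrite -ExD//; apply: Ex_norm_le; last by move=> u; exact: jump_split.
    by apply: intg_measurable (intgB (intgB (intgB ij ia) ib) ik).
  exact: intgD.
move: split; rewrite Ea Eb Ex_far Ex_far_swap /k.
move: (B1 p) (B2 p) (B3 p) (B4 p); rewrite !ler_norml.
move=> /andP[? ?] /andP[? ?] ? ? /andP[? ?]; apply/andP; split; lra.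
Unshelve. all: by end_near. Qed.

End two_independent_jumps.

Section both_large_coordinates.
Context {R : realType}.
Implicit Types H K : probability R R.

(** The upper ends are kept apart from the threshold z because each comparison with [Phi] moves one
    of them from z to z + 1. *)
Definition large_box (A z z' z'' : R) (u : R * R) : bool :=
  [&& z < u.1 + u.2, A < u.1 <= z' & A < u.2 <= z''].

Lemma both_largeE A z u : both_large A z u = large_box A z z z u.
Proof. by rewrite /both_large /large_box !andbA. Qed.

Lemma measurable_large_box A z z' z'' :
  measurable_fun setT (large_box A z z' z'').
Proof. by rewrite /large_box; meas. Qed.

(** For fixed x the admissible t form the interval ]max(z - x, A), z'], so the event only sees an
    increment of the tail. *)
Lemma Ex_large_section K A z z' x : 0 <= A -> A <= z' -> z <= z' -> A < x ->
  Ex K (fun t => \I[(z < t + x) && (A < t <= z')]) =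
  dtail K (Num.max (z - x) A) - dtail K z'.
Proof.
move=> A0 Az' zz' Ax; rewrite -Ex_itv; last by rewrite ge_max; apply/andP; split; lra.
apply: eq_Ex => t; rewrite gt_max ltrBlDr.
by case: (z < t + x); case: (A < t).
Qed.

Lemma Ex_large_box K H A z z' z'' : 0 <= A -> A <= z' -> z <= z' ->
  Ex (K \x H)%E (fun u => \I[large_box A z z' z'' u]) =
  Ex H (fun x => \I[A < x <= z''] *
    (dtail K (Num.max (z - x) A) - dtail K z')).
Proof.
move=> A0 Az' zz'; have mb := measurable_large_box A z z' z''.
rewrite Ex_fubini; [|exact: intg_natb|].
  apply: eq_Ex => x; case: (boolP (A < x <= z'')) => Axz; last first.
    rewrite mul0r -[RHS](Ex_cst K); apply: eq_Ex => t.
    by rewrite /large_box/= (negbTE Axz) !andbF.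
  have /andP[Ax _] := Axz.
  rewrite mul1r -Ex_large_section//; apply: eq_Ex => t.
  by rewrite /large_box/= Axz andbT.
by move=> x; apply: intg_natb; rewrite /large_box/=; meas.
Qed.

Lemma Ex_large_box_swap K H A z z' z'' : 0 <= A -> A <= z'' -> z <= z'' ->
  Ex (K \x H)%E (fun u => \I[large_box A z z' z'' u]) =
  Ex K (fun t => \I[A < t <= z'] *
    (dtail H (Num.max (z - t) A) - dtail H z'')).
Proof.
move=> A0 Az' zz'; have mb := measurable_large_box A z z' z''.
rewrite Ex_fubini_swap; [|exact: intg_natb|].
  apply: eq_Ex => t; case: (boolP (A < t <= z')) => Atz; last first.
    rewrite mul0r -[RHS](Ex_cst H); apply: eq_Ex => x.
    by rewrite /large_box/= (negbTE Atz) andFb andbF.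
  have /andP[At _] := Atz.
  rewrite mul1r -Ex_large_section//; apply: eq_Ex => x.
  by rewrite /large_box/= Atz andTb addrC.
by move=> x; apply: intg_natb; rewrite /large_box/=; meas.
Qed.

Lemma intg_large_section H K A z z' z'' :
  intg H (fun x => \I[A < x <= z''] *
    (dtail K (Num.max (z - x) A) - dtail K z')).
Proof.
have mT := measurable_dtail K.
apply: (@intg_bounded _ _ _ _ _ 1).
  apply: measurable_mulf; first by meas.
  apply: measurable_subf; last by meas.
  apply: (measurableT_comp mT); apply: measurable_maxr; last by meas.
  by meas.
move=> x; rewrite normrM -[leRHS]mulr1 ler_pM//.
  by case: (_ && _); rewrite ?normr1 ?normr0.
have := dtail_ge0 K (Num.max (z - x) A); have := dtail_le1 K (Num.max (z - x) A).
have := dtail_ge0 K z'; have := dtail_le1 K z'.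
by rewrite ler_norml => ? ? ? ?; apply/andP; split; lra.
Qed.

Lemma Ex_indep_bool H K (b c : R -> bool) :
  measurable_fun setT b -> measurable_fun setT c ->
  Ex (H \x K)%E (fun u => \I[b u.1 && c u.2]) =
  Ex H (fun x => \I[b x]) * Ex K (fun x => \I[c x]).
Proof.
move=> mb mc; rewrite Ex_fubini.
- rewrite -ExZ; last exact: intg_natb.
  apply: eq_Ex => y /=; case: (c y).
    by rewrite mulr1; apply: eq_Ex => x; rewrite andbT.
  by rewrite mulr0 -[RHS](Ex_cst H); apply: eq_Ex => x; rewrite andbF.
- apply: intg_natb; apply: measurable_andf.
    exact: (measurableT_comp mb measurable_fst).
  exact: (measurableT_comp mc measurable_snd).
- by move=> y /=; apply: intg_natb; meas.
Qed.

Lemma dtail_excess H A : intg H id -> 1 <= A -> dtail H A <= excess H A.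
Proof.
move=> iH A1; rewrite dtailE; apply: Ex_le.
- by apply: intg_natb; meas.
- exact: intg_excess.
- move=> x; have nx := ler_norm x; case: (ltP A x) => Ax; last first.
    by rewrite mulr_ge0.
  rewrite (lt_le_trans Ax nx).
  by rewrite mulr1 /=; lra.
Qed.

End both_large_coordinates.

Section two_jump_expansion.
Context {R : realType} (Phi : probability R R).
Local Notation D := (scale Phi).
Hypothesis scaleP : scale_function D.

(** Enlarging the box only adds points with one coordinate in ]z, z + 1] and the other beyond A;
    each of the two cases has probability [dtail Phi A * D z]. *)
Lemma Ex_large_box_Phi A z :
  Ex (Phi \x Phi)%E (fun u => \I[large_box A z (z + 1) (z + 1) u]) <=
  Ex (Phi \x Phi)%E (fun u => \I[both_large A z u]) + 2 * dtail Phi A * D z.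
Proof.
have -> : 2 * dtail Phi A * D z =
    Ex (Phi \x Phi)%E (fun u => \I[(A < u.1) && (z < u.2 <= z + 1)])
  + Ex (Phi \x Phi)%E (fun u => \I[(z < u.1 <= z + 1) && (A < u.2)]).
  rewrite (@Ex_indep_bool _ _ _ (fun x => A < x) (fun x => z < x <= z + 1)); try meas.
  rewrite (@Ex_indep_bool _ _ _ (fun x => z < x <= z + 1) (fun x => A < x)); try meas.
  by rewrite -dtailE Ex_itv /scale; [ring|lra].
have m1 := measurable_large_box A z (z + 1) (z + 1).
have m2 := measurable_both_large A z.
have i1 : intg (Phi \x Phi)%E (fun u => \I[(A < u.1) && (z < u.2 <= z + 1)]).
  by apply: intg_natb; meas.
have i2 : intg (Phi \x Phi)%E (fun u => \I[(z < u.1 <= z + 1) && (A < u.2)]).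
  by apply: intg_natb; meas.
have i3 : intg (Phi \x Phi)%E (fun u => \I[both_large A z u]) by exact: intg_natb.
rewrite -ExD// -ExD//; last exact: intgD.
apply: Ex_le; [exact: intg_natb|by apply: intgD => //; exact: intgD|].
move=> [t x]; rewrite -!natrD ler_nat /large_box /both_large /=.
case: (z < t + x) => //=; case: (A < t) => //=.
case: (A < x) => /=; last by rewrite ?andbF.
rewrite ?andbT; case: (leP t z) => tz; case: (leP x z) => xz //=.
- by case: (_ && _).
- by case: (t <= z + 1); case: (x <= z + 1).
- by case: (t <= z + 1); case: (x <= z + 1).
- by case: (t <= z + 1); case: (x <= z + 1).
Qed.

(** The laws are exchanged for [Phi] one coordinate at a time: with the other coordinate fixed the
    event is an interval, to which [regular_itv_le] applies; integrating in the other order prepares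
    the second exchange. *)
Lemma both_large_le (I : Type) (H1 H2 : I -> probability R R) h1 h2 :
  regular D (fun p => dtail (H1 p)) h1 -> regular D (fun p => dtail (H2 p)) h2 ->
  exists2 C, 0 < C & exists v0, forall A z p, v0 <= A -> A <= z ->
    Ex (H1 p \x H2 p)%E (fun u => \I[both_large A z u]) <=
    C * (Ex (Phi \x Phi)%E (fun u => \I[both_large A z u])
         + 2 * dtail Phi A * D z).
Proof.
move=> /regular_itv_le[C1 C10 [v1 HC1]] /regular_itv_le[C2 C20 [v2 HC2]].
exists (C1 * C2); first by rewrite mulr_gt0.
exists (`|v1| + `|v2|) => A z p vA Az.
have nv1 := ler_norm v1; have nv2 := ler_norm v2.
have nv10 := normr_ge0 v1; have nv20 := normr_ge0 v2.
have A0 : 0 <= A by lra.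
rewrite [leLHS](_ : _ =
    Ex (H1 p \x H2 p)%E (fun u => \I[large_box A z z z u])); last first.
  by apply: eq_Ex => u; rewrite both_largeE.
apply: le_trans (_ : C1 * Ex (Phi \x H2 p)%E
    (fun u => \I[large_box A z (z + 1) z u]) <= _).
  rewrite !Ex_large_box//; try lra.
  rewrite -ExZ; last exact: intg_large_section.
  apply: Ex_le; [exact: intg_large_section|exact: intgZ (intg_large_section _ _ _ _ _ _)|].
  move=> x; case: (boolP (A < x <= z)) => [/andP[Ax xz]|_]; last by rewrite !mul0r mulr0.
  rewrite !mul1r HC1//; first by rewrite le_max; apply/orP; right; lra.
  by rewrite ge_max; apply/andP; split; lra.
rewrite -mulrA ler_pM2l//.
apply: le_trans (_ : C2 * Ex (Phi \x Phi)%E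
    (fun u => \I[large_box A z (z + 1) (z + 1) u]) <= _).
  rewrite !Ex_large_box_swap//; try lra.
  rewrite -ExZ; last exact: intg_large_section.
  apply: Ex_le; [exact: intg_large_section|exact: intgZ (intg_large_section _ _ _ _ _ _)|].
  move=> x; case: (boolP (A < x <= z + 1)) => [/andP[Ax xz]|_]; last by rewrite !mul0r mulr0.
  rewrite !mul1r HC2//; first by rewrite le_max; apply/orP; right; lra.
  by rewrite ge_max; apply/andP; split; lra.
by rewrite ler_pM2l// Ex_large_box_Phi.
Qed.

Hypothesis intgPhi : intg Phi id.
Hypothesis regularPhi : regular D (fun _ : unit => dtail Phi) (fun _ => D).
Hypothesis jumpPhi : negl D (fun (_ : unit) z =>
  Ex (Phi \x Phi)%E (jump z) - 2 * mean Phi * D z).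

Lemma unif_int_cst (I : Type) : unif_int (fun _ : I => Phi).
Proof.
split=> // e e0.
have [B HB] := integrable_tail_small (intg_norm intgPhi) (fun w => normr_ge0 _) e0.
by exists B => _; exact: HB.
Qed.

(** For two copies of [Phi] the expansion containing [both_large] and the S_2 asymptotics [jumpPhi]
    have the same main term; subtracting them leaves the claim. Subexponentiality enters here. *)
Lemma both_large_Phi e : 0 < e -> exists A0, forall A, A0 <= A ->
  \forall z \near +oo, Ex (Phi \x Phi)%E (fun u => \I[both_large A z u]) <= e * D z.
Proof.
move=> e0; have e20 : 0 < e / 2 by lra.
have [A0 A01 HA] := jump_expansion_upto scaleP (unif_int_cst unit)
  (unif_int_cst unit) regularPhi regularPhi e20.
exists A0 => A AA; have /= HH := HA A AA; near=> z.
have J : `|Ex (Phi \x Phi)%E (jump z) - 2 * mean Phi * D z| <= e / 2 * D z.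
  by move: tt; near: z; exact: jumpPhi.
have K : forall p : unit, `|Ex (Phi \x Phi)%E (jump z) - mean Phi * D z - mean Phi * D z
   - Ex (Phi \x Phi)%E (fun u => \I[both_large A z u])| <= e / 2 * D z.
  by near: z; exact: HH.
move: (K tt) J; clear; rewrite !ler_norml => /andP[? ?] /andP[? ?]; lra.
Unshelve. all: by end_near. Qed.

Lemma jump_expansion (I : Type) (H1 H2 : I -> probability R R) h1 h2 :
  unif_int H1 -> unif_int H2 ->
  regular D (fun p => dtail (H1 p)) h1 -> regular D (fun p => dtail (H2 p)) h2 ->
  negl D (fun p z => Ex (H1 p \x H2 p)%E (jump z)
                     - mean (H2 p) * h1 p z - mean (H1 p) * h2 p z).
Proof.
move=> u1 u2 r1 r2 e e0; have e20 : 0 < e / 2 by lra.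
have [C C0 [v0 HC]] := both_large_le r1 r2.
(* Used once for [both_large] under [Phi] and twice for the tail at A; times [C] this makes 3 e / 8,
   below e / 2. *)
have eC : 0 < e / (8 * C) by rewrite divr_gt0// mulr_gt0.
have [A1 A11 HA1] := jump_expansion_upto scaleP u1 u2 r1 r2 e20.
have [A2 HA2] := both_large_Phi eC.
have [A3 A31 HA3] := unif_int_excess (unif_int_cst unit) eC.
pose A := A1 + `|A2| + A3 + `|v0|.
have A2A : A2 <= A by rewrite /A; have := ler_norm A2; have := normr_ge0 v0; lra.
have AA1 : A1 <= A by rewrite /A; have := normr_ge0 A2; have := normr_ge0 v0; lra.
have AA3 : A3 <= A by rewrite /A; have := normr_ge0 A2; have := normr_ge0 v0; lra.
have Av0 : v0 <= A by rewrite /A; have := normr_ge0 A2; have := ler_norm v0; lra.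
near=> z.
have Az : A <= z by near: z; apply: nbhs_pinfty_ge; exact: num_real.
have Dz : 0 < D z by near: z; exact: scale_gt0.
have B p : `|Ex (H1 p \x H2 p)%E (jump z) - mean (H2 p) * h1 p z - mean (H1 p) * h2 p z
      - Ex (H1 p \x H2 p)%E (fun u => \I[both_large A z u])| <= e / 2 * D z.
  by move: p; near: z; exact: HA1.
have K : Ex (Phi \x Phi)%E (fun u => \I[both_large A z u]) <= e / (8 * C) * D z.
  by near: z; exact: HA2.
have T : dtail Phi A <= e / (8 * C).
  by apply: le_trans (HA3 A AA3 tt); apply: dtail_excess => //; lra.
move=> p.
have K0 : 0 <= Ex (H1 p \x H2 p)%E (fun u => \I[both_large A z u]).
  by apply: Ex_ge0 => u.
have {}K : Ex (H1 p \x H2 p)%E (fun u => \I[both_large A z u]) <= e / 2 * D z.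
  rewrite (le_trans (HC A z p Av0 Az))//.
  have -> : e / 2 * D z = C * (e / (8 * C) * D z + 3 * (e / (8 * C)) * D z).
    by field; rewrite gt_eqF.
  rewrite ler_pM2l//; apply: lerD => //; rewrite ler_pM2r//; lra.
have -> : e * D z = e / 2 * D z + e / 2 * D z by field.
set k := Ex _ (fun u => \I[both_large A z u]) in K0 K.
rewrite -[X in `|X|](subrK k) (le_trans (ler_normD _ _))// lerD//.
  exact: B.
by rewrite ger0_norm.
Unshelve. all: by end_near. Qed.

End two_jump_expansion.

(** * Local long-tailedness *)

Section locally_long_tailed.
Context {R : realType} (F : probability R R).
Hypothesis LF : class_LDelta F.

Let w t z := dtail F z - dtail F (z + t).

Let w_ge0 t z : 0 <= t -> 0 <= w t z.
Proof. by move=> t0; rewrite subr_ge0 dtail_nonincreasing//; lra. Qed.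

(** If the increment vanished, the ratio at y = 0 would be 0 by the convention on division, hence at
    distance 1 from its limit. *)
Lemma LDelta_gt0 t : 0 < t -> \forall z \near +oo, 0 < w t z.
Proof.
move=> t0; apply: filterS (LF t0 ltr01) => z /(_ 0); rewrite lexx ler01 addr0.
move=> /(_ isT); rewrite dincrE -/(w t z) => h.
rewrite lt_neqAle w_ge0 ?ltW// andbT; apply/eqP => w0; move: h.
by rewrite -w0 mul0r sub0r normrN1 ltxx.
Qed.

(** The class only speaks of shifts in [0, 1]. A negative shift is a positive one from the moved
    base point, and longer shifts are iterated. *)
Lemma LDelta_shift_nat t (k : nat) e : 0 < t -> 0 < e ->
  \forall z \near +oo, forall y, `|y| <= k%:R -> `|w t (z + y) - w t z| <= e * w t z.
Proof.
move=> t0.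
have right e' : 0 < e' -> \forall z \near +oo, forall y, 0 <= y <= 1 ->
    `|w t (z + y) - w t z| <= e' * w t z.
  move=> e'0; near=> z.
  have wz : 0 < w t z by near: z; exact: LDelta_gt0.
  have Lz y : 0 <= y <= 1 -> `|dincr F (z + y) t / dincr F z t - 1| < e'.
    by move: y; near: z; exact: LF.
  move=> y /Lz; rewrite !dincrE -/(w t z) -/(w t (z + y)).
  have -> : w t (z + y) / w t z - 1 = (w t (z + y) - w t z) / w t z.
    by field; rewrite gt_eqF.
  by rewrite normrM normfV (gtr0_norm wz) ltr_pdivrMr// => /ltW.
have both e' : 0 < e' -> \forall z \near +oo, forall y, `|y| <= 1 ->
    `|w t (z + y) - w t z| <= e' * w t z.
  (* With a <= 1 / 2 the estimate from the base point z + y yields [w t (z + y) <= 2 * w t z], which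
     brings the error back to z. *)
  move=> e'0; pose a := Num.min (e' / 2) 2^-1.
  have a0 : 0 < a by rewrite lt_min; apply/andP; split; lra.
  have a2 : a <= 2^-1 by rewrite ge_min lexx orbT.
  have ae : a <= e' / 2 by rewrite ge_min lexx.
  near=> z.
  have A y : 0 <= y <= 1 -> `|w t (z + y) - w t z| <= a * w t z.
    by move: y; near: z; exact: right.
  have B y : `|y| <= 1 -> forall x, 0 <= x <= 1 ->
      `|w t (z - y + x) - w t (z - y)| <= a * w t (z - y).
    move: y; near: z;
    apply: (@near_window R (fun z => forall x, 0 <= x <= 1 -> `|w t (z + x) - w t z| <= a * w t z)).
    exact: right.
  move=> y y1; have wz := w_ge0 z (ltW t0); have wzy := w_ge0 (z + y) (ltW t0).
  move: (y1); rewrite ler_norml => /andP[y11 y12].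
  have [y0|y0] := lerP 0 y.
    have y01 : 0 <= y <= 1 by apply/andP.
    apply: le_trans (A y y01) _; apply: ler_wpM2r => //; lra.
  have Ny1 : `|- y| <= 1 by rewrite normrN.
  have Ny01 : 0 <= - y <= 1 by apply/andP; split; lra.
  have := B (- y) Ny1 (- y) Ny01; rewrite opprK addrK => h.
  have h2 : w t (z + y) <= 2 * w t z.
    have := ler_wpM2r wzy a2; move: h; rewrite ler_norml => /andP[? ?]; lra.
  rewrite distrC (le_trans h)//.
  have := ler_wpM2r wzy ae; have := ler_wpM2l (ltW e'0) h2; lra.
elim: k e => [|k IH] e e0.
  near=> z => y; rewrite normr_le0 => /eqP ->.
  by rewrite addr0 subrr normr0 mulr_ge0// ?w_ge0// ltW.
pose a := Num.min (e / 3) 1.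
have a0 : 0 < a by rewrite lt_min; apply/andP; split; lra.
have a2 : a <= 1 by rewrite ge_min lexx orbT.
have ae : a <= e / 3 by rewrite ge_min lexx.
near=> z.
have A y : `|y| <= k%:R -> `|w t (z + y) - w t z| <= a * w t z.
  by move: y; near: z; exact: IH.
have B y : `|y| <= k%:R -> forall x, `|x| <= 1 ->
    `|w t (z - y + x) - w t (z - y)| <= a * w t (z - y).
  move: y; near: z;
  apply: (@near_window R (fun z => forall x, `|x| <= 1 -> `|w t (z + x) - w t z| <= a * w t z)).
  exact: both.
(* The proportional splitting gives |v| <= k and |x| <= 1 whatever the sign of y. *)
move=> y yk; pose x := y / k.+1%:R; pose v := y - x.
have k1 : 0 < k.+1%:R :> R by rewrite ltr0n.
have x1 : `|x| <= 1.
  by rewrite normrM normfV (gtr0_norm k1) ler_pdivrMr// mul1r.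
have vk : `|v| <= k%:R.
  have -> : v = x * k%:R.
    by rewrite /v /x -natr1; field; rewrite natr1 gt_eqF.
  by rewrite normrM normr_nat ler_piMl.
have wz := w_ge0 z (ltW t0).
have A1 := A v vk.
have Nv : `|- v| <= k%:R by rewrite normrN.
have := B (- v) Nv x x1; rewrite opprK => B1.
have yE : z + v + x = z + y by rewrite /v; ring.
rewrite yE in B1.
have wv : w t (z + v) <= 2 * w t z.
  have := ler_wpM2r wz a2; move: A1; rewrite ler_norml => /andP[? ?]; lra.
rewrite -(subrKA (w t (z + v))) (le_trans (ler_normD _ _))//.
have := ler_wpM2l (ltW a0) wv; have := ler_wpM2r wz ae; lra.
Unshelve. all: by end_near. Qed.

(** Shift invariance only compares increments of equal length. Different lengths are compared
    through a mesh t = 1 / N: ]z, z + 1] and, up to one cell, ]z, z + y] are unions of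
    asymptotically equal cells. *)
Lemma LDelta_linear M e : 0 < e -> \forall z \near +oo, forall y, 0 <= y <= M ->
  `|dtail F z - dtail F (z + y) - y * scale F z| <= e * scale F z.
Proof.
move=> e0.
pose m := (Num.truncn `|M|).+1; have Mm : M <= m%:R.
  by rewrite (le_trans (ler_norm M))// ltW// Num.Theory.truncnS_gt.
(* The total error will be two cells, and N cells weigh at most [2 * scale F z]. *)
pose N := (Num.truncn (4 / e)).+1; have eN : 4 / e < N%:R by exact: Num.Theory.truncnS_gt.
have m1 : 1 <= m%:R :> R by rewrite ler1n.
have N1 : 1 <= N%:R :> R by rewrite ler1n.
pose t : R := N%:R^-1; have t0 : 0 < t by rewrite invr_gt0; lra.
have Nt : N%:R * t = 1 by rewrite divff// gt_eqF//; lra.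
(* At most N m + 1 cells are added, the last one for rounding up, so the relative errors accumulate
   to at most half a cell. *)
pose a : R := (2 * (N * m + 1)%:R)^-1.
have a0 : 0 < a by rewrite invr_gt0 mulr_gt0// ltr0n addn1.
near=> z.
have wz : 0 < w t z by near: z; exact: LDelta_gt0.
have S y : `|y| <= m.+1%:R -> `|w t (z + y) - w t z| <= a * w t z.
  by move: y; near: z; exact: LDelta_shift_nat.
have steps k : (k <= N * m + 1)%N ->
    `|dtail F z - dtail F (z + k%:R * t) - k%:R * w t z| <= k%:R * (a * w t z).
  elim: k => [|k IH] kN.
    by rewrite !mul0r addr0 subrr subr0 normr0.
  have kt : `|k%:R * t| <= m.+1%:R.
    rewrite ger0_norm; last by rewrite mulr_ge0// ltW.
    rewrite -(ler_pM2r (_ : 0 < N%:R)); last by lra.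
    rewrite -mulrA [t * _]mulrC Nt mulr1 -natrM ler_nat.
    by apply: (leq_trans (ltnW kN)); rewrite mulSn addnC mulnC leq_add2r.
  have := S _ kt; have := IH (ltnW kN).
  have -> : z + k.+1%:R * t = z + k%:R * t + t by rewrite -natr1; ring.
  rewrite /w -natr1 !ler_norml => /andP[? ?] /andP[? ?]; apply/andP; split; lra.
move=> y /andP[y0 yM].
have yN0 : 0 <= y * N%:R by rewrite mulr_ge0.
have /andP[k1 k2] := Num.Theory.truncn_itv yN0.
set k := Num.truncn _ in k1 k2.
have kN : (k.+1 <= N * m + 1)%N.
  rewrite addn1 ltnS -(ler_nat R) (le_trans k1)// natrM mulrC ler_wpM2l//.
  by rewrite (le_trans yM).
have kt1 : k%:R * t <= y.
  by rewrite ler_pdivrMr//; lra.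
have kt2 : y <= k.+1%:R * t by rewrite ler_pdivlMr ?ltW//; lra.
have T1 : dtail F (z + y) <= dtail F (z + k%:R * t).
  by apply: dtail_nonincreasing; lra.
have T2 : dtail F (z + k.+1%:R * t) <= dtail F (z + y).
  by apply: dtail_nonincreasing; lra.
have S1 := steps k (ltnW kN); have S2 := steps k.+1 kN.
have NN : (N <= N * m + 1)%N by rewrite addn1 ltnW// ltnS leq_pmulr.
have S3 := steps N NN; rewrite Nt -/(scale F z) in S3.
have aN (j : nat) : (j <= N * m + 1)%N -> j%:R * (a * w t z) <= 2^-1 * w t z.
  move=> jN; rewrite mulrA ler_pM2r// /a invfM mulrCA ler_piMr//.
  rewrite ler_pdivrMr ?ltr0n ?addn1// mul1r ler_nat.
  by rewrite -addn1.
have a1 := aN _ (ltnW kN); have a2 := aN _ kN; have a3 := aN _ NN.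
have ym : y * (N%:R * (a * w t z)) <= 2^-1 * w t z.
  apply: le_trans (aN (N * m)%N _); last by rewrite addn1.
  rewrite natrM [N%:R * m%:R]mulrC -mulrA ler_wpM2r//.
    by rewrite !mulr_ge0// ltW.
  exact: le_trans yM Mm.
have wN : N%:R * w t z <= 2 * scale F z.
  have : w t z <= N%:R * w t z by rewrite ler_peMl// ltW.
  move: S3; rewrite ler_norml => /andP[? ?]; lra.
have we : 2 * w t z <= e * scale F z.
  have : 4 / e * w t z <= 2 * scale F z by apply: le_trans wN; rewrite ler_pM2r// ltW.
  move=> h; have := ler_wpM2l (ltW e0) h.
  have -> : e * (4 / e * w t z) = 4 * w t z by field; rewrite gt_eqF.
  lra.
(* Two cells in all: one for rounding y to the mesh, half for the accumulated error, half for
   exchanging [N%:R * w t z] for the scale. *)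
apply: le_trans we.
have S4 : `|y * (scale F z - N%:R * w t z)| <= 2^-1 * w t z.
  rewrite normrM ger0_norm// (le_trans _ ym)// ler_wpM2l//.
move: S1 S2 S4; rewrite -natr1 !ler_norml => /andP[? ?] /andP[? ?] /andP[? ?].
have k1w : k%:R * w t z <= y * N%:R * w t z by rewrite ler_pM2r.
have k2w : y * N%:R * w t z <= (k%:R + 1) * w t z.
  by rewrite ler_pM2r// natr1 ltW.
rewrite -natr1 in a2; rewrite -natr1 in T2.
apply/andP; split; lra.
Unshelve. all: by end_near. Qed.

Lemma LDelta_shift M e : 0 < e -> \forall z \near +oo, forall x, `|x| <= M ->
  `|scale F (z - x) - scale F z| <= e * scale F z.
Proof.
move=> e0; pose m := (Num.truncn `|M|).+1.
have Mm : M <= m%:R.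
  by rewrite (le_trans (ler_norm M))// ltW// Num.Theory.truncnS_gt.
have := LDelta_shift_nat m ltr01 e0; apply: filterS => z h x xM.
by apply: h; rewrite normrN (le_trans xM).
Qed.

Lemma LDelta_regular :
  regular (scale F) (fun _ : unit => dtail F) (fun _ => scale F).
Proof.
split.
  exists 1 => //; near=> z => _; rewrite mul1r ger0_norm// subr_ge0.
  by apply: dtail_nonincreasing; lra.
move=> M e e0; have e20 : 0 < e / 2 by lra.
pose a := Num.min (e / 4) 1.
have a0 : 0 < a by rewrite lt_min; apply/andP; split; lra.
have a2 : a <= 1 by rewrite ge_min lexx orbT.
have ae : a <= e / 4 by rewrite ge_min lexx.
pose b := e / 2 / (`|M| + 1).
have M1 : 0 < `|M| + 1 by have := normr_ge0 M; lra.
have b0 : 0 < b by rewrite divr_gt0.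
near=> z.
have Dz : 0 < scale F z by near: z; exact: LDelta_gt0.
have A y : 0 <= y <= M -> `|dtail F z - dtail F (z + y) - y * scale F z| <= a * scale F z.
  by move: y; near: z; exact: LDelta_linear.
have B x : `|x| <= M -> forall y, 0 <= y <= M ->
    `|dtail F (z - x) - dtail F (z - x + y) - y * scale F (z - x)| <= a * scale F (z - x).
  move: x; near: z; apply: (@near_window R (fun z => forall y, 0 <= y <= M ->
    `|dtail F z - dtail F (z + y) - y * scale F z| <= a * scale F z)).
  exact: LDelta_linear.
have C x : `|x| <= M -> `|scale F (z - x) - scale F z| <= b * scale F z.
  by move: x; near: z; exact: LDelta_shift.
have C1 x : `|x| <= M -> `|scale F (z - x) - scale F z| <= 1 * scale F z.
  by move: x; near: z; exact: LDelta_shift.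
move=> _ x xM; move: (xM); rewrite ler_norml => /andP[x1 x2].
(* For x < 0 this is the linear expansion from z; for x >= 0 it is the one from z - x, with
   [scale F (z - x)] then exchanged for [scale F z]. *)
have [x0|x0] := lerP 0 x; last first.
  have h : 0 <= - x <= M by apply/andP; split; lra.
  have := A (- x) h; rewrite mulNr opprK => h'.
  have -> : dtail F (z - x) - dtail F z - x * scale F z =
    - (dtail F z - dtail F (z - x) + x * scale F z) by ring.
  rewrite normrN (le_trans h')//.
  by rewrite ler_pM2r//; lra.
have xx : 0 <= x <= M by apply/andP.
have := B x xM x xx; rewrite subrK => Bx.
have Cx : `|x * (scale F (z - x) - scale F z)| <= e / 2 * scale F z.
  have -> : e / 2 * scale F z = (`|M| + 1) * (b * scale F z).
    by rewrite /b; field; rewrite gt_eqF.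
  rewrite normrM ler_pM//; last exact: C.
  by rewrite (le_trans xM)// (le_trans (ler_norm M))//; lra.
have D2 : a * scale F (z - x) <= e / 2 * scale F z.
  have h : scale F (z - x) <= 2 * scale F z.
    by have := C1 x xM; rewrite ler_norml => /andP[? ?]; lra.
  have e40 : 0 <= e / 4 by lra.
  have s0 : 0 <= scale F (z - x).
    by rewrite subr_ge0; apply: dtail_nonincreasing; lra.
  have := ler_wpM2r s0 ae; have := ler_wpM2l e40 h; lra.
move: Bx Cx; rewrite !ler_norml => /andP[? ?] /andP[? ?]; apply/andP; split; lra.
Unshelve. all: by end_near. Qed.

End locally_long_tailed.

Section change_of_scale.
Context {R : realType} (D D' : R -> R).

(** G is regular on its own scale; as the scales of F and G have the same order, this carries its
    regularity over to the scale of F. *)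
Lemma regular_le_scale (I : Type) (T h : I -> R -> R) C : 0 < C ->
  (\forall z \near +oo, D' z <= C * D z) -> regular D' T h -> regular D T h.
Proof.
move=> C0 DD [[B B0 dh] r]; split.
  exists (B * C); first by rewrite mulr_gt0.
  near=> z.
  have A : D' z <= C * D z by near: z.
  have H p : `|h p z| <= B * D' z by move: p; near: z; exact: dh.
  by move=> p; rewrite (le_trans (H p))// -mulrA ler_pM2l.
move=> M e e0; have eC : 0 < e / C by rewrite divr_gt0.
near=> z.
have A : D' z <= C * D z by near: z.
have H p x : `|x| <= M -> `|T p (z - x) - T p z - x * h p z| <= e / C * D' z.
  by move: p x; near: z; exact: r.
move=> p x xM; rewrite (le_trans (H p x xM))//.
have -> : e * D z = e / C * (C * D z) by field; rewrite gt_eqF.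
by rewrite ler_pM2l.
Unshelve. all: by end_near. Qed.

End change_of_scale.

(** * Mixtures and the FGM law *)

Section sums_of_measures.
Context d (T : measurableType d) (R : realType).
Variables (nu : probability T R) (n : nat) (m : nat -> probability T R)
  (w : nat -> {nonneg R}).
Hypothesis nuE : forall S, measurable S ->
  nu S = (\sum_(k < n) (w k)%:num%:E * m k S)%E.

Let mix := msum (fun k => mscale (w k) (m k)) n.

Let ge0_integral_mix (f : T -> \bar R) : measurable_fun setT f ->
  (forall x, 0 <= f x)%E ->
  (\int[nu]_x f x = \sum_(k < n) (w k)%:num%:E * \int[m k]_x f x)%E.
Proof.
move=> mf f0; rewrite (@eq_measure_integral _ _ _ _ mix); last first.
  by move=> A mA _; exact: (nuE mA).
rewrite ge0_integral_measure_sum//; apply: eq_bigr => k _.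
by rewrite ge0_integral_mscale.
Qed.

Lemma intg_mixture (f : T -> R) : (0 < n)%N -> 
  (forall k, (k < n)%N -> intg (m k) f) -> intg nu f.
Proof.
move=> n0 intf; have /integrableP[mf _] := intf 0%N n0.
apply/integrableP; split => //.
rewrite ge0_integral_mix//; last exact: measurableT_comp.
apply: lte_sum_pinfty => k _; apply: lte_mul_pinfty => //.
by have /integrableP[] := intf k (ltn_ord k).
Qed.

(** The integral against a weighted sum of measures splits for nonnegative functions, hence the
    passage through positive and negative parts. *)
Lemma Ex_mixture (f : T -> R) : (0 < n)%N ->
  (forall k, (k < n)%N -> intg (m k) f) ->
  Ex nu f = \sum_(k < n) (w k)%:num * Ex (m k) f.
Proof.
move=> n0 intf; have mf := intg_measurable (intf 0%N n0).
pose fp x := Num.max (f x) 0; pose fn x := Num.max (- f x) 0.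
have mfp : measurable_fun setT fp by apply: measurable_maxr => //; meas.
have mfn : measurable_fun setT fn.
  by apply: measurable_maxr => //; exact: measurable_oppf.
have fE x : f x = fp x - fn x.
  rewrite /fp /fn; case: (leP (f x) 0) => h.
    by rewrite max_l; lra.
  by rewrite max_r; lra.
have fp0 x : 0 <= fp x by rewrite le_max lexx orbT.
have fn0 x : 0 <= fn x by rewrite le_max lexx orbT.
have fpf x : `|fp x| <= `|f x|.
  by rewrite ger0_norm// ge_max normr_ge0 ler_norm.
have fnf x : `|fn x| <= `|f x|.
  by rewrite ger0_norm// ge_max normr_ge0 -normrN ler_norm.
have ifp k : (k < n)%N -> intg (m k) fp.
  by move=> kn; apply: intg_le mfp fpf _; exact: intg_norm (intf k kn).
have ifn k : (k < n)%N -> intg (m k) fn.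
  by move=> kn; apply: intg_le mfn fnf _; exact: intg_norm (intf k kn).
have ge0E (g : T -> R) : measurable_fun setT g -> (forall x, 0 <= g x) ->
    (forall k, (k < n)%N -> intg (m k) g) ->
    Ex nu g = \sum_(k < n) (w k)%:num * Ex (m k) g.
  move=> mg g0 ig; rewrite /Ex /Rintegral ge0_integral_mix;
    [|exact/measurable_EFinP|by move=> x; rewrite lee_fin].
  rewrite -sum_fine => [|k _]; last first.
    by rewrite fin_numM//; exact: (integrable_fin_num measurableT (ig k (ltn_ord k))).
  apply: eq_bigr => k _; rewrite fineM//.
  exact: (integrable_fin_num measurableT (ig k (ltn_ord k))).
rewrite (eq_Ex _ fE) ExB; [|exact: intg_mixture..].
rewrite !ge0E// -sumrB; apply: eq_bigr => k _.
by rewrite -mulrBr -ExB ?(eq_Ex _ fE)//; [exact: ifp|exact: ifn].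
Qed.

End sums_of_measures.

(** * Measures on the plane determined by quadrants *)

Section uniqueness_in_the_plane.
Context {R : realType}.

Let quadrants : set (set (R * R)) :=
  [set A | exists x y, A = `]-oo, x]%classic `*` `]-oo, y]%classic].

(** The half-plane where a coordinate exceeds x is the complement of a countable union of quadrants,
    so both projections are measurable for the generated sigma-algebra. *)
Lemma measurable_quadrants : (measurable : set (set (R * R))) = <<s quadrants >>.
Proof.
apply/seteqP; split; last first.
  apply: smallest_sub; first exact: sigma_algebra_measurable.
  by move=> _ [x [y ->]]; exact: measurableX.
pose U := g_sigma_algebraType quadrants.
have msub (x y : R) : measurable ((`]-oo, x] `*` `]-oo, y])%classic : set U).
  by apply: sub_sigma_algebra; exists x, y.
have mfst : measurable_fun setT (fst : U -> R).
  apply: (measurability _ (RGenOInfty.measurableE R)) => _ [_ [x ->] <-].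
  rewrite setTI.
  have -> : fst @^-1` `]x, +oo[%classic =
      ~` (\bigcup_n (`]-oo, x] `*` `]-oo, n%:R])%classic) :> set U.
    apply/seteqP; split=> [[a b]/= |[a b]/= h].
      rewrite in_itv/= andbT => xa [n _ []/=]; rewrite in_itv/=.
      by rewrite leNgt xa.
    rewrite in_itv/= andbT ltNge; apply/negP => ax; apply: h.
    exists (Num.truncn `|b|).+1 => //; split => //=; rewrite in_itv/=//.
    by rewrite (le_trans (ler_norm b))// ltW// Num.Theory.truncnS_gt.
  by apply: measurableC; apply: bigcupT_measurable => n; exact: msub.
have msnd : measurable_fun setT (snd : U -> R).
  apply: (measurability _ (RGenOInfty.measurableE R)) => _ [_ [x ->] <-].
  rewrite setTI.
  have -> : snd @^-1` `]x, +oo[%classic =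
      ~` (\bigcup_n (`]-oo, n%:R] `*` `]-oo, x])%classic) :> set U.
    apply/seteqP; split=> [[a b]/= |[a b]/= h].
      rewrite in_itv/= andbT => xb [n _ []/=] _; rewrite in_itv/=.
      by rewrite leNgt xb.
    rewrite in_itv/= andbT ltNge; apply/negP => bx; apply: h.
    exists (Num.truncn `|a|).+1 => //; split => //=; rewrite in_itv/=//.
    by rewrite (le_trans (ler_norm a))// ltW// Num.Theory.truncnS_gt.
  by apply: measurableC; apply: bigcupT_measurable => n; exact: msub.
rewrite measurable_prod_measurableType; apply: smallest_sub.
  exact: smallest_sigma_algebra.
move=> _ [A mA [B mB <-]].
have -> : A `*` B = (fst @^-1` A) `&` (snd @^-1` B) by [].
have := measurableI _ _ (mfst measurableT _ mA) (msnd measurableT _ mB).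
by rewrite !setTI.
Qed.

(** Quadrants are stable under intersection and exhaust the plane. Finite measures are allowed
    because the independence of partial sums is proved with restrictions of [P] to an event. *)
Lemma measure_unique_quadrants (m1 m2 : {measure set (R * R) -> \bar R}) :
  (m1 setT < +oo)%E ->
  (forall x y, m1 (`]-oo, x] `*` `]-oo, y])%classic =
               m2 (`]-oo, x] `*` `]-oo, y])%classic) ->
  forall S, measurable S -> m1 S = m2 S.
Proof.
move=> m1T m12 S mS.
apply: (measure_unique quadrants (fun n => `]-oo, n%:R] `*` `]-oo, n%:R])%classic) => //.
- exact: measurable_quadrants.
- move=> _ _ [x [y ->]] [x' [y' ->]]; exists (Num.min x x'), (Num.min y y').
  apply/seteqP; split => [[a b]/=|[a b]/=]; rewrite !in_itv/= !le_min.
    by move=> [[-> ->] [-> ->]].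
  by move=> [/andP[-> ->] /andP[-> ->]].
- by move=> n; exists n%:R, n%:R.
- apply/seteqP; split => // -[a b] _.
  exists (Num.truncn (`|a| + `|b|)).+1 => //.
  have ab := Num.Theory.truncnS_gt (`|a| + `|b|).
  have := ler_norm a; have := ler_norm b.
  have := normr_ge0 a; have := normr_ge0 b => ? ? ? ?.
  by split; rewrite /= in_itv/=; lra.
- by move=> _ [x [y ->]]; exact: m12.
- move=> k; apply: le_lt_trans m1T; apply: le_measure; rewrite ?inE//.
  exact: measurableX.
Qed.

End uniqueness_in_the_plane.

(** * The reference law F^+ and its scale *)

Section reference_law.
Context {R : realType}.
Implicit Types F G : probability R R.

Lemma dtail_pos_part F x : 0 <= x -> dtail (pos_part F) x = dtail F x.
Proof.
move=> x0; rewrite /dtail dfun_pos_part indicE mem_set ?mulr1//=.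
by rewrite in_itv/= x0.
Qed.

Lemma scale_pos_part F z : 0 <= z -> scale (pos_part F) z = dincr F z 1.
Proof.
by move=> z0; rewrite /scale !dtail_pos_part ?dincrE//; lra.
Qed.

Lemma S2tilde_scale F : class_S2tilde F -> scale_function (scale (pos_part F)).
Proof.
move=> [_ [_ _ LF _] [F0 [[C C0 FC] _]]]; split.
- exact: LDelta_gt0.
- move=> M; near=> z.
  have h x : `|x| <= M -> `|scale (pos_part F) (z - x) - scale (pos_part F) z|
      <= 1 * scale (pos_part F) z.
    by move: x; near: z; exact: LDelta_shift.
  by move=> x /h; rewrite ler_norml => /andP[? ?]; lra.
- exists C => //; near=> z.
  have z0 : 0 <= z by near: z; apply: nbhs_pinfty_ge; exact: num_real.
  have Fz : 0 < dincr F z 1 by near: z.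
  have supz : `|sup [set dincr F y 1 | y in `[z, +oo[%classic]| <= C * `|dincr F z 1|.
    by near: z.
  move=> y zy; rewrite !scale_pos_part//; last by lra.
  rewrite -[X in _ <= C * X](gtr0_norm Fz) (le_trans _ supz)//.
  (* A real supremum bounds its set only if the set is bounded above; increments are at most 1. *)
  rewrite (le_trans _ (ler_norm _))//; apply: ub_le_sup.
    exists 1 => _ [u _ <-]; rewrite dincrE.
    by have := dtail_le1 F u; have := dtail_ge0 F (u + 1); lra.
  by exists y => //=; rewrite in_itv/= zy.
Unshelve. all: by end_near. Qed.

Lemma dtail_convolution F : dtail (convolution F F) = fun z =>
  Ex (F \x F)%E (fun u => \I[z < u.1 + u.2]).
Proof.
apply/funext => z; rewrite dtailE Ex_distribution//; first by meas.
by apply: intg_natb; rewrite /= /addR2; meas.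
Qed.

(** The expectation of the jump is the numerator of the S_2 ratio. Multiplying back needs a nonzero
    denominator; otherwise the ratio would be 0, which [h2] excludes. *)
Lemma S2_jump F : class_S2 F -> negl (scale F) (fun (_ : unit) z =>
  Ex (F \x F)%E (jump z) - 2 * mean F * scale F z).
Proof.
move=> [_ mF _ asF] e e0; pose B := 2 * `|mean F| + 1.
have B0 : 0 < B by rewrite /B; have := normr_ge0 (mean F); lra.
have eB : 0 < e / B by rewrite divr_gt0.
near=> z => _.
rewrite Ex_jump; set f := Ex _ _; set g := 2 * mean F * _.
have gE : g = 2 * mean F * dincr F z 1 by rewrite dincrE.
have fE : f - dtail F z - dtail F z = dtail (convolution F F) z - 2 * dtail F z.
  by rewrite dtail_convolution -/f; ring.
have h1 : `|1 - (dtail (convolution F F) z - 2 * dtail F z) /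
    (2 * mean F * dincr F z 1)| < e / B.
  by near: z; move/cvgrPdist_lt : asF; exact.
have h2 : `|1 - (dtail (convolution F F) z - 2 * dtail F z) /
    (2 * mean F * dincr F z 1)| < 1.
  by near: z; move/cvgrPdist_lt : asF; exact.
rewrite -fE -gE in h1 h2.
have g0 : g != 0.
  by apply/eqP => g0; move: h2; rewrite g0 invr0 mulr0 subr0 normr1 ltxx.
rewrite fE -fE; rewrite distrC.
have -> : g - (f - dtail F z - dtail F z) =
    (1 - (f - dtail F z - dtail F z) / g) * g by field.
have D0 : 0 <= scale F z.
  by rewrite subr_ge0; apply: dtail_nonincreasing; lra.
have gB : `|g| <= B * scale F z.
  rewrite /g !normrM (ger0_norm D0) ler_wpM2r// /B ger0_norm//.
  lra.
rewrite normrM (le_trans (ler_pM _ _ (ltW h1) gB))//.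
by rewrite mulrA divfK ?gt_eqF.
Unshelve. all: by end_near. Qed.

Lemma S2tilde_regular F : class_S2tilde F ->
  regular (scale (pos_part F)) (fun _ : unit => dtail F)
    (fun _ => scale (pos_part F)).
Proof.
move=> [_ [_ _ LF _] _]; apply: eq_regular (LDelta_regular LF).
- near=> z => _; apply: dtail_pos_part.
  by near: z; apply: nbhs_pinfty_ge; exact: num_real.
- exact: nearW.
Unshelve. all: by end_near. Qed.

Lemma same_order_scale F G :
  same_order (fun x => dincr F x 1) (fun x => dincr G x 1) ->
  exists2 C, 0 < C & \forall z \near +oo,
    scale (pos_part F) z <= C * scale (pos_part G) z.
Proof.
move=> [[C C0 FG] _]; exists C => //; near=> z.
have z0 : 0 <= z by near: z; apply: nbhs_pinfty_ge; exact: num_real.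
rewrite !scale_pos_part//.
have d0 H : 0 <= dincr H z 1.
  by rewrite dincrE subr_ge0; apply: dtail_nonincreasing; lra.
rewrite -(ger0_norm (d0 F)) -(ger0_norm (d0 G)); near: z; exact: FG.
Unshelve. all: by end_near. Qed.

Lemma intg_pos_part F : intg F id -> intg (pos_part F) id.
Proof.
move=> iF; apply: intg_distribution => //.
apply: intg_le (intg_norm iF) => // x.
by rewrite /= /posR; case: (leP x 0) => x0; rewrite ?normr0 ?normr_ge0//.
Qed.

End reference_law.

Section order_statistics.
Context {R : realType}.
Implicit Types F G : probability R R.

Definition extreme2 (b : bool) (u : R * R) : R :=
  if b then Num.min u.1 u.2 else Num.max u.1 u.2.

Lemma measurable_extreme2 b : measurable_fun setT (extreme2 b).
Proof.
by case: b; [apply: measurable_minr|apply: measurable_maxr]; meas.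
Qed.

(* Law of the minimum (b = true) or of the maximum of two independent copies. *)
Definition extreme F (b : bool) : probability R R :=
  distribution (F \x F)%E (mfun_of (measurable_extreme2 b)).

Lemma dtail_extreme F b x :
  dtail (extreme F b) x = if b then dtail F x ^+ 2
                          else 2 * dtail F x - dtail F x ^+ 2.
Proof.
have E : Ex (F \x F)%E (fun u => \I[(x < u.1) && (x < u.2)]) = dtail F x ^+ 2.
  rewrite (@Ex_indep_bool _ _ _ (fun y => x < y) (fun y => x < y)); try meas.
  by rewrite -dtailE expr2.
have E1 : Ex (F \x F)%E (fun u => \I[x < u.1]) = dtail F x.
  rewrite Ex_fubini_swap; [|by apply: intg_natb; meas|move=> y /=; exact: intg_cst].
  by rewrite dtailE; apply: eq_Ex => y /=; rewrite Ex_cst.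
have E2 : Ex (F \x F)%E (fun u => \I[x < u.2]) = dtail F x.
  rewrite Ex_fubini; [|by apply: intg_natb; meas|move=> y /=; exact: intg_cst].
  by rewrite dtailE; apply: eq_Ex => y /=; rewrite Ex_cst.
have mx c : measurable_fun setT (fun u : R * R => x < extreme2 c u).
  by apply: measurable_ltf; [exact: measurable_cst|exact: measurable_extreme2].
rewrite /extreme dtailE Ex_distribution/=; [|by meas|exact: intg_natb].
case: b.
  by rewrite -E; apply: eq_Ex => u /=; rewrite lt_min.
rewrite -E mulr2n mulrDl mul1r -{1}E1 -E2 -ExD; [|apply: intg_natb; meas..].
rewrite -ExB; [|by apply: intgD; apply: intg_natb; meas|by apply: intg_natb; meas].
apply: eq_Ex => u /=; rewrite lt_max.
by case: (x < u.1); case: (x < u.2) => /=; lra.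
Qed.

Lemma extreme_Iic F b x : extreme F b `]-oo, x]%classic =
  (1 - (if b then dtail F x ^+ 2 else 2 * dtail F x - dtail F x ^+ 2))%:E.
Proof.
rewrite -dtail_extreme /dtail /dfun subKr fineK// fin_num_measure//.
Qed.

Lemma intg_extreme F b : intg F id -> intg (extreme F b) id.
Proof.
move=> iF; have i2 : intg (F \x F)%E (fun u => `|u.1| + `|u.2|).
  apply: intgD.
    exact: (intg_fst F (intg_norm iF)).
  exact: (intg_snd F (intg_norm iF)).
apply: intg_distribution => //.
apply: intg_le i2 => /=; first exact: measurable_extreme2.
move=> u; rewrite /extreme2 /Order.min /Order.max.
by case: b; case: ifP => _; rewrite ?lerDl ?lerDr.
Qed.

End order_statistics.

Section FGM_mixture.
Context d (T : measurableType d) (R : realType).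
Variables (P : probability T R) (F G : probability R R) (r : R).
Variables X Y : {mfun T >-> R}.
Hypothesis hr : -1 <= r <= 1.
Hypothesis hFGM : forall x y, prob P [set w | X w <= x /\ Y w <= y] = FGM r F G x y.

(** k < 4 encodes two bits: [odd k] chooses minimum or maximum for the first coordinate, [odd k./2]
    for the second. *)
Definition FGM_weight (k : nat) : R :=
  (if odd k == odd k./2 then 1 + r else 1 - r) / 4.

Lemma FGM_weight_ge0 k : 0 <= FGM_weight k.
Proof.
by rewrite /FGM_weight; move: hr => /andP[? ?]; case: ifP => _; lra.
Qed.

Definition FGM_factor (k : nat) : probability (R * R)%type R :=
  (extreme F (odd k) \x extreme G (odd k./2))%E.

Lemma measurable_pairXY : measurable_fun setT (fun w => (X w, Y w)).
Proof. exact: measurable_fun_pair. Qed.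

(* With m, M the distribution functions of the minimum and the maximum of two
   independent copies, F = (m + M) / 2 and F (1 - F) = (m - M) / 2, so the FGM
   law is a convex combination of the four products of such laws. *)
Lemma FGM_law S : measurable S ->
  distribution P (mfun_of measurable_pairXY) S =
  (\sum_(k < 4) (NngNum (FGM_weight_ge0 k))%:num%:E * FGM_factor k S)%E.
Proof.
pose mix := msum (fun k => mscale (NngNum (FGM_weight_ge0 k)) (FGM_factor k)) 4.
apply: (@measure_unique_quadrants _ _ mix).
  by rewrite (le_lt_trans (probability_le1 _ _)) ?ltry.
move=> x y.
transitivity (FGM r F G x y)%:E.
  rewrite -hFGM /prob fineK.
    by congr (P _); apply/seteqP; split => w /=; rewrite !in_itv/=.
  rewrite fin_num_measure//.
  have := measurable_pairXY measurableT
    (measurableX (measurable_itv `]-oo, x]) (measurable_itv `]-oo, y])).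
  by rewrite setTI (_ : _ @^-1` _ = [set w | X w <= x /\ Y w <= y]).
pose t b := if b then dtail F x ^+ 2 else 2 * dtail F x - dtail F x ^+ 2.
pose u b := if b then dtail G y ^+ 2 else 2 * dtail G y - dtail G y ^+ 2.
have factorE k : FGM_factor k (`]-oo, x] `*` `]-oo, y])%classic =
    ((1 - t (odd k)) * (1 - u (odd k./2)))%:E.
  rewrite EFinM -!extreme_Iic; exact: product_measure1E.
transitivity (\sum_(k < 4) (FGM_weight k)%:E *
  FGM_factor k (`]-oo, x] `*` `]-oo, y])%classic)%E; last by [].
under eq_bigr do rewrite factorE -EFinM.
rewrite sumEFin !big_ord_recl big_ord0; congr EFin.
by rewrite /FGM /FGM_weight /dtail /t /u /dtail/=; field.
Qed.

End FGM_mixture.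

(** * Dilated laws, their windows, and regularity of extremes *)

Section dilation.
Context {R : realType}.
Implicit Types H : probability R R.

Lemma measurable_scaling (c : R) : measurable_fun setT (fun x : R => c * x).
Proof. by meas. Qed.

Definition dilate H (c : R) : probability R R :=
  distribution H (mfun_of (measurable_scaling c)).

Lemma dtail_dilate H c z : 0 < c -> dtail (dilate H c) z = dtail H (z / c).
Proof.
move=> c0; rewrite dtailE Ex_distribution/=; [|by meas|by apply: intg_natb; meas].
by rewrite dtailE; apply: eq_Ex => x /=; rewrite ltr_pdivrMr// mulrC.
Qed.

Lemma mean_dilate H c : intg H id -> mean (dilate H c) = c * mean H.
Proof.
move=> iH; rewrite !meanE Ex_distribution/=.
- by rewrite -ExZ.
- exact: measurable_id.
- exact: intgZ.
Qed.

Lemma unif_int_dilate (I : Type) H (c : I -> R) :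
  intg H id -> (forall p, `|c p| <= 1) -> unif_int (fun p => dilate H (c p)).
Proof.
move=> iH c1; apply: (unif_int_distribution (intg_norm iH)) => // p x /=.
by rewrite normrM ler_piMl.
Qed.

Lemma Ex_dilate_prod (A B : probability R R) c e K (f : R * R -> R) :
  measurable_fun setT f -> (forall u, `|f u| <= K) ->
  Ex (dilate A c \x dilate B e)%E f =
  Ex (A \x B)%E (fun u => f (c * u.1, e * u.2)).
Proof.
move=> mf fK.
have mce : measurable_fun setT (fun u : R * R => (c * u.1, e * u.2)).
  by apply: measurable_fun_pair; meas.
have mx y : measurable_fun setT (fun x : R => f (x, y)).
  exact: (measurableT_comp mf (pair2_measurable y)).
have i1 : intg (dilate A c \x dilate B e)%E f by exact: intg_bounded mf fK.
have i1y y : intg (dilate A c) (fun x => f (x, y)).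
  by apply: intg_bounded (mx y) _ => x; exact: fK.
have mxc y : measurable_fun setT (fun x : R => f (c * x, y)).
  exact: (measurableT_comp (mx y) (measurable_scaling c)).
have iy y : intg A (fun x => f (c * x, y)).
  by apply: intg_bounded (mxc y) _ => x; exact: fK.
have h1 := intg_fubini i1 i1y.
rewrite Ex_fubini// Ex_distribution//=; last 2 first.
- exact: intg_measurable h1.
- exact: intg_distributionP h1.
have ice : intg (A \x B)%E (fun u => f (c * u.1, e * u.2)).
  by apply: intg_bounded (measurableT_comp mf mce) _ => u; exact: fK.
rewrite (Ex_fubini ice) => [|y]; last exact: (iy (e * y)).
by apply: eq_Ex => y /=; rewrite Ex_distribution//; exact: iy.
Qed.

(** An increment over length 1 / s brought back to unit length, so that it agrees up to o(D) with
    the window of a regular [T]. *)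
Definition window (s : R) (T : R -> R) (z : R) : R := s * (T z - T (z + s^-1)).

End dilation.

Section dilated_families.
Context {R : realType} (Phi : probability R R).
Local Notation D := (scale Phi).
Hypothesis scaleP : scale_function D.

(** The window is re-expressed through the tail itself, so that the final formulas contain
    probabilities instead of the auxiliary [k]. *)
Lemma regular_dilate_window (I : Type) H k (a : R) (c s : I -> R) :
  0 < a -> (forall p, a <= c p <= 1) ->
  (forall p, 0 < s p) -> bounded s -> bounded (fun p => (s p)^-1) ->
  regular D (fun _ : unit => dtail H) (fun _ => k) ->
  regular D (fun p => dtail (dilate H (c p)))
            (fun p => window (s p) (dtail (dilate H (c p)))).
Proof.
move=> a0 hc s0 bs bsV rH.
have c0 p : 0 < c p by have /andP[/(lt_le_trans a0)] := hc p.
have := regular_dilation scaleP a0 hc rH.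
move=> /(eq_regular (T' := fun p => dtail (dilate H (c p)))
  (h' := fun p z => k (z / c p) / c p)) r.
have {}r : regular D (fun p => dtail (dilate H (c p))) (fun p z => k (z / c p) / c p).
  by apply: r; apply: nearW => z p //; rewrite dtail_dilate.
exact: regular_negl_window r (negl_rescaled_window s0 bs bsV r).
Qed.

(** The square is the probability that two independent copies both exceed z. For z >= A the smaller
    copy then lies in (z, z + |larger|], one of the two far events that [small_far] makes
    negligible. *)
Lemma dtail_prod_negl (H : probability R R) k : intg H id ->
  regular D (fun _ : unit => dtail H) (fun _ => k) ->
  negl D (fun (_ : unit) z => dtail H z ^+ 2).
Proof.
move=> iH rH e e0; have e20 : 0 < e / 2 by lra.
have uH : unif_int (fun _ : unit => H).
  split=> // e' e'0.
  have [B HB] := integrable_tail_small (intg_norm iH) (fun w => normr_ge0 _) e'0.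
  by exists B => _; exact: HB.
have [A A1 HA] := small_far scaleP uH rH e20.
have {}HA := HA A (lexx _); near=> z => _.
have Az : A <= z by near: z; apply: nbhs_pinfty_ge; exact: num_real.
have far : Ex H (fun x => \I[A < `|x|] * (dtail H z - dtail H (z + `|x|))) <= e / 2 * D z.
  by move: tt; near: z; exact: HA.
rewrite ger0_norm ?sqr_ge0//.
have <- : Ex (H \x H)%E (fun u => \I[(z < u.1) && (z < u.2)]) = dtail H z ^+ 2.
  rewrite (@Ex_indep_bool _ _ _ (fun y => z < y) (fun y => z < y)); try meas.
  by rewrite -dtailE expr2.
have -> : e * D z = e / 2 * D z + e / 2 * D z by field.
apply: le_trans (lerD far far); rewrite -{1}Ex_far -{1}Ex_far_swap -ExD; last 2 first.
- apply: (@intg_bounded _ _ _ _ _ 1) => [|u]; first by meas.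
  by rewrite -natrM mulnb normr_nat lern1 leq_b1.
- apply: (@intg_bounded _ _ _ _ _ 1) => [|u]; first by meas.
  by rewrite -natrM mulnb normr_nat lern1 leq_b1.
apply: Ex_le.
- by apply: intg_natb; meas.
- apply: (@intg_bounded _ _ _ _ _ 2) => [|u]; first by meas.
  by rewrite -!natrM !mulnb -natrD normr_nat ler_nat; do 2 case: (_ && _).
- move=> [x y] /=; rewrite -!natrM !mulnb -natrD ler_nat.
  case: (ltP z x) => //= zx; case: (ltP z y) => //= zy.
  have x0 := ler_norm x; have y0 := ler_norm y.
  have -> : A < `|x| by apply: le_lt_trans Az (lt_le_trans zx x0).
  have -> : A < `|y| by apply: le_lt_trans Az (lt_le_trans zy y0).
  have h1 : 0 <= z by lra.
  case: (leP x y) => xy.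
    by rewrite (_ : x <= z + `|y|)//; lra.
  by rewrite (_ : y <= z + `|x|) ?addn1//; lra.
Unshelve. all: by end_near. Qed.

(** Up to the negligible square, the minimum has tail 0 and the maximum twice the tail of [H]. *)
Lemma regular_extreme (H : probability R R) k b : intg H id ->
  regular D (fun _ : unit => dtail H) (fun _ => k) ->
  regular D (fun _ : unit => dtail (extreme H b))
            (fun _ z => if b then 0 else 2 * k z).
Proof.
move=> iH rH; have nH := dtail_prod_negl iH rH.
have r0 := negl_regular scaleP nH.
case: b.
  by apply: eq_regular r0; apply: nearW => z p //; rewrite dtail_extreme.
have b2 : bounded (fun _ : unit => 2 : R) by exists 2 => // _; rewrite normr_nat.
apply: eq_regular (regularD (regularM b2 rH) (negl_regular scaleP (neglN nH))).
- by apply: nearW => z p; rewrite dtail_extreme.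
- by apply: nearW => z p; rewrite addr0.
Qed.

End dilated_families.

Section FGM_expectation.
Context d (T : measurableType d) (R : realType).
Variables (P : probability T R) (F G : probability R R) (r : R).
Variables X Y : {mfun T >-> R}.
Hypothesis hr : -1 <= r <= 1.
Hypothesis hFGM : forall x y, prob P [set w | X w <= x /\ Y w <= y] = FGM r F G x y.
Hypotheses (iF : intg F id) (iG : intg G id).

Local Notation wt := (FGM_weight r).
Local Notation factor := (FGM_factor F G).

Lemma intg_FGM (f : R * R -> R) : (forall k, intg (factor k) f) ->
  intg P (fun w => f (X w, Y w)).
Proof.
move=> intf.
have := @intg_mixture _ _ _ _ 4 _ (fun k => NngNum (FGM_weight_ge0 hr k))
  (FGM_law hr hFGM) f isT (fun k _ => intf k).
by move=> /intg_distributionP.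
Qed.

Lemma Ex_FGM (f : R * R -> R) : (forall k, intg (factor k) f) ->
  Ex P (fun w => f (X w, Y w)) = \sum_(k < 4) wt k * Ex (factor k) f.
Proof.
move=> intf.
have := @Ex_mixture _ _ _ _ 4 _ (fun k => NngNum (FGM_weight_ge0 hr k))
  (FGM_law hr hFGM) f isT (fun k _ => intf k).
rewrite Ex_distribution//; last exact: intg_FGM.
exact: intg_measurable (intf 0%N).
Qed.

Lemma intg_factor1 k : intg (factor k) fst.
Proof. exact: (intg_fst _ (intg_extreme (odd k) iF)). Qed.

Lemma intg_factor2 k : intg (factor k) snd.
Proof. exact: (intg_snd _ (intg_extreme (odd k./2) iG)). Qed.

Lemma intg_X : intg P X.
Proof. exact: intg_FGM intg_factor1. Qed.

Lemma intg_Y : intg P Y.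
Proof. exact: intg_FGM intg_factor2. Qed.

Lemma Ex_fst (A B : probability R R) f : intg A f ->
  Ex (A \x B)%E (fun u => f u.1) = Ex A f.
Proof.
move=> iA; rewrite Ex_fubini_swap/=; [|exact: intg_fst|by move=> x; exact: intg_cst].
by apply: eq_Ex => x; rewrite Ex_cst.
Qed.

Lemma Ex_snd (A B : probability R R) f : intg B f ->
  Ex (A \x B)%E (fun u => f u.2) = Ex B f.
Proof.
move=> iB; rewrite Ex_fubini/=; [|exact: intg_snd|by move=> x; exact: intg_cst].
by apply: eq_Ex => x; rewrite Ex_cst.
Qed.

(** Minimum and maximum of two copies add up to the sum of the copies. *)
Lemma mean_extreme (H : probability R R) : intg H id ->
  mean (extreme H true) + mean (extreme H false) = 2 * mean H.
Proof.
move=> iH; have ie b := intg_distributionP (intg_extreme b iH).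
have Eb b : mean (extreme H b) = Ex (H \x H)%E (extreme2 b).
  by rewrite meanE Ex_distribution//; exact: ie.
rewrite !Eb meanE -ExD; [|exact: (ie true)|exact: (ie false)].
have -> : 2 * Ex H id = Ex (H \x H)%E fst + Ex (H \x H)%E snd.
  rewrite (@Ex_fst H H id iH) (@Ex_snd H H id iH); ring.
rewrite -ExD; [|exact: (intg_fst H iH)|exact: (intg_snd H iH)].
apply: eq_Ex => u /=; rewrite /extreme2 /=.
by rewrite addr_min_max.
Qed.

(** The marginal is recovered from the mixture, where each value of a bit has total weight 1 / 2 and
    minimum and maximum average to F; this avoids a limit y -> oo in [hFGM]. *)
Lemma dtail_X z : Ex P (fun w => \I[z < X w]) = dtail F z.
Proof.
rewrite (@Ex_FGM (fun u => \I[z < u.1])); last by move=> k; apply: intg_natb; meas.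
have E k : Ex (factor k) (fun u => \I[z < u.1]) = dtail (extreme F (odd k)) z.
  rewrite dtailE (@Ex_fst _ _ (fun x => \I[z < x]))//.
  by apply: intg_natb; meas.
under eq_bigr do rewrite E dtail_extreme.
by rewrite !big_ord_recl big_ord0 /FGM_weight/=; field.
Qed.

Lemma dtail_Y z : Ex P (fun w => \I[z < Y w]) = dtail G z.
Proof.
rewrite (@Ex_FGM (fun u => \I[z < u.2])); last by move=> k; apply: intg_natb; meas.
have E k : Ex (factor k) (fun u => \I[z < u.2]) = dtail (extreme G (odd k./2)) z.
  rewrite dtailE (@Ex_snd _ _ (fun x => \I[z < x]))//.
  by apply: intg_natb; meas.
under eq_bigr do rewrite E dtail_extreme.
by rewrite !big_ord_recl big_ord0 /FGM_weight/=; field.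
Qed.

Lemma mean_X : Ex P X = mean F.
Proof.
rewrite (Ex_FGM intg_factor1).
have E k : Ex (factor k) fst = mean (extreme F (odd k)).
  exact: (@Ex_fst _ _ id (intg_extreme (odd k) iF)).
under eq_bigr do rewrite E.
rewrite !big_ord_recl big_ord0 /FGM_weight/=.
move: (mean_extreme iF); move: (mean _) (mean _) (mean _) => u v w.
lra.
Qed.

Lemma mean_Y : Ex P Y = mean G.
Proof.
rewrite (Ex_FGM intg_factor2).
have E k : Ex (factor k) snd = mean (extreme G (odd k./2)).
  exact: (@Ex_snd _ _ id (intg_extreme (odd k./2) iG)).
under eq_bigr do rewrite E.
rewrite !big_ord_recl big_ord0 /FGM_weight/=.
move: (mean_extreme iG); move: (mean _) (mean _) (mean _) => u v w.
lra.
Qed.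

End FGM_expectation.

(** * One weighted FGM pair *)

Section pair_expansion.
Context {R : realType} (Phi : probability R R).
Local Notation D := (scale Phi).
Hypothesis scaleP : scale_function D.
Hypothesis intgPhi : intg Phi id.
Hypothesis regularPhi : regular D (fun _ : unit => dtail Phi) (fun _ => D).
Hypothesis jumpPhi : negl D (fun (_ : unit) z =>
  Ex (Phi \x Phi)%E (jump z) - 2 * mean Phi * D z).
Context d (T : measurableType d).
Variables (P : probability T R) (F G : probability R R) (r : R).
Variables X Y : {mfun T >-> R}.
Hypothesis hr : -1 <= r <= 1.
Hypothesis hFGM : forall x y, prob P [set w | X w <= x /\ Y w <= y] = FGM r F G x y.
Hypotheses (iF : intg F id) (iG : intg G id).
Variables kF kG : R -> R.
Hypothesis rF : regular D (fun _ : unit => dtail F) (fun _ => kF).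
Hypothesis rG : regular D (fun _ : unit => dtail G) (fun _ => kG).
Variables (I : Type) (a : R) (c e s : I -> R).
Hypothesis a0 : 0 < a.
Hypothesis hc : forall p, a <= c p <= 1.
Hypothesis he : forall p, a <= e p <= 1.
Hypothesis s0 : forall p, 0 < s p.
Hypotheses (bs : bounded s) (bsV : bounded (fun p => (s p)^-1)).

Local Notation wt := (FGM_weight r).
Local Notation factor := (FGM_factor F G).
Local Notation exF := (fun k : nat => extreme F (odd k)).
Local Notation exG := (fun k : nat => extreme G (odd k./2)).

Let mX : measurable_fun setT X. Proof. by []. Qed.
Let mY : measurable_fun setT Y. Proof. by []. Qed.
Let c0 p : 0 < c p. Proof. by have /andP[/(lt_le_trans a0)] := hc p. Qed.
Let e0 p : 0 < e p. Proof. by have /andP[/(lt_le_trans a0)] := he p. Qed.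

Let hc1 p : `|c p| <= 1. Proof. by rewrite gtr0_norm//; have /andP[] := hc p. Qed.
Let he1 p : `|e p| <= 1. Proof. by rewrite gtr0_norm//; have /andP[] := he p. Qed.

Let regF k := regular_dilate_window scaleP a0 hc s0 bs bsV
  (regular_extreme scaleP (odd k) iF rF).
Let regG k := regular_dilate_window scaleP a0 he s0 bs bsV
  (regular_extreme scaleP (odd k./2) iG rG).

Let jump_factor (k : nat) := jump_expansion scaleP intgPhi regularPhi jumpPhi
  (unif_int_dilate (intg_extreme (odd k) iF) hc1)
  (unif_int_dilate (intg_extreme (odd k./2) iG) he1) (regF k) (regG k).

(** The first-order interaction of the pair. Under a product law its expectation is a sum of
    products of a mean and a window; under the FGM law it does not factor. The factor [s p]
    compensates the interval length 1 / s. *)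
Definition cross (p : I) (z : R) (u : R * R) : R :=
  s p * (c p * u.1 * \I[z < e p * u.2 <= z + (s p)^-1])
  + s p * (e p * u.2 * \I[z < c p * u.1 <= z + (s p)^-1]).

Let zs p z : z <= z + (s p)^-1.
Proof. by rewrite lerDl invr_ge0 ltW. Qed.

Let Ex_window (H : probability R R) (b : R) p z : 0 < b ->
  Ex H (fun x => \I[z < b * x <= z + (s p)^-1]) =
  dtail (dilate H b) z - dtail (dilate H b) (z + (s p)^-1).
Proof.
move=> b0; rewrite -Ex_itv// Ex_distribution//=; first by meas.
by apply: intg_natb; meas.
Qed.

Let intg_cross1 k p z :
  intg (factor k) (fun u => c p * u.1 * \I[z < e p * u.2 <= z + (s p)^-1]).
Proof.
apply: (@intgMb _ _ _ _ (fun u : R * R => z < e p * u.2 <= z + (s p)^-1)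
  (fun u => c p * u.1)); first by meas.
by apply: intgZ; exact: intg_factor1.
Qed.

Let intg_cross2 k p z :
  intg (factor k) (fun u => e p * u.2 * \I[z < c p * u.1 <= z + (s p)^-1]).
Proof.
apply: (@intgMb _ _ _ _ (fun u : R * R => z < c p * u.1 <= z + (s p)^-1)
  (fun u => e p * u.2)); first by meas.
by apply: intgZ; exact: intg_factor2.
Qed.

Let intg_cross k p z : intg (factor k) (cross p z).
Proof. by apply: intgD; apply: intgZ; [exact: intg_cross1|exact: intg_cross2]. Qed.

Let Ex_cross k p z : Ex (factor k) (cross p z) =
  mean (dilate (exF k) (c p)) * window (s p) (dtail (dilate (exG k) (e p))) z
  + mean (dilate (exG k) (e p)) * window (s p) (dtail (dilate (exF k) (c p))) z.
Proof.
have iFk := intg_extreme (odd k) iF; have iGk := intg_extreme (odd k./2) iG.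
rewrite /cross ExD; [|by apply: intgZ; exact: intg_cross1|
  by apply: intgZ; exact: intg_cross2].
rewrite !ExZ; [|exact: intg_cross2|exact: intg_cross1].
rewrite !mean_dilate// !meanE; congr (_ + _).
- rewrite (Ex_fubini (intg_cross1 k p z)) => [|y]; last first.
    rewrite /=; apply: (@intgMb _ _ _ _ (fun _ => z < e p * y <= z + (s p)^-1)
      (fun x => c p * x)); first by meas.
    exact: intgZ.
  have -> : Ex (exG k) (fun y => Ex (exF k) (fun x => c p * (x, y).1 *
      \I[z < e p * (x, y).2 <= z + (s p)^-1])) =
    Ex (exG k) (fun y => c p * Ex (exF k) id * \I[z < e p * y <= z + (s p)^-1]).
    apply: eq_Ex => y /=; case: (_ && _).
      rewrite mulr1 -ExZ//; apply: eq_Ex => x; by rewrite mulr1.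
    by rewrite mulr0 -[RHS](Ex_cst (exF k)); apply: eq_Ex => x; rewrite mulr0.
  rewrite ExZ ?Ex_window//; first by rewrite /window; ring.
  by apply: intg_natb; meas.
- rewrite (Ex_fubini_swap (intg_cross2 k p z)) => [|x]; last first.
    rewrite /=; apply: (@intgMb _ _ _ _ (fun _ => z < c p * x <= z + (s p)^-1)
      (fun y => e p * y)); first by meas.
    exact: intgZ.
  have -> : Ex (exF k) (fun x => Ex (exG k) (fun y => e p * (x, y).2 *
      \I[z < c p * (x, y).1 <= z + (s p)^-1])) =
    Ex (exF k) (fun x => e p * Ex (exG k) id * \I[z < c p * x <= z + (s p)^-1]).
    apply: eq_Ex => x /=; case: (_ && _).
      rewrite mulr1 -ExZ//; apply: eq_Ex => y; by rewrite mulr1.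
    by rewrite mulr0 -[RHS](Ex_cst (exG k)); apply: eq_Ex => y; rewrite mulr0.
  rewrite ExZ ?Ex_window//; first by rewrite /window; ring.
  by apply: intg_natb; meas.
Qed.

Let intg_jump_factor k p z : intg (factor k) (fun u => jump z (c p * u.1, e p * u.2)).
Proof.
apply: (@intg_jump _ _ _ _ z (fun u => (c p * u.1, e p * u.2))).
by apply: measurable_fun_pair; meas.
Qed.

(** Both expectations are linear in the law of (X, Y), so the estimate for the four product laws is
    enough. *)
Lemma pair_jump_negl : negl D (fun p z =>
  Ex P (fun w => jump z (c p * X w, e p * Y w)) -
  Ex P (fun w => cross p z (X w, Y w))).
Proof.
have bw (k : nat) : bounded (fun _ : I => wt k).
  exists (`|wt k| + 1) => [|_]; last by rewrite lerDl.
  by have := normr_ge0 (wt k); lra.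
have N := @negl_sum _ D I nat (index_iota 0 4) xpredT
  (fun k p z => wt k * _) scaleP (fun k _ => neglM (bw k) (jump_factor k)).
apply: eq_negl N; apply: nearW => z p.
rewrite (Ex_FGM hr hFGM (fun k => intg_jump_factor k p z)).
rewrite (Ex_FGM hr hFGM (fun k => intg_cross k p z)).
rewrite big_mkord -sumrB; apply: eq_bigr => k _; rewrite -mulrBr; congr (_ * _).
rewrite Ex_cross (@Ex_dilate_prod _ _ _ _ _ 3); first by ring.
- exact: measurable_jump.
- move=> u; rewrite /jump; case: (_ < _); case: (_ < _); case: (_ < _);
    rewrite ler_norml /=; apply/andP; split; lra.
Qed.

Definition pair_window (p : I) (z : R) : R :=
  window (s p) (dtail (dilate F (c p))) z + window (s p) (dtail (dilate G (e p))) z.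

Lemma Ex_cX p z : Ex P (fun w => \I[z < c p * X w]) = dtail (dilate F (c p)) z.
Proof.
rewrite dtail_dilate// -(dtail_X hr hFGM); apply: eq_Ex => w.
by rewrite ltr_pdivrMr// mulrC.
Qed.

Lemma Ex_eY p z : Ex P (fun w => \I[z < e p * Y w]) = dtail (dilate G (e p)) z.
Proof.
rewrite dtail_dilate// -(dtail_Y hr hFGM); apply: eq_Ex => w.
by rewrite ltr_pdivrMr// mulrC.
Qed.

Lemma Ex_pair_jump p z : Ex P (fun w => jump z (c p * X w, e p * Y w)) =
  Ex P (fun w => \I[z < c p * X w + e p * Y w])
  - dtail (dilate F (c p)) z - dtail (dilate G (e p)) z.
Proof.
rewrite -Ex_cX -Ex_eY -ExB; [|apply: intg_natb; meas..].
rewrite -ExB//; last by apply: intg_natb; meas.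
by apply: intgB; apply: intg_natb; meas.
Qed.

(** The tail of c X + e Y is the sum of two regular tails, the cross term and a negligible term. The
    cross term has window zero because its windows are themselves regular with window zero. *)
Lemma pair_regular :
  regular D (fun p z => Ex P (fun w => \I[z < c p * X w + e p * Y w])) pair_window.
Proof.
have rFp := regular_dilate_window scaleP a0 hc s0 bs bsV rF.
have rGp := regular_dilate_window scaleP a0 he s0 bs bsV rG.
have rC : regular D (fun p z => Ex P (fun w => cross p z (X w, Y w))) (fun _ _ => 0).
  have bw (k : nat) : bounded (fun _ : I => wt k).
    exists (`|wt k| + 1) => [|_]; last by rewrite lerDl.
    by have := normr_ge0 (wt k); lra.
  have rk (k : nat) : regular D (fun p z => wt k * Ex (factor k) (cross p z)) (fun _ _ => 0).
    have bF := unif_int_mean (unif_int_dilate (intg_extreme (odd k) iF) hc1).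
    have bG := unif_int_mean (unif_int_dilate (intg_extreme (odd k./2) iG) he1).
    have r1 := regularM bF (regular_window scaleP (regG k)).
    have r2 := regularM bG (regular_window scaleP (regF k)).
    apply: eq_regular (regularM (bw k) (regularD r1 r2)).
      by apply: nearW => z p; rewrite Ex_cross.
    by apply: nearW => z p; rewrite !mulr0 addr0 mulr0.
  have rS := @regular_sum _ D I nat (index_iota 0 4) _ _ scaleP (fun k _ => rk k).
  apply: eq_regular rS; apply: nearW => z p; last by rewrite big1.
  by rewrite (Ex_FGM hr hFGM (fun k => intg_cross k p z)) big_mkord.
have rAll := regularD (regularD rFp rGp) (regularD rC (negl_regular scaleP pair_jump_negl)).
apply: eq_regular rAll.
  by apply: nearW => z p; rewrite Ex_pair_jump; ring.
by apply: nearW => z p; rewrite /pair_window !addr0.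
Qed.

End pair_expansion.

(** * Sums of independent terms *)

Section partial_sums_independence.
Context d (T : measurableType d) (R : realType) (P : probability T R).
Variable zeta : nat -> {mfun T >-> R}.
Hypothesis indep : mutually_independent P (fun i w => zeta i w).

Definition partial_sum (k : nat) (w : T) : R := \sum_(1 <= i < k.+1) zeta i w.

Lemma measurable_partial_sum k : measurable_fun setT (partial_sum k).
Proof. exact: measurable_sum. Qed.

Lemma partial_sum0 w : partial_sum 0 w = 0.
Proof. by rewrite /partial_sum big_geq. Qed.

Lemma partial_sumS k w : partial_sum k.+1 w = partial_sum k w + zeta k.+1 w.
Proof. by rewrite /partial_sum big_nat_recr. Qed.

Let event (s : seq nat) (B : nat -> set R) : set T :=
  \big[setI/setT]_(i <- s) (zeta i @^-1` B i).

Let measurable_event s B : (forall i, measurable (B i)) -> measurable (event s B).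
Proof.
move=> mB; rewrite /event; elim: s => [|i s IH]; first by rewrite big_nil.
rewrite big_cons; apply: measurableI => //.
by rewrite -[X in measurable X]setTI; exact: measurable_funPT.
Qed.

Let pair_sum k w := (partial_sum k w, zeta k.+1 w).

Let measurable_pair_sum k : measurable_fun setT (pair_sum k).
Proof. by apply: measurable_fun_pair => //; exact: measurable_partial_sum. Qed.

Let indep_block k : forall (s : seq nat) (B : nat -> set R) A,
  uniq s -> (forall i, i \in s -> (k < i)%N) -> measurable A ->
  (forall i, measurable (B i)) ->
  P (partial_sum k @^-1` A `&` event s B) =
  (P (partial_sum k @^-1` A) * P (event s B))%E.
Proof.
elim: k => [|k IH] s B A us sk mA mB.
  (* The empty sum is 0, so the preimage of A is everything or empty. *)
  have [A0|A0] := pselect (A 0).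
    rewrite (_ : partial_sum 0 @^-1` A = setT).
      by rewrite setTI probability_setT mul1e.
    by apply/seteqP; split => // w _ /=; rewrite partial_sum0.
  rewrite (_ : partial_sum 0 @^-1` A = set0).
    by rewrite set0I measure0 mul0e.
  by apply/seteqP; split => // w /=; rewrite partial_sum0.
have mE := measurable_event s mB.
have kNs : k.+1 \notin s by apply/negP => /sk; rewrite ltnn.
have fE : P (event s B) \is a fin_num by exact: fin_num_measure.
have q0 : 0 <= fine (P (event s B)) by exact: fine_ge0.
pose m1_of : {measure set (R * R) -> \bar R} :=
  pushforward (mrestr P mE) (mfun_of (measurable_pair_sum k)).
pose m1 := m1_of (measurable_pair_sum k).
pose m2 : {measure set (R * R) -> \bar R} :=
  mscale (NngNum q0) (distribution P (mfun_of (measurable_pair_sum k))).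
have m12 : forall S, measurable S -> m1 S = m2 S.
  apply: measure_unique_quadrants.
    apply: (@le_lt_trans _ _ 1%E); last exact: ltry.
    exact: (probability_le1 P (measurableI _ _ measurableT mE)).
  move=> x y.
  pose B' i : set R := if i == k.+1 then `]-oo, y]%classic else B i.
  have mB' i : measurable (B' i) by rewrite /B'; case: ifP.
  have e1 : event (k.+1 :: s) B' = zeta k.+1 @^-1` `]-oo, y] `&` event s B.
    rewrite /event big_cons /B' eqxx; congr (_ `&` _).
    rewrite big_seq_cond [RHS]big_seq_cond; apply: eq_bigr => i; rewrite andbT => si.
    by case: eqP => // ik; move: kNs; rewrite -ik si.
  have e2 : event [:: k.+1] B' = zeta k.+1 @^-1` `]-oo, y].
    by rewrite /event big_cons big_nil setIT /B' eqxx.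
  have s1 i : i \in k.+1 :: s -> (k < i)%N.
    by rewrite inE => /orP[/eqP ->//|/sk/ltnW].
  have s2 i : i \in [:: k.+1] -> (k < i)%N by rewrite inE => /eqP ->.
  have u1 : uniq (k.+1 :: s) by rewrite /= kNs.
  have mx : measurable (`]-oo, x]%classic : set R) by [].
  have h1 := IH (k.+1 :: s) B' _ u1 s1 mx mB'.
  have h2 := IH [:: k.+1] B' _ isT s2 mx mB'.
  have h3 : P (zeta k.+1 @^-1` `]-oo, y] `&` event s B) =
      (P (zeta k.+1 @^-1` `]-oo, y]) * P (event s B))%E.
    rewrite -e1 -e2 /event indep// indep// big_cons big_seq1; congr (_ * _)%E.
    rewrite indep// big_seq_cond [RHS]big_seq_cond; apply: eq_bigr => i.
    rewrite andbT => si; rewrite /B'.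
    by case: eqP => // ik; move: kNs; rewrite -ik si.
  rewrite e1 in h1; rewrite e2 in h2.
  transitivity (P (partial_sum k @^-1` `]-oo, x] `&`
     (zeta k.+1 @^-1` `]-oo, y] `&` event s B))).
    by rewrite setIA.
  rewrite h1 h3 muleA -h2 muleC.
  by rewrite -[X in (X * _)%E](fineK fE).
have mAA : measurable [set u : R * R | A (u.1 + u.2)].
  rewrite -[X in measurable X]setTI.
  exact: (measurable_addf measurable_fst measurable_snd measurableT).
have := m12 _ mAA.
have -> : m1 [set u | A (u.1 + u.2)] = P (partial_sum k.+1 @^-1` A `&` event s B).
  congr (P (_ `&` _)); apply/seteqP.
  by split => w /=; rewrite /pair_sum /= partial_sumS.
move=> ->.
have -> : m2 [set u | A (u.1 + u.2)] =
    (P (event s B) * P (partial_sum k.+1 @^-1` A))%E.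
  rewrite -[in RHS](fineK fE); congr (_ * P _)%E; apply/seteqP.
  by split => w /=; rewrite /pair_sum /= partial_sumS.
by rewrite muleC.
Qed.

Definition sum_law k : probability R R :=
  distribution P (mfun_of (measurable_partial_sum k)).

Lemma Ex_pair_sum k K (f : R * R -> R) : measurable_fun setT f ->
  (forall u, `|f u| <= K) ->
  Ex P (fun w => f (partial_sum k w, zeta k.+1 w)) =
  Ex (sum_law k \x distribution P (zeta k.+1))%E f.
Proof.
move=> mf fK; rewrite -(Ex_distribution (X := mfun_of (measurable_pair_sum k)))//.
  rewrite /Ex /Rintegral; congr fine; apply: eq_measure_integral => S mS _.
  pose m1 : {measure set (R * R) -> \bar R} :=
    distribution P (mfun_of (measurable_pair_sum k)).
  pose m2 : {measure set (R * R) -> \bar R} :=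
    (sum_law k \x distribution P (zeta k.+1))%E.
  apply: (@measure_unique_quadrants _ m1 m2) => //.
    by apply: (@le_lt_trans _ _ 1%E); [exact: probability_le1|exact: ltry].
  move=> x y.
  transitivity (sum_law k `]-oo, x]%classic *
    distribution P (zeta k.+1) `]-oo, y]%classic)%E; last first.
    by rewrite /m2/= product_measure1E.
  have s2 i : i \in [:: k.+1] -> (k < i)%N by rewrite inE => /eqP ->.
  have mx : measurable (`]-oo, x]%classic : set R) by [].
  have my (i : nat) : measurable (`]-oo, y]%classic : set R) by [].
  have := @indep_block k [:: k.+1] (fun _ => `]-oo, y]%classic) _ isT s2 mx my.
  by rewrite /event big_cons big_nil setIT.
by apply: intg_bounded (measurableT_comp mf (measurable_pair_sum k)) _ => w; exact: fK.
Qed.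

End partial_sums_independence.

Lemma sum_offdiag (R : realType) (f : nat -> nat -> R) k :
  \sum_(1 <= i < k.+2) \sum_(1 <= l < k.+2 | i != l) f i l =
  \sum_(1 <= i < k.+1) \sum_(1 <= l < k.+1 | i != l) f i l
  + \sum_(1 <= i < k.+1) f i k.+1 + \sum_(1 <= l < k.+1) f k.+1 l.
Proof.
rewrite big_nat_recr//=; congr (_ + _).
  rewrite -big_split/=; apply: eq_big_nat => i /andP[_ ik].
  rewrite big_mkcond big_nat_recr//= -big_mkcond/=.
  by rewrite (_ : i != k.+1)// neq_ltn ik.
rewrite big_mkcond big_nat_recr//= eqxx addr0 -big_mkcond/=.
rewrite big_nat_cond [RHS]big_nat_cond; apply: eq_bigl => l.
by case: (boolP (1 <= l < k.+1)%N) => //= /andP[_ lk]; rewrite eq_sym neq_ltn lk.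
Qed.

Section telescoping.
Context {R : realType} (Phi : probability R R).
Local Notation D := (scale Phi).
Hypothesis scaleP : scale_function D.
Hypothesis intgPhi : intg Phi id.
Hypothesis regularPhi : regular D (fun _ : unit => dtail Phi) (fun _ => D).
Hypothesis jumpPhi : negl D (fun (_ : unit) z =>
  Ex (Phi \x Phi)%E (jump z) - 2 * mean Phi * D z).
Context d (T : measurableType d) (P : probability T R).
Variables (I : Type) (zeta : I -> nat -> {mfun T >-> R}).
Hypothesis indep : forall p, mutually_independent P (fun i w => zeta p i w).
Variable Z : nat -> T -> R.
Hypothesis intgZ0 : forall i, intg P (Z i).
Hypothesis zetaZ : forall p i w, `|zeta p i w| <= Z i w.
Hypothesis Z_ge0 : forall i w, 0 <= Z i w.
Variables (n : nat) (h : nat -> I -> R -> R).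
Hypothesis reg : forall i, (1 <= i <= n)%N ->
  regular D (fun p => dtail (distribution P (zeta p i))) (h i).

Let intg_zeta p i : intg P (zeta p i).
Proof. exact: intg_le (measurable_funPT _) (zetaZ p i) (intgZ0 i). Qed.

Let intg_sum_zeta p k : intg P (partial_sum (zeta p) k).
Proof. by apply: intg_sum => i _; exact: intg_zeta. Qed.

Let unif_int_zeta i : unif_int (fun p => distribution P (zeta p i)).
Proof. exact: unif_int_distribution (intgZ0 i) (Z_ge0 i) (zetaZ^~ i). Qed.

Let unif_int_sum k : unif_int (fun p => sum_law P (zeta p) k).
Proof.
apply: (@unif_int_distribution _ _ _ _ P
  (fun p => mfun_of (measurable_partial_sum (zeta p) k))
  (fun w => \sum_(1 <= i < k.+1) Z i w)).
- by apply: intg_sum.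
- by move=> w; apply: sumr_ge0.
- move=> p w; rewrite /= /partial_sum (le_trans (ler_norm_sum _ _ _))//.
  exact: ler_sum.
Qed.

Let mean_zeta p i : mean (distribution P (zeta p i)) = Ex P (zeta p i).
Proof. by rewrite meanE Ex_distribution//; exact: intg_zeta. Qed.

Let mean_sum p k : mean (sum_law P (zeta p) k) =
  \sum_(1 <= i < k.+1) Ex P (zeta p i).
Proof.
rewrite meanE Ex_distribution//; last exact: intg_sum_zeta.
by rewrite -Ex_sum.
Qed.

Let dtail_sumS p k z : dtail (sum_law P (zeta p) k.+1) z =
  Ex (sum_law P (zeta p) k \x distribution P (zeta p k.+1))%E
    (fun u => \I[z < u.1 + u.2]).
Proof.
rewrite -(@Ex_pair_sum _ _ _ P _ (indep p) k 1 (fun u => \I[z < u.1 + u.2])).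
- rewrite dtailE Ex_distribution/=; [|by meas|].
    by apply: eq_Ex => w /=; rewrite partial_sumS.
  apply: intg_natb; apply: measurable_ltf; first exact: measurable_cst.
  exact: measurable_partial_sum.
- by meas.
- by move=> u; rewrite normr_nat lern1 leq_b1.
Qed.

(** The two claims need each other: expanding k + 1 terms uses regularity of the k-term tail, and
    that expansion shows the (k + 1)-term tail to be regular. *)
Lemma telescoping k : (k <= n)%N ->
  regular D (fun p => dtail (sum_law P (zeta p) k))
    (fun p z => \sum_(1 <= i < k.+1) h i p z) /\
  negl D (fun p z => dtail (sum_law P (zeta p) k) z
    - \sum_(1 <= i < k.+1) dtail (distribution P (zeta p i)) z
    - \sum_(1 <= i < k.+1) \sum_(1 <= l < k.+1 | i != l)
        Ex P (zeta p i) * h l p z).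
Proof.
elim: k => [|k IH] kn.
  have n0 : negl D (fun (_ : I) (_ : R) => 0).
    move=> e e0; near=> z => _; rewrite normr0 mulr_ge0 ?ltW//.
    by near: z; exact: scale_gt0.
  have d0 : \forall z \near +oo, forall p, dtail (sum_law P (zeta p) 0) z = 0.
    near=> z => p.
    have z0 : 0 <= z by near: z; apply: nbhs_pinfty_ge; exact: num_real.
    rewrite dtailE Ex_distribution/=; [|by meas|].
      rewrite -[RHS](Ex_cst P); apply: eq_Ex => w /=.
      by rewrite partial_sum0 ltNge z0.
    apply: intg_natb; apply: measurable_ltf; first exact: measurable_cst.
    exact: measurable_partial_sum.
  split.
    apply: eq_regular (negl_regular scaleP n0).
      by apply: filterS d0 => z d0z p; rewrite d0z.
    by apply: nearW => z p; rewrite big_geq.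
  by apply: eq_negl n0; apply: filterS d0 => z d0z p; rewrite d0z !big_geq// !subr0.
have [rk nk] := IH (ltnW kn).
have rz := reg (i := k.+1) kn.
have N := jump_expansion scaleP intgPhi regularPhi jumpPhi
  (unif_int_sum k) (unif_int_zeta k.+1) rk rz.
have N' : negl D (fun p z => dtail (sum_law P (zeta p) k.+1) z
    - dtail (sum_law P (zeta p) k) z - dtail (distribution P (zeta p k.+1)) z
    - Ex P (zeta p k.+1) * (\sum_(1 <= i < k.+1) h i p z)
    - (\sum_(1 <= i < k.+1) Ex P (zeta p i)) * h k.+1 p z).
  apply: eq_negl N; apply: nearW => z p.
  by rewrite Ex_jump -dtail_sumS mean_zeta mean_sum.
split.
  have b1 := unif_int_mean (unif_int_zeta k.+1).
  have b2 := unif_int_mean (unif_int_sum k).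
  have r1 := regularM b1 (regular_window scaleP rk).
  have r2 := regularM b2 (regular_window scaleP rz).
  apply: eq_regular (regularD (regularD (regularD rk rz) (regularD r1 r2))
    (negl_regular scaleP N')).
    by apply: nearW => z p; rewrite mean_zeta mean_sum; ring.
  by apply: nearW => z p; rewrite !mulr0 !addr0 [RHS]big_nat_recr.
apply: eq_negl (neglD N' nk); apply: nearW => z p.
rewrite sum_offdiag [\sum_(1 <= i < k.+2) _]big_nat_recr//= mulr_suml mulr_sumr.
ring.
Unshelve. all: by end_near. Qed.

End telescoping.

(** * Deterministic weights *)

Section independent_pair.
Context d (T : measurableType d) (R : realType) (P : probability T R).

(** Independence on quadrants makes the law of (A, B) a product law, against which the unbounded
    function x 1_b(y) is integrated by Fubini. *)
Lemma Ex_indep_window (A B : {mfun T >-> R}) (b : R -> bool) :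
  (forall x y, P (A @^-1` `]-oo, x] `&` B @^-1` `]-oo, y]) =
     (P (A @^-1` `]-oo, x]) * P (B @^-1` `]-oo, y]))%E) ->
  measurable_fun setT b -> intg P A ->
  Ex P (fun w => A w * \I[b (B w)]) = Ex P A * Ex P (fun w => \I[b (B w)]).
Proof.
move=> AB mb iA.
have mAB : measurable_fun setT (fun w => (A w, B w)) by exact: measurable_fun_pair.
have mbB : measurable_fun setT (b \o B) by exact: (measurableT_comp mb).
pose f (u : R * R) : R := u.1 * \I[b u.2].
have mf : measurable_fun setT f.
  apply: measurable_mulf; first by meas.
  by apply: measurable_natb; exact: (measurableT_comp mb measurable_snd).
have ifP : intg P (fun w => f (A w, B w)) by exact: intgMb.
pose lA := distribution P A; pose lB := distribution P B.
have law : forall S, measurable S ->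
    distribution P (mfun_of mAB) S = (lA \x lB)%E S.
  pose m1 : {measure set (R * R) -> \bar R} := distribution P (mfun_of mAB).
  pose m2 : {measure set (R * R) -> \bar R} := (lA \x lB)%E.
  apply: (@measure_unique_quadrants _ m1 m2).
    by apply: (@le_lt_trans _ _ 1%E); [exact: probability_le1|exact: ltry].
  move=> x y; rewrite /m2/= product_measure1E//; exact: AB.
have ilA : intg lA id by apply: intg_distribution.
have iprod : intg (lA \x lB)%E f.
  apply: (@intgMb _ _ _ _ (fun u : R * R => b u.2) fst).
    exact: (measurableT_comp mb measurable_snd).
  exact: (intg_fst lB ilA).
transitivity (Ex (lA \x lB)%E f).
  rewrite -(Ex_distribution (X := mfun_of mAB) mf)//.
  by rewrite /Ex /Rintegral; congr fine; apply: eq_measure_integral => S mS _; exact: law.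
rewrite Ex_fubini// => [|y]; last first.
  by apply: (@intgMb _ _ _ _ (fun _ => b y) id); [meas|].
have <- : Ex lA id = Ex P A by rewrite Ex_distribution.
have <- : Ex lB (fun y => \I[b y]) = Ex P (fun w => \I[b (B w)]).
  by rewrite Ex_distribution//; [exact: measurable_natb|exact: intg_natb].
rewrite -ExZ; last exact: intg_natb.
apply: eq_Ex => y; rewrite /f /=; case: (b y).
  by rewrite mulr1; apply: eq_Ex => x; rewrite mulr1.
by rewrite mulr0 -[RHS](Ex_cst lA); apply: eq_Ex => x; rewrite mulr0.
Qed.

End independent_pair.

Lemma sum_diag (R : realType) (s : seq nat) (f : nat -> nat -> R) : uniq s ->
  \sum_(i <- s) \sum_(j <- s) f i j =
  \sum_(i <- s) f i i + \sum_(i <- s) \sum_(j <- s | i != j) f i j.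
Proof.
move=> us; rewrite -big_split/= big_seq_cond [RHS]big_seq_cond.
apply: eq_bigr => i /andP[si _]; rewrite (bigD1_seq i)//=; congr (_ + _).
by apply: eq_bigl => j; rewrite eq_sym.
Qed.

Lemma sum_offdiagC (R : realType) (s : seq nat) (f : nat -> nat -> R) :
  \sum_(i <- s) \sum_(j <- s | i != j) f i j =
  \sum_(i <- s) \sum_(j <- s | i != j) f j i.
Proof.
under eq_bigr do rewrite big_mkcond.
rewrite exchange_big/=; apply: eq_bigr => i _; rewrite [RHS]big_mkcond.
by apply: eq_bigr => j _; rewrite eq_sym.
Qed.

Lemma bigmax_attained (R : realType) (s : seq nat) (f : nat -> R) x :
  \big[Num.max/x]_(i <- s) f i = x \/
  exists2 i, i \in s & \big[Num.max/x]_(i <- s) f i = f i.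
Proof.
elim: s => [|i s IH]; first by left; rewrite big_nil.
rewrite big_cons; case: (leP (f i) (\big[Num.max/x]_(j <- s) f j)) => h.
  case: IH => [->|[j js ->]]; first by left.
  by right; exists j; rewrite ?inE ?js ?orbT.
by right; exists i; rewrite ?mem_head.
Qed.

(** * Normalisation by the largest weight *)

Section normalisation.
Context {R : realType} (lo hi : R) (n : nat).
Hypotheses (lo0 : 0 < lo) (lohi : lo <= hi) (n0 : (0 < n)%N).

Record box := Box {
  boxX : nat -> R;
  boxY : nat -> R;
  boxXP : forall i, lo <= boxX i <= hi;
  boxYP : forall i, lo <= boxY i <= hi }.

Definition top (p : box) : R :=
  \big[Num.max/lo]_(1 <= i < n.+1) Num.max (boxX p i) (boxY p i).

Lemma top_ge p : lo <= top p.
Proof. exact: bigmax_ge_id. Qed.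

Lemma top_le p : top p <= hi.
Proof.
apply: bigmax_le => // i _; rewrite ge_max.
by have /andP[_ ->] := boxXP p i; have /andP[_ ->] := boxYP p i.
Qed.

Lemma top_gt0 p : 0 < top p. Proof. exact: lt_le_trans lo0 (top_ge p). Qed.

Lemma boxX_top p i : (1 <= i < n.+1)%N -> boxX p i <= top p.
Proof.
move=> ni; have := @le_bigmax_seq _ _ _ (index_iota 1 n.+1) lo i xpredT
  (fun i => Num.max (boxX p i) (boxY p i)).
by rewrite mem_index_iota => /(_ ni isT); rewrite ge_max => /andP[].
Qed.

Lemma boxY_top p i : (1 <= i < n.+1)%N -> boxY p i <= top p.
Proof.
move=> ni; have := @le_bigmax_seq _ _ _ (index_iota 1 n.+1) lo i xpredT
  (fun i => Num.max (boxX p i) (boxY p i)).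
by rewrite mem_index_iota => /(_ ni isT); rewrite ge_max => /andP[].
Qed.

(** If the maximum is the initial value [lo], the first weight, being at least [lo], equals it. *)
Lemma top_attained p : exists2 i, (1 <= i < n.+1)%N &
  top p = boxX p i \/ top p = boxY p i.
Proof.
have [tlo|[i]] := @bigmax_attained R (index_iota 1 n.+1)
  (fun i => Num.max (boxX p i) (boxY p i)) lo.
  exists 1%N; first by rewrite ltnS.
  left; apply/eqP; rewrite eq_le boxX_top ?ltnS// andbT.
  by rewrite /top tlo; have /andP[] := boxXP p 1%N.
rewrite mem_index_iota => ni ti; exists i => //; rewrite /top ti.
by case: (leP (boxX p i) (boxY p i)) => _; [right|left].
Qed.

(** [top] does not control indices outside 1..n; the value 1 there keeps the relative weights in
    [lo / hi, 1] at every index, as the estimates for one pair require. *)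
Definition relX (p : box) (i : nat) : R :=
  if (1 <= i < n.+1)%N then boxX p i / top p else 1.
Definition relY (p : box) (i : nat) : R :=
  if (1 <= i < n.+1)%N then boxY p i / top p else 1.

Lemma relXP i p : lo / hi <= relX p i <= 1.
Proof.
have hi0 : 0 < hi by exact: lt_le_trans lohi.
rewrite /relX; case: ifP => ni; last by rewrite lexx ler_pdivrMr// mul1r lohi.
have /andP[l_ _] := boxXP p i; apply/andP; split; last first.
  by rewrite ler_pdivrMr ?top_gt0// mul1r boxX_top.
rewrite ler_pdivlMr ?top_gt0// mulrAC ler_pdivrMr// ler_pM ?top_le//.
  exact: ltW.
exact: ltW (top_gt0 _).
Qed.

Lemma relYP i p : lo / hi <= relY p i <= 1.
Proof.
have hi0 : 0 < hi by exact: lt_le_trans lohi.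
rewrite /relY; case: ifP => ni; last by rewrite lexx ler_pdivrMr// mul1r lohi.
have /andP[l_ _] := boxYP p i; apply/andP; split; last first.
  by rewrite ler_pdivrMr ?top_gt0// mul1r boxY_top.
rewrite ler_pdivlMr ?top_gt0// mulrAC ler_pdivrMr// ler_pM ?top_le//.
  exact: ltW.
exact: ltW (top_gt0 _).
Qed.

Lemma relX_top p i : (1 <= i < n.+1)%N -> relX p i * top p = boxX p i.
Proof. by move=> ni; rewrite /relX ni divfK// gt_eqF// top_gt0. Qed.

Lemma relY_top p i : (1 <= i < n.+1)%N -> relY p i * top p = boxY p i.
Proof. by move=> ni; rewrite /relY ni divfK// gt_eqF// top_gt0. Qed.

Lemma bounded_top : bounded top.
Proof.
exists hi; first exact: lt_le_trans lohi.
by move=> p; rewrite gtr0_norm ?top_gt0// top_le.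
Qed.

Lemma bounded_topV : bounded (fun p => (top p)^-1).
Proof.
exists lo^-1; first by rewrite invr_gt0.
move=> p; rewrite gtr0_norm ?invr_gt0 ?top_gt0//.
by rewrite lef_pV2 ?posrE ?top_gt0// top_ge.
Qed.

(** Since [top] is at most [hi], z / top p tends to infinity uniformly in p. *)
Lemma near_div_top (Q : R -> Prop) : (\forall z \near +oo, Q z) ->
  \forall z \near +oo, forall p, Q (z / top p).
Proof.
move=> [b [_ bQ]]; have hi0 : 0 < hi by exact: lt_le_trans lohi.
near=> z => p; apply: bQ; rewrite ltr_pdivlMr ?top_gt0//.
apply: (@le_lt_trans _ _ (`|b| * hi)).
  have := ler_norm b => bb; apply: le_trans (_ : `|b| * top p <= _).
    by rewrite ler_wpM2r// ltW// top_gt0.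
  by rewrite ler_wpM2l// top_le.
by near: z; apply: nbhs_pinfty_gt; exact: num_real.
Unshelve. all: by end_near. Qed.

End normalisation.

Section first_order_terms.
Context d (T : measurableType d) (R : realType) (P : probability T R).
Variables (n : nat) (A B c e : nat -> T -> R) (mu nu z : R).

(** The integrand of the announced expansion. The coefficients [c] and [e] may depend on the sample
    point, so that it serves for frozen and for random weights. *)
Definition first_order_terms (w : T) : R :=
  \sum_(1 <= i < n.+1) \I[z < A i w]
  + mu * (\sum_(1 <= i < n.+1) \sum_(1 <= l < n.+1 | i != l)
      c i w * \I[z < A l w <= z + 1])
  + \sum_(1 <= j < n.+1) \I[z < B j w]
  + nu * (\sum_(1 <= j < n.+1) \sum_(1 <= l < n.+1 | j != l)
      e j w * \I[z < B l w <= z + 1])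
  + \sum_(1 <= i < n.+1) \sum_(1 <= j < n.+1)
      (A i w * \I[z < B j w <= z + 1] + B j w * \I[z < A i w <= z + 1]).

Lemma measurable_first_order_terms :
  (forall i, measurable_fun setT (A i)) -> (forall i, measurable_fun setT (B i)) ->
  (forall i, measurable_fun setT (c i)) -> (forall i, measurable_fun setT (e i)) ->
  measurable_fun setT first_order_terms.
Proof.
move=> mA mB mc me.
have double (C g : nat -> T -> R) : (forall i, measurable_fun setT (C i)) ->
    (forall i, measurable_fun setT (g i)) ->
    measurable_fun setT (fun w => \sum_(1 <= i < n.+1)
      \sum_(1 <= l < n.+1 | i != l) g i w * \I[z < C l w <= z + 1]).
  move=> mC mg; apply: measurable_sum => i.
  under eq_fun do rewrite big_mkcond/=.
  apply: measurable_sum => l; case: (i != l); last by meas.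
  by have := mC l; have := mg i => ? ?; meas.
apply: measurable_addf; first apply: measurable_addf; first apply: measurable_addf;
  first apply: measurable_addf.
- by apply: measurable_sum => i; have := mA i => ?; meas.
- by apply: measurable_mulf; [meas|exact: double].
- by apply: measurable_sum => i; have := mB i => ?; meas.
- by apply: measurable_mulf; [meas|exact: double].
- apply: measurable_sum => i; apply: measurable_sum => j.
  by have := mA i; have := mB j => ? ?; meas.
Qed.

Hypotheses (iA : forall i, intg P (A i)) (iB : forall i, intg P (B i)).
Hypotheses (ic : forall i, intg P (c i)) (ie : forall i, intg P (e i)).

Let intg_gt (f : T -> R) : intg P f -> intg P (fun w => \I[z < f w]).
Proof. by move=> /intg_measurable mf; apply: intg_natb; meas. Qed.

Let intg_in (f g : T -> R) : intg P f -> intg P g ->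
  intg P (fun w => f w * \I[z < g w <= z + 1]).
Proof.
move=> fi /intg_measurable mg.
by apply: (@intgMb _ _ _ P (fun w => z < g w <= z + 1) f) => //; meas.
Qed.

Let i1 (C : nat -> T -> R) : (forall i, intg P (C i)) ->
  intg P (fun w => \sum_(1 <= i < n.+1) \I[z < C i w]).
Proof. by move=> iC; apply: intg_sum => i _; exact: intg_gt. Qed.

Let i2 (C g : nat -> T -> R) : (forall i, intg P (C i)) -> (forall i, intg P (g i)) ->
  intg P (fun w => \sum_(1 <= i < n.+1) \sum_(1 <= l < n.+1 | i != l)
      g i w * \I[z < C l w <= z + 1]).
Proof.
by move=> iC ig; apply: intg_sum => i _; apply: intg_sum => l _; exact: intg_in.
Qed.

Let i3 : intg P (fun w => \sum_(1 <= i < n.+1) \sum_(1 <= j < n.+1)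
    (A i w * \I[z < B j w <= z + 1] + B j w * \I[z < A i w <= z + 1])).
Proof.
by apply: intg_sum => i _; apply: intg_sum => j _; apply: intgD; exact: intg_in.
Qed.

Lemma intg_first_order_terms : intg P first_order_terms.
Proof.
exact: intgD (intgD (intgD (intgD (i1 iA) (intgZ mu (i2 iA ic))) (i1 iB))
  (intgZ nu (i2 iB ie))) i3.
Qed.

Let Ex_double (C g : nat -> T -> R) : (forall i, intg P (C i)) ->
  (forall i, intg P (g i)) ->
  Ex P (fun w => \sum_(1 <= i < n.+1) \sum_(1 <= l < n.+1 | i != l)
      g i w * \I[z < C l w <= z + 1]) =
  \sum_(1 <= i < n.+1) \sum_(1 <= l < n.+1 | i != l)
      Ex P (fun w => g i w * \I[z < C l w <= z + 1]).
Proof.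
move=> iC ig; rewrite Ex_sum => [|i _]; last by apply: intg_sum => l _; exact: intg_in.
by apply: eq_bigr => i _; rewrite Ex_sum => [//|l _]; exact: intg_in.
Qed.

Lemma Ex_first_order_terms : Ex P first_order_terms =
  \sum_(1 <= i < n.+1) Ex P (fun w => \I[z < A i w])
  + mu * (\sum_(1 <= i < n.+1) \sum_(1 <= l < n.+1 | i != l)
      Ex P (fun w => c i w * \I[z < A l w <= z + 1]))
  + \sum_(1 <= j < n.+1) Ex P (fun w => \I[z < B j w])
  + nu * (\sum_(1 <= j < n.+1) \sum_(1 <= l < n.+1 | j != l)
      Ex P (fun w => e j w * \I[z < B l w <= z + 1]))
  + \sum_(1 <= i < n.+1) \sum_(1 <= j < n.+1)
      (Ex P (fun w => A i w * \I[z < B j w <= z + 1])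
       + Ex P (fun w => B j w * \I[z < A i w <= z + 1])).
Proof.
have z1 := intgZ mu (i2 iA ic); have z2 := intgZ nu (i2 iB ie).
rewrite /first_order_terms ExD; [|exact: intgD (intgD (intgD (i1 iA) z1) (i1 iB)) z2
  |exact: i3].
rewrite ExD; [|exact: intgD (intgD (i1 iA) z1) (i1 iB)|exact: z2].
rewrite ExD; [|exact: intgD (i1 iA) z1|exact: i1].
rewrite ExD; [|exact: i1|exact: z1].
rewrite !ExZ; [|exact: i2|exact: i2].
congr (_ + _ * _ + _ + _ * _ + _); [|exact: Ex_double| |exact: Ex_double|].
- by rewrite Ex_sum// => i _; exact: intg_gt.
- by rewrite Ex_sum// => i _; exact: intg_gt.
- rewrite Ex_sum => [|i _]; last first.
    by apply: intg_sum => j _; apply: intgD; exact: intg_in.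
  apply: eq_bigr => i _; rewrite Ex_sum => [|j _]; last by apply: intgD; exact: intg_in.
  by apply: eq_bigr => j _; rewrite ExD//; exact: intg_in.
Qed.

End first_order_terms.

Section half_scale.
Context {R : realType}.
Implicit Types x D E C w : R.

Lemma half_le x D w : `|x - D| <= 2^-1 * D -> x <= w -> 2^-1 * D <= w.
Proof. by rewrite ler_norml => /andP[? _] ?; lra. Qed.

(** The alternatives correspond to the largest weight belonging to an X or to a Y; [E] is meant as
    the scale of G. *)
Lemma half_le_scale D E C w : 0 < C -> 0 <= w ->
  2^-1 * D <= w \/ D <= C * E /\ 2^-1 * E <= w -> D <= (2 + 2 * C) * w.
Proof.
move=> C0 w0; have Cw : 0 <= C * w by rewrite mulr_ge0// ltW.
case=> [h|[DE h]]; first by lra.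
have h1 : C * (2^-1 * E) <= C * w by rewrite ler_pM2l.
by lra.
Qed.

End half_scale.

Section deterministic_weights.
Context {R : realType} d (T : measurableType d) (P : probability T R).
Variables (F G : probability R R) (r : R) (X Y : nat -> {mfun T >-> R}).
Hypothesis hr : -1 <= r <= 1.
Hypothesis hFGM : forall i x y,
  prob P [set w | X i w <= x /\ Y i w <= y] = FGM r F G x y.
Hypothesis hindep : mutually_independent P (fun i w => (X i w, Y i w)).
Hypotheses (hF : class_S2tilde F) (hG : class_S2tilde G).
Hypothesis hFG : same_order (fun x => dincr F x 1) (fun x => dincr G x 1).
Variables (n : nat) (lo hi : R).
Hypotheses (lo0 : 0 < lo) (lohi : lo <= hi) (n0 : (0 < n)%N).

Local Notation DF := (scale (pos_part F)).
Local Notation DG := (scale (pos_part G)).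
Local Notation I := (box lo hi).
Local Notation top := (top (lo := lo) (hi := hi) n).
Local Notation relX := (relX (lo := lo) (hi := hi) n).
Local Notation relY := (relY (lo := lo) (hi := hi) n).

Let iF : intg F id. Proof. by have [] := hF. Qed.
Let iG : intg G id. Proof. by have [] := hG. Qed.
Let scaleP := S2tilde_scale hF.
Let intgPhi := intg_pos_part iF.
Let S2F : class_S2 (pos_part F). Proof. by have [] := hF. Qed.
Let regPhi : regular DF (fun _ : unit => dtail (pos_part F)) (fun _ => DF).
Proof. by apply: LDelta_regular; have [] := S2F. Qed.
Let jumpPhi := S2_jump S2F.
Let rF := S2tilde_regular hF.

Let rG : regular DF (fun _ : unit => dtail G) (fun _ => DG).
Proof.
have [C C0 GF] : exists2 C, 0 < C & \forall z \near +oo, DG z <= C * DF z.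
  by apply: same_order_scale; case: hFG.
exact: regular_le_scale C0 GF (S2tilde_regular hG).
Qed.

Let a0 : 0 < lo / hi.
Proof. by rewrite divr_gt0// (lt_le_trans lo0). Qed.

Let mX i : measurable_fun setT (X i). Proof. by []. Qed.
Let mY i : measurable_fun setT (Y i). Proof. by []. Qed.

Let topP (p : I) : 0 < top p. Proof. exact: top_gt0. Qed.
Let btop : bounded top. Proof. exact: bounded_top. Qed.
Let btopV : bounded (fun p => (top p)^-1). Proof. exact: bounded_topV. Qed.
Let rX i (p : I) : lo / hi <= relX p i <= 1. Proof. exact: relXP. Qed.
Let rY i (p : I) : lo / hi <= relY p i <= 1. Proof. exact: relYP. Qed.

Let cX i : I -> R := fun p => relX p i.
Let cY i : I -> R := fun p => relY p i.

Let cr i := cross (cX i) (cY i) top.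
Let pw i := pair_window F G (cX i) (cY i) top.

Let pairJ i := pair_jump_negl scaleP intgPhi regPhi jumpPhi hr (hFGM i) iF iG
  rF rG a0 (rX i) (rY i) topP btop btopV.
Let pairR i := pair_regular scaleP intgPhi regPhi jumpPhi hr (hFGM i) iF iG
  rF rG a0 (rX i) (rY i) topP btop btopV.

Let measurable_zeta p i :
  measurable_fun setT (fun w => cX i p * X i w + cY i p * Y i w).
Proof. by have := mX i; have := mY i => ? ?; meas. Qed.

Let zeta p i := mfun_of (measurable_zeta p i).

Let intgX i : intg P (X i). Proof. exact: intg_X hr (hFGM i) iF. Qed.
Let intgY i : intg P (Y i). Proof. exact: intg_Y hr (hFGM i) iG. Qed.

Let indep_zeta p : mutually_independent P (fun i w => zeta p i w).
Proof.
move=> s B us mB.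
apply: (hindep (B := fun i => [set u : R * R | B i (cX i p * u.1 + cY i p * u.2)]) us).
move=> i; rewrite -[X in measurable X]setTI.
have m : measurable_fun setT (fun u : R * R => cX i p * u.1 + cY i p * u.2) by meas.
exact: m.
Qed.

Let dtail_zeta p i z : dtail (distribution P (zeta p i)) z =
  Ex P (fun w => \I[z < cX i p * X i w + cY i p * Y i w]).
Proof.
have := mX i; have := mY i => ? ?.
by rewrite dtailE Ex_distribution//=; [meas|apply: intg_natb; meas].
Qed.

Let mean_zeta p i : Ex P (zeta p i) = cX i p * mean F + cY i p * mean G.
Proof.
rewrite ExD; [|exact: intgZ|exact: intgZ].
by rewrite !ExZ// (mean_X hr (hFGM i) iF) (mean_Y hr (hFGM i) iG).
Qed.

(** Telescoping leaves the tails of the single pairs and products over distinct indices; the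
    expansions of the n pairs then resolve these tails. *)
Let normalised_negl : negl DF (fun p z => dtail (sum_law P (zeta p) n) z
  - \sum_(1 <= i < n.+1) (dtail (dilate F (cX i p)) z + dtail (dilate G (cY i p)) z)
  - \sum_(1 <= i < n.+1) Ex P (fun w => cr i p z (X i w, Y i w))
  - \sum_(1 <= i < n.+1) \sum_(1 <= l < n.+1 | i != l)
      (cX i p * mean F + cY i p * mean G) * pw l p z).
Proof.
have reg i : (1 <= i <= n)%N ->
    regular DF (fun p => dtail (distribution P (zeta p i))) (pw i).
  move=> _; apply: eq_regular (pairR i); last exact: nearW.
  by apply: nearW => z p; rewrite dtail_zeta.
have intgZ i : intg P (fun w => `|X i w| + `|Y i w|).
  by apply: intgD; exact: intg_norm.
have zetaZ p i w : `|zeta p i w| <= `|X i w| + `|Y i w|.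
  have /andP[x1 x2] := rX i p; have /andP[y1 y2] := rY i p.
  rewrite /= (le_trans (ler_normD _ _))// !normrM lerD// ler_piMl//.
    by rewrite ger0_norm// (le_trans (ltW a0)).
  by rewrite ger0_norm// (le_trans (ltW a0)).
have Z0 i w : 0 <= `|X i w| + `|Y i w| by exact: addr_ge0.
have [_ N] := telescoping scaleP intgPhi regPhi jumpPhi indep_zeta intgZ zetaZ Z0
  reg (leqnn n).
have M := @negl_sum _ DF I nat (index_iota 1 n.+1) xpredT _ scaleP (fun i _ => pairJ i).
apply: eq_negl (neglD N M); apply: nearW => z p.
have E : \sum_(1 <= i < n.+1)
   (Ex P (fun w => jump z (cX i p * X i w, cY i p * Y i w)) -
    Ex P (fun w => cr i p z (X i w, Y i w))) =
   \sum_(1 <= i < n.+1) dtail (distribution P (zeta p i)) z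
   - \sum_(1 <= i < n.+1) (dtail (dilate F (cX i p)) z + dtail (dilate G (cY i p)) z)
   - \sum_(1 <= i < n.+1) Ex P (fun w => cr i p z (X i w, Y i w)).
  rewrite -!sumrB; apply: eq_bigr => i _; congr (_ - _).
  rewrite dtail_zeta opprD addrA.
  exact: (Ex_pair_jump hr (hFGM i) a0 (rX i) (rY i)).
rewrite E.
have -> : \sum_(1 <= i < n.+1) \sum_(1 <= l < n.+1 | i != l)
    Ex P (zeta p i) * pw l p z =
  \sum_(1 <= i < n.+1) \sum_(1 <= l < n.+1 | i != l)
    (cX i p * mean F + cY i p * mean G) * pw l p z.
  by apply: eq_bigr => i _; apply: eq_bigr => l _; rewrite mean_zeta.
by ring.
Qed.

Let regular_index (H : probability R R) k (D : R -> R) :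
  regular D (fun _ : unit => dtail H) (fun _ => k) ->
  regular D (fun _ : I => dtail H) (fun _ => k).
Proof.
move=> [[C C0 dk] rk]; split.
  by exists C => //; apply: filterS dk => z dz p; exact: dz tt.
by move=> M e e0; apply: filterS (rk M e e0) => z dz p; exact: dz tt.
Qed.

Let dilate1 (H : probability R R) z : dtail (dilate H 1) z = dtail H z.
Proof. by rewrite dtail_dilate// divr1. Qed.

Let window_ge0 (H : probability R R) c p z : 0 <= window (top p) (dtail (dilate H c)) z.
Proof.
apply: mulr_ge0; first exact: ltW (topP p).
rewrite subr_ge0; apply: dtail_nonincreasing.
by rewrite lerDl invr_ge0 ltW.
Qed.

(* The term with the largest weight carries an increment of order DF. *)
Let scale_le_window : exists2 C, 0 < C & \forall z \near +oo, forall p,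
  DF z <= C * \sum_(1 <= i < n.+1) pw i p z.
Proof.
have [C C0 FG] := same_order_scale hFG.
have nF := negl_rescaled_window topP btop btopV (regular_index rF).
have nG := negl_rescaled_window topP btop btopV (regular_index (S2tilde_regular hG)).
exists (2 + 2 * C); first by rewrite addr_gt0// mulr_gt0.
have h2 : 0 < 2^-1 :> R by lra.
have nF2 := nF _ h2; have nG2 := nG _ h2.
near=> z.
have F0 : 0 < DF z by near: z; exact: scale_gt0.
have A p : `|top p * (dtail F z - dtail F (z + (top p)^-1)) - DF z| <= 2^-1 * DF z.
  by move: p; near: z.
have B p : `|top p * (dtail G z - dtail G (z + (top p)^-1)) - DG z| <= 2^-1 * DG z.
  by move: p; near: z.
have CFG : DF z <= C * DG z by near: z.
move=> p; have [i ni ti] := top_attained n0 p.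
have pw0 j : 0 <= pw j p z by apply: addr_ge0; exact: window_ge0.
have pwi : pw i p z <= \sum_(1 <= j < n.+1) pw j p z.
  rewrite (bigD1_seq i) ?mem_index_iota ?iota_uniq//= lerDl; exact: sumr_ge0.
apply: le_trans (_ : (2 + 2 * C) * pw i p z <= _); last first.
  by rewrite ler_wpM2l// addr_ge0// mulr_ge0// ltW.
(* A term attaining [top] has relative weight 1, so its window is that of the undilated law and is
   at least half the corresponding scale. *)
apply: (@half_le_scale _ _ (DG z)) => //; case: ti => ti; [left|right; split => //].
  have c1 : cX i p = 1 by rewrite /cX /relX ni -ti divff// gt_eqF// topP.
  apply: half_le (A p) _; rewrite -!(dilate1 F) -{1}c1 -c1 lerDl.
  exact: window_ge0.
have c1 : cY i p = 1 by rewrite /cY /relY ni -ti divff// gt_eqF// topP.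
apply: half_le (B p) _; rewrite -!(dilate1 G) -c1 lerDr.
exact: window_ge0.
Unshelve. all: by end_near. Qed.

Definition gain (p : I) (z : R) (w : T) : R :=
  \I[z < \sum_(1 <= i < n.+1) X i w * boxX p i
         + \sum_(1 <= i < n.+1) Y i w * boxY p i].

Definition inX (p : I) i z w : bool := z < X i w * boxX p i <= z + 1.
Definition inY (p : I) i z w : bool := z < Y i w * boxY p i <= z + 1.

Definition first_order (p : I) (z : R) : T -> R :=
  first_order_terms n (fun i w => X i w * boxX p i) (fun j w => Y j w * boxY p j)
    (fun i _ => boxX p i) (fun j _ => boxY p j) (mean F) (mean G) z.

Definition error_terms (p : I) (z : R) (w : T) : R :=
  \sum_(1 <= i < n.+1) \I[inX p i z w] + \sum_(1 <= j < n.+1) \I[inY p j z w].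

Let wX p l z := Ex P (fun w => \I[inX p l z w]).
Let wY p l z := Ex P (fun w => \I[inY p l z w]).

Let meas_inX p l z : measurable_fun setT (inX p l z).
Proof. by have := mX l => ?; rewrite /inX; meas. Qed.
Let meas_inY p l z : measurable_fun setT (inY p l z).
Proof. by have := mY l => ?; rewrite /inY; meas. Qed.

Let ltE p (x y c : R) : (x < y * (c * top p)) = (x / top p < c * y).
Proof. by rewrite ltr_pdivrMr// mulrA [y * c]mulrC. Qed.

Let leE p (x y c : R) : (y * (c * top p) <= x) = (c * y <= x / top p).
Proof. by rewrite ler_pdivlMr// mulrA [y * c]mulrC. Qed.

(** Division by [top p] takes (z, z + 1] to an interval of length 1 / top p, the one used in
    [window (top p)]. *)
Let inX_rel p l z w : (1 <= l < n.+1)%N ->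
  inX p l z w = (z / top p < cX l p * X l w <= z / top p + (top p)^-1).
Proof.
move=> nl; rewrite /inX -(relX_top lo0 p nl) ltE leE.
by rewrite [(z + 1) / _]mulrDl mul1r.
Qed.

Let inY_rel p l z w : (1 <= l < n.+1)%N ->
  inY p l z w = (z / top p < cY l p * Y l w <= z / top p + (top p)^-1).
Proof.
move=> nl; rewrite /inY -(relY_top lo0 p nl) ltE leE.
by rewrite [(z + 1) / _]mulrDl mul1r.
Qed.

Let ltX p i z w : (1 <= i < n.+1)%N ->
  (z < X i w * boxX p i) = (z / top p < cX i p * X i w).
Proof. by move=> ni; rewrite -(relX_top lo0 p ni) ltE. Qed.

Let ltY p i z w : (1 <= i < n.+1)%N ->
  (z < Y i w * boxY p i) = (z / top p < cY i p * Y i w).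
Proof. by move=> ni; rewrite -(relY_top lo0 p ni) ltE. Qed.

Let Ex_between (A : T -> R) u v : measurable_fun setT A -> u <= v ->
  Ex P (fun w => \I[u < A w <= v]) =
  Ex P (fun w => \I[u < A w]) - Ex P (fun w => \I[v < A w]).
Proof.
move=> mA uv; rewrite -ExB; [|apply: intg_natb; meas..].
apply: eq_Ex => w; case: (ltP u (A w)) => uA; case: (leP (A w) v) => vA //=.
- by rewrite subr0.
- by rewrite subrr.
- by rewrite subr0.
- by have := lt_le_trans vA (le_trans uA uv); rewrite ltxx.
Qed.

Let topV_ge0 p : 0 <= (top p)^-1. Proof. by rewrite invr_ge0 ltW. Qed.

Let wXE p l z : (1 <= l < n.+1)%N -> top p * wX p l z =
  window (top p) (dtail (dilate F (cX l p))) (z / top p).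
Proof.
have := mX l => ? nl; rewrite /wX /window; congr (_ * _).
under eq_Ex => w do rewrite inX_rel//.
rewrite Ex_between; [|by meas|by rewrite lerDl].
by rewrite !(Ex_cX hr (hFGM l) a0 (rX l)).
Qed.

Let wYE p l z : (1 <= l < n.+1)%N -> top p * wY p l z =
  window (top p) (dtail (dilate G (cY l p))) (z / top p).
Proof.
have := mY l => ? nl; rewrite /wY /window; congr (_ * _).
under eq_Ex => w do rewrite inY_rel//.
rewrite Ex_between; [|by meas|by rewrite lerDl].
by rewrite !(Ex_eY hr (hFGM l) a0 (rY l)).
Qed.

Let pwE p l z : (1 <= l < n.+1)%N ->
  pw l p (z / top p) = top p * (wX p l z + wY p l z).
Proof. by move=> nl; rewrite /pw /pair_window -wXE// -wYE// mulrDr. Qed.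

Let crE p i z w : (1 <= i < n.+1)%N -> cr i p (z / top p) (X i w, Y i w) =
  X i w * boxX p i * \I[inY p i z w] + Y i w * boxY p i * \I[inX p i z w].
Proof.
move=> ni; rewrite /cr /cross /= -inX_rel// -inY_rel//.
by rewrite -(relX_top lo0 p ni) -(relY_top lo0 p ni) /cX /cY; ring.
Qed.

Let intg_XbX (p : I) i : intg P (fun w => X i w * boxX p i).
Proof.
have := intgZ (boxX p i) (intgX i); congr intg; apply/funext => w.
exact: mulrC.
Qed.

Let intg_YbY (p : I) i : intg P (fun w => Y i w * boxY p i).
Proof.
have := intgZ (boxY p i) (intgY i); congr intg; apply/funext => w.
exact: mulrC.
Qed.

Let intg_Xin p i j z : intg P (fun w => X i w * boxX p i * \I[inY p j z w]).
Proof. exact: (@intgMb _ _ _ P (inY p j z) (fun w => X i w * boxX p i)). Qed.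

Let intg_Yin p i j z : intg P (fun w => Y i w * boxY p i * \I[inX p j z w]).
Proof. exact: (@intgMb _ _ _ P (inX p j z) (fun w => Y i w * boxY p i)). Qed.

Let indepXY (i j : nat) x y : i != j ->
  P (X i @^-1` `]-oo, x] `&` Y j @^-1` `]-oo, y]) =
  (P (X i @^-1` `]-oo, x]) * P (Y j @^-1` `]-oo, y]))%E.
Proof.
move=> ij; pose B (k : nat) : set (R * R) := if k == i then (`]-oo, x] `*` setT)%classic
  else (setT `*` `]-oo, y])%classic.
have mB k : measurable (B k) by rewrite /B; case: ifP => _; exact: measurableX.
have us : uniq [:: i; j] by rewrite /= inE ij.
have := hindep (s := [:: i; j] : seq nat) (B := B) us mB; rewrite !big_cons !big_nil setIT mule1.
have -> : (fun w => (X i w, Y i w)) @^-1` B i = X i @^-1` `]-oo, x].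
  by rewrite /B eqxx; apply/seteqP; split => w /=; [case|].
have -> : (fun w => (X j w, Y j w)) @^-1` B j = Y j @^-1` `]-oo, y].
  by rewrite /B eq_sym (negbTE ij); apply/seteqP; split => w /=; [case|].
by [].
Qed.

Let Ex_Xin p i j z : i != j ->
  Ex P (fun w => X i w * boxX p i * \I[inY p j z w]) =
  boxX p i * mean F * wY p j z.
Proof.
move=> ij; have mb : measurable_fun setT (fun y : R => z < y * boxY p j <= z + 1).
  by meas.
have h := Ex_indep_window (fun x y => indepXY x y ij) mb (intgX i).
rewrite -mulrA -(mean_X hr (hFGM i) iF) -h -ExZ.
  by apply: eq_Ex => w; rewrite -mulrA mulrCA.
exact: (@intgMb _ _ _ P (inY p j z) (X i)).
Qed.

Let Ex_Yin p i j z : i != j ->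
  Ex P (fun w => Y j w * boxY p j * \I[inX p i z w]) =
  boxY p j * mean G * wX p i z.
Proof.
move=> ij; have mb : measurable_fun setT (fun y : R => z < y * boxX p i <= z + 1).
  by meas.
have h := Ex_indep_window (A := Y j) (B := X i) _ mb (intgY j).
rewrite -mulrA -(mean_Y hr (hFGM j) iG) -h -?ExZ.
- by apply: eq_Ex => w; rewrite -mulrA mulrCA.
- exact: (@intgMb _ _ _ P (inX p i z) (Y j)).
- by move=> x y; rewrite setIC indepXY// muleC.
Qed.

Let Ex_gain p z : Ex P (gain p z) = dtail (sum_law P (zeta p) n) (z / top p).
Proof.
rewrite dtailE Ex_distribution/=; [|by meas|].
  apply: eq_Ex => w /=; rewrite /gain ltr_pdivrMr// /partial_sum.
  rewrite -big_split/= big_distrl/=; congr (\I[_ < _]).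
  apply: eq_big_nat => i ni.
  by rewrite -(relX_top lo0 p ni) -(relY_top lo0 p ni) /cX /cY; ring.
apply: intg_natb; apply: measurable_ltf; first exact: measurable_cst.
exact: measurable_partial_sum.
Qed.

Lemma measurable_weighted_sum (p : I) :
  measurable_fun setT (fun w => \sum_(1 <= i < n.+1) X i w * boxX p i
         + \sum_(1 <= i < n.+1) Y i w * boxY p i).
Proof.
apply: measurable_addf; apply: measurable_sum => i.
  by have := mX i => ?; meas.
by have := mY i => ?; meas.
Qed.

Lemma intg_gain p z : intg P (gain p z).
Proof.
apply: intg_natb; apply: measurable_ltf; first exact: measurable_cst.
exact: measurable_weighted_sum.
Qed.

Let iwX p i z : intg P (fun w => \I[inX p i z w]).
Proof. exact: intg_natb. Qed.
Let iwY p i z : intg P (fun w => \I[inY p i z w]).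
Proof. exact: intg_natb. Qed.

Lemma intg_first_order p z : intg P (first_order p z).
Proof.
by apply: intg_first_order_terms => // i; exact: intg_cst.
Qed.

Lemma intg_error_terms p z : intg P (error_terms p z).
Proof. by apply: intgD; apply: intg_sum. Qed.

(** In the double sum over (i, j) the terms with i != j factor by independence; those with i = j
    belong to one dependent pair and remain as cross terms. *)
Let Ex_first_order p z : Ex P (first_order p z) =
  \sum_(1 <= i < n.+1) dtail (dilate F (cX i p)) (z / top p)
  + mean F * (\sum_(1 <= i < n.+1) \sum_(1 <= l < n.+1 | i != l)
      boxX p i * wX p l z)
  + \sum_(1 <= i < n.+1) dtail (dilate G (cY i p)) (z / top p)
  + mean G * (\sum_(1 <= i < n.+1) \sum_(1 <= l < n.+1 | i != l)
      boxY p i * wY p l z)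
  + (\sum_(1 <= i < n.+1) Ex P (fun w => cr i p (z / top p) (X i w, Y i w))
    + \sum_(1 <= i < n.+1) \sum_(1 <= j < n.+1 | i != j)
        (boxX p i * mean F * wY p j z + boxY p j * mean G * wX p i z)).
Proof.
rewrite /first_order Ex_first_order_terms//; [|by move=> i; exact: intg_cst..].
congr (_ + _ * _ + _ + _ * _ + _).
- apply: eq_big_nat => i ni; rewrite -(Ex_cX hr (hFGM i) a0 (rX i)).
  by apply: eq_Ex => w; rewrite ltX.
- by apply: eq_bigr => i _; apply: eq_bigr => l _; rewrite ExZ//; exact: iwX.
- apply: eq_big_nat => i ni; rewrite -(Ex_eY hr (hFGM i) a0 (rY i)).
  by apply: eq_Ex => w; rewrite ltY.
- by apply: eq_bigr => i _; apply: eq_bigr => l _; rewrite ExZ//; exact: iwY.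
- rewrite sum_diag ?iota_uniq//; congr (_ + _).
    apply: eq_big_nat => i ni; rewrite -ExD; [|exact: intg_Xin|exact: intg_Yin].
    by apply: eq_Ex => w; rewrite crE.
  apply: eq_bigr => i _; apply: eq_bigr => j ij.
  by rewrite (Ex_Xin _ _ ij) (Ex_Yin _ _ ij).
Qed.

Let Ex_error p z : top p * Ex P (error_terms p z) =
  \sum_(1 <= i < n.+1) pw i p (z / top p).
Proof.
rewrite /error_terms ExD; [|exact: intg_sum|exact: intg_sum].
rewrite !Ex_sum// -big_split/= big_distrr/=.
by apply: eq_big_nat => i ni; rewrite pwE.
Qed.

(** Multiplied out over i != l, the products of the mean of term i with the window of term l are the
    X-X, Y-Y and both mixed terms of the expansion. *)
Let Ex_difference p z :
  Ex P (fun w => gain p z w - first_order p z w) =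
  dtail (sum_law P (zeta p) n) (z / top p)
  - \sum_(1 <= i < n.+1) (dtail (dilate F (cX i p)) (z / top p)
                          + dtail (dilate G (cY i p)) (z / top p))
  - \sum_(1 <= i < n.+1) Ex P (fun w => cr i p (z / top p) (X i w, Y i w))
  - \sum_(1 <= i < n.+1) \sum_(1 <= l < n.+1 | i != l)
      (cX i p * mean F + cY i p * mean G) * pw l p (z / top p).
Proof.
rewrite ExB; [|exact: intg_gain|exact: intg_first_order].
rewrite Ex_gain Ex_first_order.
have -> : \sum_(1 <= i < n.+1) \sum_(1 <= l < n.+1 | i != l)
      (cX i p * mean F + cY i p * mean G) * pw l p (z / top p) =
    mean F * (\sum_(1 <= i < n.+1) \sum_(1 <= l < n.+1 | i != l)
      boxX p i * wX p l z)
    + mean G * (\sum_(1 <= i < n.+1) \sum_(1 <= l < n.+1 | i != l)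
      boxY p i * wY p l z)
    + \sum_(1 <= i < n.+1) \sum_(1 <= l < n.+1 | i != l)
        (boxX p i * mean F * wY p l z + boxY p l * mean G * wX p i z).
  (* The products of a Y mean with an X window carry their indices in the opposite order; swapping
     the two summations matches them. *)
  have -> : \sum_(1 <= i < n.+1) \sum_(1 <= l < n.+1 | i != l)
        (boxX p i * mean F * wY p l z + boxY p l * mean G * wX p i z) =
      \sum_(1 <= i < n.+1) \sum_(1 <= l < n.+1 | i != l)
        (boxX p i * mean F * wY p l z + boxY p i * mean G * wX p l z).
    under eq_bigr do rewrite big_split/=.
    rewrite big_split/= [X in _ + X]sum_offdiagC -big_split/=.
    by apply: eq_bigr => i _; rewrite -big_split.
  rewrite !big_distrr/= -!big_split/=; apply: eq_big_nat => i ni.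
  rewrite !big_distrr/= -!big_split/= big_nat_cond [RHS]big_nat_cond.
  apply: eq_bigr => l /andP[nl _]; rewrite pwE//.
  by rewrite -(relX_top lo0 p ni) -(relY_top lo0 p ni) /cX /cY; ring.
by rewrite [\sum_(1 <= i < n.+1) (dtail _ _ + dtail _ _)]big_split/=; ring.
Qed.

Lemma first_order_expansion eps : 0 < eps -> \forall z \near +oo, forall p,
  `|Ex P (fun w => gain p z w - first_order p z w)| <=
  eps * Ex P (error_terms p z).
Proof.
move=> eps0; have [C C0 DC] := scale_le_window.
have hi0 : 0 < hi by exact: lt_le_trans lohi.
(* [C] converts the scale into the sum of windows, and [hi] bounds the factor [top p] between that
   sum and the expected error terms. *)
have e0 : 0 < eps / (C * hi) by rewrite divr_gt0// mulr_gt0.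
have N := near_div_top n lo0 lohi (normalised_negl e0).
have {}DC := near_div_top n lo0 lohi DC.
apply: filterS2 N DC => z N DC p; rewrite Ex_difference.
(* The first [p] fixes the point z / top p, the second selects the member of the family. *)
apply: le_trans (N p p) _.
have Err0 : 0 <= Ex P (error_terms p z).
  by apply: Ex_ge0 => w; apply: addr_ge0; apply: sumr_ge0.
have -> : eps * Ex P (error_terms p z) =
  eps / (C * hi) * (C * (hi * Ex P (error_terms p z))).
  by field; rewrite !gt_eqF.
rewrite ler_pM2l// (le_trans (DC p p))// ler_pM2l// -Ex_error ler_wpM2r//.
exact: top_le.
Qed.

End deterministic_weights.

(** * Random weights *)

Section decoupling.
Context d (T : measurableType d) (R : realType) (P : probability T R).
Variables gZ gW : set (set T).
Hypotheses (mgZ : gZ `<=` measurable) (mgW : gW `<=` measurable).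
Hypothesis indep : forall A B, <<s gZ >> A -> <<s gW >> B ->
  P (A `&` B) = (P A * P B)%E.

Local Notation TZ := (g_sigma_algebraType gZ).
Local Notation TW := (g_sigma_algebraType gW).

(** Both groups of variables live on the same space; each is represented by the identity onto that
    space with the smaller sigma-algebra it generates. *)
Let measurable_toZ : measurable_fun setT (fun w : T => w : TZ).
Proof.
move=> _ B mB; rewrite setTI; move: B mB; apply: smallest_sub => //.
exact: sigma_algebra_measurable.
Qed.

Let measurable_toW : measurable_fun setT (fun w : T => w : TW).
Proof.
move=> _ B mB; rewrite setTI; move: B mB; apply: smallest_sub => //.
exact: sigma_algebra_measurable.
Qed.

Let measurable_diag : measurable_fun setT (fun w : T => (w : TZ, w : TW)).
Proof. exact: measurable_fun_pair. Qed.

Let PZ : probability TZ R := distribution P (mfun_of measurable_toZ).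
Let PW : probability TW R := distribution P (mfun_of measurable_toW).
Let PD : probability (TZ * TW)%type R := distribution P (mfun_of measurable_diag).

Let diag_law S : measurable S -> (PZ \x PW)%E S = PD S.
Proof. by move: S; apply: product_measure_unique => A B mA mB; exact: indep. Qed.

Variable f : TZ * TW -> R.
Hypothesis mf : measurable_fun setT f.
Hypothesis idiag : intg P (fun w => f (w, w)).
Hypothesis isec : forall v, intg P (fun w => f (w, v)).

Let iprod : intg (PZ \x PW)%E f.
Proof.
have /integrableP[_ h] : intg PD f by apply: intg_distribution.
apply/integrableP; split; first exact/measurable_EFinP.
rewrite (@eq_measure_integral _ _ _ _ PD)// => A mA _; exact: diag_law.
Qed.

Let measurable_section v : measurable_fun setT (fun w => f (w, v)).
Proof. exact: (measurableT_comp mf (pair2_measurable v)). Qed.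

Let isecZ v : intg PZ (fun w => f (w, v)).
Proof. by apply: intg_distribution => //; exact: isec. Qed.

Let ExZ_sec v : Ex PZ (fun w => f (w, v)) = Ex P (fun w => f (w, v)).
Proof. by rewrite Ex_distribution//; exact: isec. Qed.

Lemma intg_decouple : intg P (fun v => Ex P (fun w => f (w, v))).
Proof.
have h := intg_distributionP (intg_fubini iprod isecZ).
by move: h; congr intg; apply/funext => v /=; exact: ExZ_sec.
Qed.

(* Under independence the law of w |-> (w, w) on the product of the two
   sub-sigma-algebras is the product of the restrictions of P. *)
Lemma Ex_decouple : Ex P (fun w => f (w, w)) =
  Ex P (fun v => Ex P (fun w => f (w, v))).
Proof.
transitivity (Ex PD f); first by rewrite Ex_distribution.
transitivity (Ex (PZ \x PW)%E f).
  rewrite /Ex /Rintegral; congr fine; apply: eq_measure_integral => A mA _.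
  exact/esym/diag_law.
rewrite (Ex_fubini iprod isecZ) Ex_distribution/=.
- by apply: eq_Ex => v /=; exact: ExZ_sec.
- exact: intg_measurable (intg_fubini iprod isecZ).
- exact: intg_distributionP (intg_fubini iprod isecZ).
Qed.

End decoupling.

Section almost_sure_equality.
Context d (T : measurableType d) (R : realType) (P : probability T R).

Lemma eq_Ex_ae (S : set T) (f g : T -> R) :
  {ae P, forall w, S w} -> measurable_fun setT f -> measurable_fun setT g ->
  (forall w, S w -> f w = g w) -> Ex P f = Ex P g.
Proof.
move=> aS mf mg fg; rewrite /Ex /Rintegral; congr fine.
apply: ae_eq_integral => //; try exact/measurable_EFinP.
by apply: filterS aS => w Sw _ /=; rewrite fg.
Qed.

Lemma ae_probability1 (S : set T) : measurable S -> P S = 1%E ->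
  {ae P, forall w, S w}.
Proof.
move=> mS PS; exists (~` S); split => //; first exact: measurableC.
by rewrite probability_setC// PS subee.
Qed.

Lemma prob_natb (b : T -> bool) : measurable_fun setT b ->
  prob P [set w | b w] = Ex P (fun w => \I[b w]).
Proof. by move=> mb; rewrite Ex_natb. Qed.

Lemma expect_on_natb (U : T -> R) (b : T -> bool) :
  expect_on P U [set w | b w] = Ex P (fun w => U w * \I[b w]).
Proof.
rewrite /expect_on unlock /Ex /Rintegral; congr fine.
apply: eq_integral => w _; congr (_ * _)%:E; rewrite indicE.
by congr (_%:R); congr nat_of_bool; exact: asboolb.
Qed.

End almost_sure_equality.

Section clamp.
Context {R : realType} (lo hi : R).

(** The weights are bounded only almost surely and for indices 1..n, while [box] asks for bounds at
    every point and index. Clamped weights satisfy them and almost surely equal the true ones for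
    those indices. *)
Definition clamp (x : R) : R := Num.max lo (Num.min x hi).

Lemma clampP x : lo <= hi -> lo <= clamp x <= hi.
Proof.
by move=> lohi; rewrite /clamp le_max lexx ge_max lohi ge_min lexx orbT.
Qed.

Lemma clamp_id x : lo <= x <= hi -> clamp x = x.
Proof. by move=> /andP[lx xh]; rewrite /clamp (min_l xh) (max_r lx). Qed.

Lemma measurable_clamp : measurable_fun setT clamp.
Proof.
by apply: measurable_maxr; [meas|apply: measurable_minr; meas].
Qed.

End clamp.

(** * Integration over the law of the weights *)

Section random_weights.
Context {R : realType} d (T : measurableType d) (P : probability T R).
Variables (F G : probability R R) (r : R) (X Y Q Qt : nat -> {mfun T >-> R}).
Variables (n : nat) (a1 b1 a2 b2 : R).
Hypothesis hr : -1 <= r <= 1.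
Hypothesis hFGM : forall i x y,
  prob P [set w | X i w <= x /\ Y i w <= y] = FGM r F G x y.
Hypothesis hindep : mutually_independent P (fun i w => (X i w, Y i w)).
Hypothesis hindepXQ : independent_families P [set: nat] [set i : nat | (0 < i)%N]
  (fun i w => (X i w, Y i w)) (fun i w => (Q i w, Qt i w)).
Hypotheses (n0 : (0 < n)%N) (ha1 : 0 < a1) (hab1 : a1 <= b1) (ha2 : 0 < a2).
Hypothesis hbounded : forall i j, (1 <= i <= n)%N -> (1 <= j <= n)%N ->
  P [set w | a1 <= discount Q i w <= b1 /\ a2 <= discount Qt j w <= b2] = 1%E.
Hypotheses (hF : class_S2tilde F) (hG : class_S2tilde G).
Hypothesis hFG : same_order (fun x => dincr F x 1) (fun x => dincr G x 1).

Let lo := Num.min a1 a2.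
Let hi := Num.max b1 b2.

Let lo0 : 0 < lo. Proof. by rewrite lt_min ha1 ha2. Qed.
Let lohi : lo <= hi.
Proof. by rewrite /lo /hi ge_min le_max (le_trans hab1). Qed.

Let W i w := clamp lo hi (discount Q i w).
Let V i w := clamp lo hi (discount Qt i w).

Let WP i w : lo <= W i w <= hi. Proof. exact: clampP. Qed.
Let VP i w : lo <= V i w <= hi. Proof. exact: clampP. Qed.

Let weights w : box lo hi := Box (WP^~ w) (VP^~ w).

Let iX i : intg P (X i). Proof. by have [iF _ _] := hF; exact: intg_X hr (hFGM i) iF. Qed.
Let iY i : intg P (Y i). Proof. by have [iG _ _] := hG; exact: intg_Y hr (hFGM i) iG. Qed.

Let measurable_discount (Z : nat -> {mfun T >-> R}) i :
  measurable_fun setT (discount Z i).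
Proof. by apply: measurable_prod => k _. Qed.

Let mW i : measurable_fun setT (W i).
Proof.
exact: (measurableT_comp (measurable_clamp lo hi) (measurable_discount Q i)).
Qed.

Let mV i : measurable_fun setT (V i).
Proof.
exact: (measurableT_comp (measurable_clamp lo hi) (measurable_discount Qt i)).
Qed.

Let clamp_le x : `|clamp lo hi x| <= hi.
Proof.
by have /andP[h ?] := clampP x lohi; rewrite ger0_norm// (le_trans (ltW lo0)).
Qed.

Let iW i : intg P (W i).
Proof. by apply: (@intg_bounded _ _ _ P _ hi) => // w; exact: clamp_le. Qed.
Let iV i : intg P (V i).
Proof. by apply: (@intg_bounded _ _ _ P _ hi) => // w; exact: clamp_le. Qed.

Let intg_weighted (A : T -> R) (x : T -> R) : intg P A ->
  measurable_fun setT x -> intg P (fun w => A w * clamp lo hi (x w)).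
Proof.
move=> iA mx; have mA := intg_measurable iA.
apply: intg_le (intgZ hi (intg_norm iA)).
  apply: measurable_mulf => //.
  exact: (measurableT_comp (measurable_clamp lo hi) mx).
by move=> w; rewrite normrM mulrC ler_pM.
Qed.

Let iXW i : intg P (fun w => X i w * W i w). Proof. exact: intg_weighted. Qed.
Let iYV i : intg P (fun w => Y i w * V i w). Proof. exact: intg_weighted. Qed.

Let gZ : set (set T) := [set A | exists i B, [/\ [set: nat] i, measurable B &
  A = (fun w => (X i w, Y i w)) @^-1` B]].
Let gW : set (set T) := [set A | exists i B, [/\ [set i : nat | (0 < i)%N] i,
  measurable B & A = (fun w => (Q i w, Qt i w)) @^-1` B]].

Let mgZ : gZ `<=` measurable.
Proof.
move=> _ [i [B [_ mB ->]]]; rewrite -[X in measurable X]setTI.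
have m : measurable_fun setT (fun w => (X i w, Y i w)) by exact: measurable_fun_pair.
exact: m.
Qed.

Let mgW : gW `<=` measurable.
Proof.
move=> _ [i [B [_ mB ->]]]; rewrite -[X in measurable X]setTI.
have m : measurable_fun setT (fun w => (Q i w, Qt i w)) by exact: measurable_fun_pair.
exact: m.
Qed.

Local Notation TZ := (g_sigma_algebraType gZ).
Local Notation TW := (g_sigma_algebraType gW).

Let preimage_fst B : measurable B -> measurable (fst @^-1` B : set (R * R)).
Proof.
move=> mB; rewrite -[X in measurable X]setTI; exact: measurable_fst.
Qed.

Let preimage_snd B : measurable B -> measurable (snd @^-1` B : set (R * R)).
Proof.
move=> mB; rewrite -[X in measurable X]setTI; exact: measurable_snd.
Qed.

Let mXZ i : measurable_fun setT (fun u : TZ * TW => X i u.1).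
Proof.
have m : measurable_fun setT (fun w : TZ => X i w).
  move=> _ B mB; rewrite setTI; apply: sub_sigma_algebra.
  by exists i, (fst @^-1` B); split => //; exact: preimage_fst.
exact: (measurableT_comp m measurable_fst).
Qed.

Let mYZ i : measurable_fun setT (fun u : TZ * TW => Y i u.1).
Proof.
have m : measurable_fun setT (fun w : TZ => Y i w).
  move=> _ B mB; rewrite setTI; apply: sub_sigma_algebra.
  by exists i, (snd @^-1` B); split => //; exact: preimage_snd.
exact: (measurableT_comp m measurable_fst).
Qed.

Let mWW i : measurable_fun setT (fun u : TZ * TW => W i u.2).
Proof.
have m : measurable_fun setT (fun w : TW => discount Q i w).
  (* [TW] is generated by the weights of index k >= 1; the product starts at 1, so each factor is
     measurable for it. *)
  apply: measurable_prod => k; rewrite mem_index_iota => /andP[k1 _].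
  move=> _ B mB; rewrite setTI; apply: sub_sigma_algebra.
  by exists k, (fst @^-1` B); split => //; exact: preimage_fst.
have m' := measurableT_comp (measurable_clamp lo hi) m.
exact: (measurableT_comp m' measurable_snd).
Qed.

Let mVW i : measurable_fun setT (fun u : TZ * TW => V i u.2).
Proof.
have m : measurable_fun setT (fun w : TW => discount Qt i w).
  apply: measurable_prod => k; rewrite mem_index_iota => /andP[k1 _].
  move=> _ B mB; rewrite setTI; apply: sub_sigma_algebra.
  by exists k, (snd @^-1` B); split => //; exact: preimage_snd.
have m' := measurableT_comp (measurable_clamp lo hi) m.
exact: (measurableT_comp m' measurable_snd).
Qed.

Let gainW z w := gain X Y n (weights w) z w.
Let firstW z w := first_order F G X Y n (weights w) z w.
Let errorW z w := error_terms X Y n (weights w) z w.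

Let mXW i : measurable_fun setT (fun u : TZ * TW => X i u.1 * W i u.2).
Proof. exact: measurable_mulf. Qed.
Let mYV i : measurable_fun setT (fun u : TZ * TW => Y i u.1 * V i u.2).
Proof. exact: measurable_mulf. Qed.

(** Weights are read at [u.2] and the pairs at [u.1]: decoupling requires joint measurability for
    the two small sigma-algebras, not just measurability on [T]. *)
Let measurable_difference z : measurable_fun setT (fun u : TZ * TW =>
  gain X Y n (weights u.2) z u.1 - first_order F G X Y n (weights u.2) z u.1).
Proof.
apply: measurable_subf.
  apply: measurable_natb; apply: measurable_ltf; first exact: measurable_cst.
  by apply: measurable_addf; exact: measurable_sum.
exact: (measurable_first_order_terms n (mean F) (mean G) z mXW mYV mWW mVW).
Qed.

Let measurable_errors z : measurable_fun setT (fun u : TZ * TW =>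
  error_terms X Y n (weights u.2) z u.1).
Proof.
apply: measurable_addf; apply: measurable_sum => i.
  by have := mXW i => ?; rewrite /inX/=; meas.
by have := mYV i => ?; rewrite /inY/=; meas.
Qed.

Let intg_gainW z : intg P (gainW z).
Proof.
apply: intg_natb; apply: measurable_ltf; first exact: measurable_cst.
by apply: measurable_addf; apply: measurable_sum => i /=;
  apply: intg_measurable; [exact: iXW|exact: iYV].
Qed.

Let intg_firstW z : intg P (firstW z).
Proof. exact: (intg_first_order_terms n (mean F) (mean G) z iXW iYV iW iV). Qed.

Let intg_errorW z : intg P (errorW z).
Proof.
apply: intgD; apply: intg_sum => i _; apply: intg_natb.
  by have := intg_measurable (iXW i) => ?; rewrite /inX/=; meas.
by have := intg_measurable (iYV i) => ?; rewrite /inY/=; meas.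
Qed.

(** Decoupling turns each expectation into an average over v of an expectation with the weights
    frozen at v, and the uniform estimate holds for every v. *)
Let expansionW eps : 0 < eps -> \forall z \near +oo,
  `|Ex P (gainW z) - Ex P (firstW z)| <= eps * Ex P (errorW z).
Proof.
move=> eps0.
have := first_order_expansion hr hFGM hindep hF hG hFG lo0 lohi n0 eps0.
apply: filterS => z H.
rewrite -ExB//.
have d1 v : intg P (fun w => gain X Y n (weights v) z w -
    first_order F G X Y n (weights v) z w).
  by apply: intgB; [exact: intg_gain|exact: (intg_first_order hr hFGM hF hG n (weights v) z)].
have d2 v : intg P (fun w => error_terms X Y n (weights v) z w).
  exact: intg_error_terms.
have e1 := Ex_decouple mgZ mgW hindepXQ (measurable_difference z)
  (intgB (intg_gainW z) (intg_firstW z)) d1.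
have e2 := Ex_decouple mgZ mgW hindepXQ (measurable_errors z) (intg_errorW z) d2.
have j1 := intg_decouple mgZ mgW hindepXQ (measurable_difference z)
  (intgB (intg_gainW z) (intg_firstW z)) d1.
have j2 := intg_decouple mgZ mgW hindepXQ (measurable_errors z) (intg_errorW z) d2.
rewrite [X in `|X|]e1 [X in _ * X]e2 -ExZ//.
apply: Ex_norm_le; [exact: intg_measurable j1|exact: intgZ|].
by move=> v; exact: (H (weights v)).
Qed.

Let exact w : Prop := forall i, (1 <= i < n.+1)%N ->
  W i w = discount Q i w /\ V i w = discount Qt i w.

Let ae_exact : {ae P, forall w, exact w}.
Proof.
apply: ae_foralln => i; have [ni|ni] := boolP (1 <= i < n.+1)%N; last exact: aeW.
have mS : measurable [set w | a1 <= discount Q i w <= b1 /\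
    a2 <= discount Qt i w <= b2].
  have m1 := measurable_discount Q i; have m2 := measurable_discount Qt i.
  have -> : [set w | a1 <= discount Q i w <= b1 /\ a2 <= discount Qt i w <= b2] =
      [set w | (a1 <= discount Q i w <= b1) && (a2 <= discount Qt i w <= b2)].
    by apply/seteqP; split => w /= /andP.
  by apply: measurable_bool_set; meas.
apply: filterS (ae_probability1 mS (hbounded ni ni)) => w /= [/andP[? ?] /andP[? ?]] _.
by split; apply: clamp_id; rewrite /lo /hi ge_min le_max; apply/andP; split;
  apply/orP; [left|left|right|right].
Qed.

Let mU i : measurable_fun setT (discounted X Q i).
Proof. exact: measurable_mulf. Qed.
Let mVt i : measurable_fun setT (discounted Y Qt i).
Proof. exact: measurable_mulf. Qed.

Let UE i w : exact w -> (1 <= i < n.+1)%N -> X i w * W i w = discounted X Q i w.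
Proof. by move=> ex ni; have [-> _] := ex i ni. Qed.
Let VE i w : exact w -> (1 <= i < n.+1)%N -> Y i w * V i w = discounted Y Qt i w.
Proof. by move=> ex ni; have [_ ->] := ex i ni. Qed.

Let mXWT i : measurable_fun setT (fun w => X i w * W i w).
Proof. exact: measurable_mulf. Qed.
Let mYVT i : measurable_fun setT (fun w => Y i w * V i w).
Proof. exact: measurable_mulf. Qed.

Let eq_gt (A B : T -> R) z : measurable_fun setT A -> measurable_fun setT B ->
  (forall w, exact w -> A w = B w) ->
  Ex P (fun w => \I[z < A w]) = prob P [set w | B w > z].
Proof.
move=> mA mB AB; rewrite prob_natb; last by meas.
by apply: (eq_Ex_ae ae_exact); [meas|meas|move=> w /AB ->].
Qed.

Let eq_window (A B : T -> R) z : measurable_fun setT A -> measurable_fun setT B ->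
  (forall w, exact w -> A w = B w) ->
  Ex P (fun w => \I[z < A w <= z + 1]) = prob P (in_window B z).
Proof.
move=> mA mB AB; rewrite /in_window prob_natb; last by meas.
by apply: (eq_Ex_ae ae_exact); [meas|meas|move=> w /AB ->].
Qed.

Let eq_expect (A B C E : T -> R) z :
  measurable_fun setT A -> measurable_fun setT B ->
  measurable_fun setT C -> measurable_fun setT E ->
  (forall w, exact w -> A w = B w) -> (forall w, exact w -> C w = E w) ->
  Ex P (fun w => C w * \I[z < A w <= z + 1]) = expect_on P E (in_window B z).
Proof.
move=> mA mB mC mE AB CE; rewrite /in_window expect_on_natb.
by apply: (eq_Ex_ae ae_exact); [meas|meas|move=> w ew; rewrite AB// CE].
Qed.

(** Off a null set clamped and true weights agree, so [expansionW] is rewritten term by term into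
    probabilities and expectations with the true weights. *)
Lemma random_expansion eps : 0 < eps -> \forall z \near +oo,
  `|prob P [set w | discounted_sum X Q n w + discounted_sum Y Qt n w > z]
    - (\sum_(1 <= i < n.+1) prob P [set w | discounted X Q i w > z]
    + mean F * (\sum_(1 <= i < n.+1) \sum_(1 <= l < n.+1 | i != l)
        expect_on P (discount Q i) (in_window (discounted X Q l) z))
    + \sum_(1 <= j < n.+1) prob P [set w | discounted Y Qt j w > z]
    + mean G * (\sum_(1 <= j < n.+1) \sum_(1 <= l < n.+1 | j != l)
        expect_on P (discount Qt j) (in_window (discounted Y Qt l) z))
    + \sum_(1 <= i < n.+1) \sum_(1 <= j < n.+1)
        (expect_on P (discounted X Q i) (in_window (discounted Y Qt j) z)
         + expect_on P (discounted Y Qt j) (in_window (discounted X Q i) z)))|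
  <= eps * (\sum_(1 <= i < n.+1) prob P (in_window (discounted X Q i) z)
    + \sum_(1 <= j < n.+1) prob P (in_window (discounted Y Qt j) z)).
Proof.
move=> eps0; apply: filterS (expansionW eps0) => z.
have -> : Ex P (gainW z) =
    prob P [set w | discounted_sum X Q n w + discounted_sum Y Qt n w > z].
  apply: (@eq_gt (fun w => \sum_(1 <= i < n.+1) X i w * W i w
      + \sum_(1 <= i < n.+1) Y i w * V i w)).
  - apply: measurable_addf; apply: measurable_sum => i; first exact: mXWT.
    exact: mYVT.
  - apply: measurable_addf; apply: measurable_sum => i; first exact: mU.
    exact: mVt.
  - move=> w ew; congr (_ + _); apply: eq_big_nat => i ni; first exact: UE.
    exact: VE.
have -> : Ex P (errorW z) =
    \sum_(1 <= i < n.+1) prob P (in_window (discounted X Q i) z)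
    + \sum_(1 <= j < n.+1) prob P (in_window (discounted Y Qt j) z).
  have iwX i : intg P (fun w => \I[z < X i w * W i w <= z + 1]).
    by have := mXWT i => ?; apply: intg_natb; meas.
  have iwY i : intg P (fun w => \I[z < Y i w * V i w <= z + 1]).
    by have := mYVT i => ?; apply: intg_natb; meas.
  have sX : intg P (fun w => \sum_(1 <= i < n.+1) \I[z < X i w * W i w <= z + 1]).
    by apply: intg_sum => i _; exact: iwX.
  have sY : intg P (fun w => \sum_(1 <= i < n.+1) \I[z < Y i w * V i w <= z + 1]).
    by apply: intg_sum => i _; exact: iwY.
  rewrite [LHS](ExD sX sY) !Ex_sum//; congr (_ + _);
    apply: eq_big_nat => i ni; apply: eq_window => //.
  - by move=> w ew; exact: UE.
  - by move=> w ew; exact: VE.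
rewrite [Ex P (firstW z)](Ex_first_order_terms n (mean F) (mean G) z iXW iYV iW iV).
have eq_center (a b b' c : R) : b = b' -> `|a - b| <= c -> `|a - b'| <= c.
  by move=> ->.
apply: eq_center; congr (_ + _ * _ + _ + _ * _ + _).
- by apply: eq_big_nat => i ni; apply: eq_gt => // w ew; exact: UE.
- apply: eq_big_nat => i ni; rewrite big_nat_cond [RHS]big_nat_cond.
  apply: eq_bigr => l /andP[nl _]; apply: eq_expect => // w ew; first exact: UE.
  by have [] := ew i ni.
- by apply: eq_big_nat => i ni; apply: eq_gt => // w ew; exact: VE.
- apply: eq_big_nat => i ni; rewrite big_nat_cond [RHS]big_nat_cond.
  apply: eq_bigr => l /andP[nl _]; apply: eq_expect => // w ew; first exact: VE.
  by have [] := ew i ni.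
- apply: eq_big_nat => i ni; apply: eq_big_nat => j nj; congr (_ + _);
    apply: eq_expect => // w ew; by [exact: UE|exact: VE].
Qed.

End random_weights.

Theorem proposition4p2
  (R : realType) (d : measure_display) (T : measurableType d)
  (P : probability T R)
  (F G : probability R R) (r : R)
  (* (X 0, Y 0) is the generic vector (X, Y); Q and Qt are the R_i and
     R~_i, of which only the indices i >= 1 are meaningful *)
  (X Y Q Qt : nat -> {RV P >-> R})
  (n : nat) (a1 b1 a2 b2 : R)
  (hFtail : forall x, 0 < x -> 0 < dtail F x)
  (hGtail : forall x, 0 < x -> 0 < dtail G x)
  (hr : -1 <= r <= 1)
  (hFGM : forall i x y,
      prob P [set w | X i w <= x /\ Y i w <= y] = FGM r F G x y)
  (hindep : mutually_independent P (fun i w => (X i w, Y i w)))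
  (hpos : forall i, (0 < i)%N -> {ae P, forall w, 0 < Q i w /\ 0 < Qt i w})
  (hindepXQ : independent_families P [set: nat] [set i : nat | (0 < i)%N]
      (fun i w => (X i w, Y i w)) (fun i w => (Q i w, Qt i w)))
  (hn : (0 < n)%N)
  (ha1 : 0 < a1) (hab1 : a1 <= b1) (ha2 : 0 < a2) (hab2 : a2 <= b2)
  (hbounded : forall i j, (1 <= i <= n)%N -> (1 <= j <= n)%N ->
      P [set w | a1 <= discount Q i w <= b1 /\
                 a2 <= discount Qt j w <= b2] = 1%E)
  (hF : class_S2tilde F) (hG : class_S2tilde G)
  (hFG : same_order (fun x => dincr F x 1) (fun x => dincr G x 1)) :
  let U := discounted X Q in
  let V := discounted Y Qt in
  let Dsum (x y : R) : R :=
    prob P [set w | discounted_sum X Q n w + discounted_sum Y Qt n w > x + y] in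
  let expansion (z : R) : R :=
    \sum_(1 <= i < n.+1) prob P [set w | U i w > z]
    + mean F * (\sum_(1 <= i < n.+1) \sum_(1 <= l < n.+1 | i != l)
                  expect_on P (discount Q i) (in_window (U l) z))
    + \sum_(1 <= j < n.+1) prob P [set w | V j w > z]
    + mean G * (\sum_(1 <= j < n.+1) \sum_(1 <= l < n.+1 | j != l)
                  expect_on P (discount Qt j) (in_window (V l) z))
    + \sum_(1 <= i < n.+1) \sum_(1 <= j < n.+1)
        (expect_on P (U i) (in_window (V j) z)
         + expect_on P (V j) (in_window (U i) z)) in
  let error_scale (z : R) : R :=
    \sum_(1 <= i < n.+1) prob P (in_window (U i) z)
    + \sum_(1 <= j < n.+1) prob P (in_window (V j) z) in
  little_o (filter_prod (pinfty_nbhs R) (pinfty_nbhs R))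
    (fun p : R * R => Dsum p.1 p.2 - expansion (p.1 + p.2))
    (fun p : R * R => error_scale (p.1 + p.2)).
Proof.
move=> U V Dsum expansion error_scale eps eps0.
have [z0 [_ Hz0]] := random_expansion hr hFGM hindep hindepXQ hn ha1 hab1 ha2
  hbounded hF hG hFG eps0.
(* Only x + y matters, and x > |z0| with y > 0 forces x + y > z0. *)
exists (`]`|z0|, +oo[%classic, `]0, +oo[%classic); first split => /=.
- by exists `|z0|; split; [exact: num_real|move=> x; rewrite /= in_itv/= andbT].
- by exists 0; split; [exact: num_real|move=> x; rewrite /= in_itv/= andbT].
move=> [x y] /= []; rewrite !in_itv/= !andbT => z0x y0.
have {}Hz0 := Hz0 (x + y); apply: le_trans (Hz0 _) _.
  by have := ler_norm z0; lra.
by apply: ler_wpM2l; [exact: ltW|exact: ler_norm].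
Qed.
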